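(* Let $n\ge 3$ be odd, let $K$ be an algebraically closed field containing an element $v$ transcendental over a subfield $F\subseteq K$, and let $TL(\widehat{A}_{n-1})$ be the affine Temperley--Lieb algebra over $K$ (realised inside $D_n$ as below). For a finite-dimensional irreducible representation $\rho$ of $TL(\widehat{A}_{n-1})$ other than the trivial one, let $t$ be the unique integer such that $\rho$ vanishes on every diagram of $TL(\widehat{A}_{n-1})$ with fewer than $t$ vertical edges but not on all diagrams of $TL(\widehat{A}_{n-1})$ with at most $t$ vertical edges, and let $\alpha\in K\setminus\{0\}$ be the scalar satisfying $\rho([S_1,S_2,w+2])=\alpha\,\rho([S_1,S_2,w])$ for all $S_1,S_2\in \mathrm{Ann}(n)\cap I(t)$ and all $w\in\mathbb{Z}$ with $[S_1,S_2,w]\in TL(\widehat{A}_{n-1})$. Then $\rho\mapsto(\alpha,t)$ is a well-defined bijection from the isomorphism classes of nontrivial finite-dimensional irreducible representations of $TL(\widehat{A}_{n-1})$ over $K$ onto the set of pairs $(\alpha,t)$ with $t$ an odd integer, $1\le t\le n-2$, and $\alpha\in K\setminus\{0\}$. The only other finite-dimensional irreducible representation is the trivial one: the one-dimensional representation sending the identity to $1$ and every generator $E_i$ to $0$.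
   Context: Put $[2]=v+v^{-1}$. An affine $n$-diagram consists of the nodes $\mathbb{Z}\times\{0,1\}\subset\mathbb{R}^2$ (bottom row $\mathbb{Z}\times\{0\}$, top row $\mathbb{Z}\times\{1\}$) together with curves called edges such that: (i) every node is an endpoint of exactly one edge; (ii) every edge lies in the strip $\mathbb{R}\times[0,1]$; (iii) an edge not joining two nodes is an infinite horizontal line meeting no node, and there are finitely many such edges; (iv) no two edges intersect; (v) the diagram is invariant under horizontal translation by $n$. Diagrams are taken up to isotopy; equivalently they are drawn on a cylinder with $n$ nodes labelled $1,\dots,n$ (indices mod $n$) on a top circle and on a bottom circle. An edge is vertical if it joins a top node to a bottom node, horizontal if it joins two nodes in the same row. The product $AB$ of two diagrams is formed by placing $A$ on top of $B$, identifying the bottom row of $A$ with the top row of $B$, and removing the $x$ closed loops formed, giving a diagram $C$; then $AB=[2]^xC$. $D_n$ is the $K$-algebra with basis the affine $n$-diagrams and this multiplication. For $1\le i\le n$, $E_i$ is the diagram having, for each $k\equiv i\pmod n$, minimal horizontal edges joining $(k,1)$ to $(k+1,1)$ and $(k,0)$ to $(k+1,0)$, and straight vertical edges joining $(j,0)$ to $(j,1)$ for all $j\not\equiv i,i+1 \pmod n$. $TL(\widehat{A}_{n-1})$ is the subalgebra of $D_n$ generated by $E_1,\dots,E_n$; its diagrams are the identity diagram and the diagrams having at least one horizontal edge and meeting each line $x=i+\tfrac12$ ($i\in\mathbb{Z}$) an even number of times (minimal count over isotopic representatives). An involution $S$ of $\{1,\dots,n\}$ is annular if for each pair $i<j$ interchanged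 by $S$: $S(\{i,\dots,j\})=\{i,\dots,j\}$, and $\{i,\dots,j\}$ contains either no fixed point of $S$ or all fixed points of $S$. $\mathrm{Ann}(n)$ is the set of annular involutions, $I(t)$ the set of involutions with exactly $t$ fixed points. For a diagram $D$ with a vertical edge let $w_1(D)$ be the number of pairs $(i,j)\in\mathbb{Z}^2$ with $i>j$ such that bottom node $(j,0)$ is joined to top node $(i,1)$ by an edge crossing the line $x=1/2$, $w_2(D)$ the same with $i<j$, and $w(D)=w_1(D)-w_2(D)$. Sending $D$ to $(S_1,S_2,w(D))$, where $S_1$ (resp. $S_2$) interchanges $i,j$ iff top (resp. bottom) nodes $i,j$ are joined in $D$, is a bijection from diagrams with at least one vertical edge onto triples with $S_1,S_2\in\mathrm{Ann}(n)\cap I(t)$, $t>0$, $w\in\mathbb{Z}$; $[S_1,S_2,w]$ denotes the corresponding diagram. *)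

(* Defs.v *)
From HB Require Import structures.
From mathcomp Require Import all_boot all_order all_algebra.
Set Implicit Arguments. Unset Strict Implicit. Unset Printing Implicit Defensive.
Import Order.TTheory GRing.Theory Num.Theory.
Local Open Scope ring_scope.

(* A node (x, r) : position x : int, row r (true = top row y=1, false = bottom row y=0). *)
Definition node := (int * bool)%type.

(* An affine n-diagram is recorded by its (translation-equivariant) matching of
   nodes: the partner of each node (k, r) with 0 <= k < n; the partner of
   (k + m n, r) is then (partner of (k,r)) shifted by m n. *)
Definition rdiag (n : nat) := {ffun 'I_n * bool -> node}.

Definition partner (n : nat) (D : rdiag n) (p : node) : node :=
  let k := absz (p.1 %% n%:Z)%Z in
  let m := (p.1 %/ n%:Z)%Z in
  match (insub k : option 'I_n) with
  | Some i => let q := D (i, p.2) in (q.1 + m * n%:Z, q.2)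
  | None => p
  end.

Definition resid (n : nat) (x : int) (dflt : 'I_n) : 'I_n :=
  insubd dflt (absz (x %% n%:Z)%Z).

Definition did (n : nat) : rdiag n :=
  [ffun p : 'I_n * bool => ((nat_of_ord p.1)%:Z, ~~ p.2)].

(* generator E_i (i taken mod n, represented in 'I_n; E_n = E_0) *)
Definition dE (n : nat) (i : 'I_n) : rdiag n :=
  [ffun p : 'I_n * bool =>
     let k := nat_of_ord p.1 in
     if k == nat_of_ord i then (k%:Z + 1, p.2)
     else if k == ((nat_of_ord i).+1 %% n)%N then (k%:Z - 1, p.2)
     else (k%:Z, ~~ p.2)].

(* Composition A (on top) with B (below): the middle row is the bottom row of
   A = the top row of B.  [trace A B f y down] follows the curve starting at
   middle node y, going down into B (down = true) or up into A (down = false),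
   until it reaches a node of the result; None if fuel runs out (closed loop). *)
Fixpoint trace (n : nat) (A B : rdiag n) (fuel : nat) (y : int) (down : bool)
  : option node :=
  match fuel with
  | 0 => None
  | f.+1 =>
    if down then
      let r := partner B (y, true) in
      if r.2 then trace A B f r.1 false else Some (r.1, false)
    else
      let r := partner A (y, false) in
      if r.2 then Some (r.1, true) else trace A B f r.1 true
  end.

(* the diagram C with A B = [2]^x C *)
Definition dcomp (n : nat) (A B : rdiag n) : rdiag n :=
  [ffun p : 'I_n * bool =>
     let x := (nat_of_ord p.1)%:Z in
     if p.2 then
       let q := partner A (x, true) in
       if q.2 then q else odflt (x, true) (trace A B n.+1 q.1 true)
     else
       let q := partner B (x, false) in
       if q.2 then odflt (x, false) (trace A B n.+1 q.1 false) else q].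

Definition mid_adj (n : nat) (A B : rdiag n) : rel 'I_n := fun k l =>
  let a := partner A ((nat_of_ord k)%:Z, false) in
  let b := partner B ((nat_of_ord k)%:Z, true) in
  ((~~ a.2) && (resid a.1 k == l)) || (b.2 && (resid b.1 k == l)).

Definition loop_nodes (n : nat) (A B : rdiag n) : {pred 'I_n} :=
  [pred k : 'I_n | trace A B n.+1 (nat_of_ord k)%:Z true == None].

Definition nloops (n : nat) (A B : rdiag n) : nat :=
  n_comp (mid_adj A B) (loop_nodes A B).

(* the diagrams of TL(\hat A_{n-1}): those occurring (up to scalar) in words
   in E_1..E_n, i.e. the subalgebra of D_n generated by the E_i is the span of
   these diagrams *)
Inductive inTL (n : nat) : rdiag n -> Prop :=
  | inTL_id : inTL (did n)
  | inTL_E (i : 'I_n) (D : rdiag n) : inTL D -> inTL (dcomp (dE i) D).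

Definition nvert (n : nat) (D : rdiag n) : nat :=
  #|[pred k : 'I_n | ~~ (D (k, true)).2]|.

(* S_1 (r = true) resp. S_2 (r = false): the involution of Z/n interchanging
   the residues of two nodes of row r joined in D *)
Definition rowInv (n : nat) (D : rdiag n) (r : bool) : {ffun 'I_n -> 'I_n} :=
  [ffun k : 'I_n => let q := D (k, r) in if q.2 == r then resid q.1 k else k].

Definition nmult (n : nat) (a b : int) : nat :=
  if a <= b then \sum_(j < absz (b - a + 1)) ((n%:Z %| a + j%:Z)%Z : nat) else 0%N.

(* w(D) = w_1(D) - w_2(D).  Each vertical edge (j',0)--(i',1) is a translate
   (j + m n, i + m n) of a unique edge with 0 <= j < n; it crosses x = 1/2
   iff j' <= 0 < i' (counted in w_1) or i' <= 0 < j' (counted in w_2),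
   i.e. iff -m n lies in [j, i-1] resp. [i, j-1]. *)
Definition wnum (n : nat) (D : rdiag n) : int :=
  \sum_(j : 'I_n)
    (let q := D (j, false) in
     if q.2 then
       (if (nat_of_ord j)%:Z < q.1 then (nmult n (nat_of_ord j)%:Z (q.1 - 1))%:Z
        else if q.1 < (nat_of_ord j)%:Z then - (nmult n q.1 ((nat_of_ord j)%:Z - 1))%:Z
        else 0)
     else 0).

Definition qtwo (K : fieldType) (v : K) : K := v + v^-1.

(* A d-dimensional representation of TL(\hat A_{n-1}) over K (column vectors),
   given by its values on the basis diagrams of TL(\hat A_{n-1}); linear
   extension gives a unital algebra homomorphism TL -> M_d(K). *)
Definition is_rep (n : nat) (K : fieldType) (v : K) (d : nat)
  (rho : rdiag n -> 'M[K]_d) : Prop :=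
  rho (did n) = 1%:M /\
  forall A B : rdiag n, inTL A -> inTL B ->
    rho A *m rho B = (qtwo v ^+ nloops A B) *: rho (dcomp A B).

(* irreducible: nonzero, and no invariant subspace other than 0 and K^d.
   The column subspace W is encoded by U with rowspace(U) = W^T. *)
Definition rep_irreducible (n : nat) (K : fieldType) (d : nat)
  (rho : rdiag n -> 'M[K]_d) : Prop :=
  (0 < d)%N /\
  forall U : 'M[K]_d,
    (forall D, inTL D -> (U *m (rho D)^T <= U)%MS) ->
    \rank U = 0%N \/ \rank U = d.

Definition irrep (n : nat) (K : fieldType) (v : K) (d : nat)
  (rho : rdiag n -> 'M[K]_d) : Prop :=
  is_rep v rho /\ rep_irreducible rho.

Definition rep_iso (n : nat) (K : fieldType) (d1 d2 : nat)
  (rho1 : rdiag n -> 'M[K]_d1) (rho2 : rdiag n -> 'M[K]_d2) : Prop :=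
  exists P : 'M[K]_(d1, d2),
    [/\ row_free P, row_full P & forall D, inTL D -> rho1 D *m P = P *m rho2 D].

Definition trivial_rep (n : nat) (K : fieldType) (d : nat)
  (rho : rdiag n -> 'M[K]_d) : Prop :=
  d = 1%N /\ forall i : 'I_n, rho (dE i) = 0.

Definition is_level (n : nat) (K : fieldType) (d : nat)
  (rho : rdiag n -> 'M[K]_d) (t : nat) : Prop :=
  (forall D, inTL D -> (nvert D < t)%N -> rho D = 0) /\
  exists D, [/\ inTL D, (nvert D <= t)%N & rho D <> 0].

Definition is_alpha (n : nat) (K : fieldType) (d : nat)
  (rho : rdiag n -> 'M[K]_d) (t : nat) (alpha : K) : Prop :=
  forall D D' : rdiag n, inTL D -> inTL D' -> nvert D = t ->
    rowInv D' true = rowInv D true ->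
    rowInv D' false = rowInv D false ->
    wnum D' = wnum D + 2 ->
    rho D' = alpha *: rho D.

(* Main.v *)
(* A diagram of TL is an n-periodic planar matching of the nodes that respects the
   checkerboard colouring.  Left multiplication by E_i is a local surgery on such a
   matching; since TL is generated by the E_i, associativity and the bookkeeping of
   closed loops reduce to one surgery step.

   With both rows fixed, a diagram is determined by the total displacement of its
   strands, and by the checkerboard colouring two such displacements differ by a
   multiple of 2n.  Sliding arcs along the circle is invertible left multiplication,
   and brings every diagram with t = n - 2m strands to one whose top row is
   ()()...()|...|.  Hence, for e = E_0 E_2 ... E_(2m-2), the diagrams with t strands
   in e TL e form an infinite cyclic group, generated by the shift of displacement
   2n; the latter is obtained by sliding one arc across the cut of the circle.

   If V is irreducible of level t, then e V is therefore one-dimensional and the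
   shift acts on it by a nonzero scalar alpha.  The corner e TL e acts on e V
   through (alpha, t), which determines V.  Conversely (alpha, t) is realised on the
   quotient of the module spanned by the top rows by the vectors x such that
   e TL x = 0. *)

(* The transcendence of v enters through [2] = v + v^-1 being nonzero. The factor [2]^x of a product
   can then be divided out: diagrams that are left multiples of each other are killed together by a
   representation, and e is idempotent up to a nonzero scalar. Algebraic closure enters twice. It
   gives an eigenvector of the shift in e V, and it gives a 2n-th root gam of alpha. The root is
   needed because a single slide changes the displacement by 2 and not by 2n, so the action of a
   general diagram on top rows involves powers of gam and not only of alpha. An obstacle at the
   start is that a product is defined by following paths with fuel n + 1. The fuel suffices because
   the middle nodes of a path that ends are pairwise incongruent mod n; a path that exhausts it lies
   on a closed loop. *)
Require Import Defs.
From mathcomp Require Import all_boot all_order all_algebra zify.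
From Stdlib Require Import Classical.
Set Implicit Arguments. Unset Strict Implicit. Unset Printing Implicit Defensive.
Import Order.TTheory GRing.Theory Num.Theory.
Local Open Scope ring_scope.

(** * Planar periodic matchings *)

Lemma mulz_small (k m x : int) : x = k * m -> - m < x -> x < m -> k = 0.
Proof. by move=> -> *; nia. Qed.

Lemma dvdzDM (n x k : int) : (n %| x + k * n)%Z = (n %| x)%Z.
Proof. by apply/dvdzP/dvdzP => -[l E]; [exists (l - k) | exists (l + k)]; lia. Qed.

Lemma odd_dvdzM (n : nat) (k : int) : odd n -> (2 %| k * n%:Z)%Z -> (2 %| k)%Z.
Proof. nia. Qed.

(* Bundled, so that unification supplies the hypotheses on n. *)
Record odd_nat := OddNat {
  odd_nat_val :> nat;
  odd_nat_odd : odd odd_nat_val;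
  odd_nat_ge3 : (3 <= odd_nat_val)%N }.

Definition shiftn (n : nat) (k : int) (p : node) : node := (p.1 + k * n%:Z, p.2).

Section Partner.
Variable n : odd_nat.
Let n_odd : odd n := odd_nat_odd n.
Let n_ge3 : (3 <= n)%N := odd_nat_ge3 n.
Let n_gt0 : (0 < n)%N := ltnW (ltnW n_ge3).
Implicit Types (D A B : rdiag n) (p q : node).

Lemma node_decomp p : exists (i : 'I_n) k, p = shiftn n k ((i : nat)%:Z, p.2).
Proof.
have lt_in : (absz (p.1 %% n%:Z)%Z < n)%N by lia.
exists (Ordinal lt_in), (p.1 %/ n%:Z)%Z; case: p lt_in => x r /= H.
rewrite /shiftn /=; congr pair; rewrite [LHS](divz_eq x n%:Z).
by rewrite addrC; congr (_ + _); lia.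
Qed.

Lemma partner_shift_ord D (i : 'I_n) r k :
  partner D (shiftn n k ((i : nat)%:Z, r)) = shiftn n k (D (i, r)).
Proof.
have lt_in := ltn_ord i; rewrite /partner /=.
have -> : (((i : nat)%:Z + k * n%:Z) %% n%:Z)%Z = (i : nat)%:Z.
  by rewrite addrC modzMDl modz_small //; lia.
have -> : (((i : nat)%:Z + k * n%:Z) %/ n%:Z)%Z = k.
  by rewrite addrC divzMDl ?divz_small ?addr0 //; lia.
by rewrite absz_nat valK.
Qed.

Lemma partner_ord D (i : 'I_n) r : partner D ((i : nat)%:Z, r) = D (i, r).
Proof.
have := partner_shift_ord D i r 0; rewrite /shiftn !mul0r !addr0 => ->.
by case: (D _).
Qed.

Lemma shiftnD k l p : shiftn n k (shiftn n l p) = shiftn n (l + k) p.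
Proof. by rewrite /shiftn /= mulrDl addrA. Qed.

Lemma shiftn0 p : shiftn n 0 p = p.
Proof. by rewrite /shiftn mul0r addr0 -surjective_pairing. Qed.

Lemma partner_shift D k p : partner D (shiftn n k p) = shiftn n k (partner D p).
Proof.
have [i [l ->]] := node_decomp p.
by rewrite shiftnD !partner_shift_ord shiftnD.
Qed.

Lemma partner_ext D A : partner D =1 partner A -> D = A.
Proof. by move=> eqDA; apply/ffunP=> -[i r]; rewrite -!partner_ord. Qed.

Lemma equivariant_ext (f g : node -> node) :
  (forall k p, f (shiftn n k p) = shiftn n k (f p)) ->
  (forall k p, g (shiftn n k p) = shiftn n k (g p)) ->
  (forall (i : 'I_n) r, f ((i : nat)%:Z, r) = g ((i : nat)%:Z, r)) -> f =1 g.
Proof.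
by move=> fsh gsh eqfg p; have [i [l ->]] := node_decomp p; rewrite fsh gsh eqfg.
Qed.

Lemma partner_did p : partner (did n) p = (p.1, ~~ p.2).
Proof.
apply: (equivariant_ext (f := partner (did n)) (g := fun q => (q.1, ~~ q.2))) => [k q|k q|i r].
- exact: partner_shift.
- by [].
- by rewrite partner_ord ffunE.
Qed.

Lemma resid_shift (i d : 'I_n) k : resid ((i : nat)%:Z + k * n%:Z) d = i.
Proof.
have lt_in := ltn_ord i; rewrite /resid addrC modzMDl modz_small ?absz_nat; last by lia.
by rewrite /insubd valK.
Qed.

Lemma residE x (d : 'I_n) : ((resid x d : nat)%:Z = (x %% n%:Z)%Z).
Proof.
have [i [k [->]]] := node_decomp (x, true).
rewrite resid_shift addrC modzMDl modz_small //.
by have := ltn_ord i; lia.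
Qed.

Lemma resid_eq x y (d d' : 'I_n) :
  (resid x d == resid y d') = (n%:Z %| x - y)%Z.
Proof.
rewrite -eqz_mod_dvd -(residE x d) -(residE y d').
by apply/eqP/eqP => [->|] //; move=> h; apply: val_inj => /=; lia.
Qed.

Lemma node_resid x (d : 'I_n) r : exists k, (x, r) = shiftn n k ((resid x d : nat)%:Z, r).
Proof.
have [i [k [->]]] := node_decomp (x, true).
by exists k; rewrite resid_shift.
Qed.

End Partner.

(* [hbelow p z]: z lies on the row of p, to its left.  For an edge {p, q} the
   sum modulo 2 of [hbelow p z] and [hbelow q z] tells on which side of the
   edge z lies, so non-crossing of two edges becomes additive in each edge. *)
Definition hbelow (p z : node) : bool := (p.2 == z.2) && (z.1 < p.1).

Definition side (f : node -> node) (p z : node) := hbelow p z (+) hbelow (f p) z.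

(* The checkerboard colouring of the nodes, which every edge of a diagram of TL
   respects.  It makes arcs have odd length and strands have even displacement;
   as n is odd, this is what distinguishes TL inside D_n. *)
Definition parity_node (p : node) : bool := (2 %| p.1 + (p.2 : nat)%:Z)%Z.

(** For an edge within a row, [side] tests whether [z] lies between its ends; for a strand, whether
    [z] lies to its left. So [wf_planar] asks that both ends of every other edge be on the same
    side, without distinguishing the kinds of edges. *)
Record wf (n : nat) (f : node -> node) : Prop := Wf {
  wf_shift : forall k p, f (shiftn n k p) = shiftn n k (f p);
  wf_invol : involutive f;
  wf_parity : forall p, parity_node (f p) = ~~ parity_node p;
  wf_planar : forall p z, z != p -> z != f p -> side f p z = side f p (f z) }.

(* If f is the matching of D then [stepf n i f] is that of E_i D: [inS] is the set
   of top nodes congruent to i or i + 1, and [sw] exchanges the two ends of each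
   top arc of E_i. *)
Definition inS (n : nat) (i : int) (p : node) : bool :=
  p.2 && ((n%:Z %| p.1 - i)%Z || (n%:Z %| p.1 - i - 1)%Z).

Definition sw (n : nat) (i : int) (p : node) : node :=
  if (n%:Z %| p.1 - i)%Z then (p.1 + 1, p.2) else (p.1 - 1, p.2).

Definition stepf (n : nat) (i : int) (f : node -> node) (p : node) : node :=
  if inS n i p then sw n i p
  else let q := f p in if inS n i q then f (sw n i q) else q.

Section Step.
Variables (n : odd_nat) (i : int).
Let n_odd : odd n := odd_nat_odd n.
Let n_ge3 : (3 <= n)%N := odd_nat_ge3 n.

Local Notation Sn := (inS n i).
Local Notation sg := (sw n i).

Lemma not_dvd_small (x : int) (k : int) : x != 0 -> - n%:Z < x -> x < n%:Z -> ~~ (n%:Z %| x)%Z.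
Proof.
move=> x0 lo hi; apply/negP => /dvdzP[l xE].
by move: x0; rewrite xE (mulz_small xE lo hi) mul0r eqxx.
Qed.

Lemma dvd_subn (x y : int) : (n%:Z %| x)%Z -> (n%:Z %| y)%Z -> - n%:Z < x - y -> x - y < n%:Z -> x = y.
Proof.
move=> /dvdzP[k ->] /dvdzP[l ->] lo hi.
by have: k - l = 0; [apply: (@mulz_small _ n%:Z (k * n%:Z - l * n%:Z)); rewrite // mulrBl | move/subr0_eq->].
Qed.

Lemma inSP p : reflect (exists k, p = (i + k * n%:Z, true) \/ p = (i + 1 + k * n%:Z, true)) (Sn p).
Proof.
rewrite /inS; case: p => x [] /=; last by right=> -[k [] []].
apply: (iffP orP) => [[] /dvdzP[k E]|[k [] []->]].
- by exists k; left; congr pair; lia.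
- by exists k; right; congr pair; lia.
- by left; rewrite addrAC subrr add0r dvdz_mull.
- by right; apply/dvdzP; exists k; lia.
Qed.

Lemma sw_l k : sg (i + k * n%:Z, true) = (i + 1 + k * n%:Z, true).
Proof.
rewrite /sw /= addrAC subrr add0r dvdz_mull //; congr pair; lia.
Qed.

Lemma sw_r k : sg (i + 1 + k * n%:Z, true) = (i + k * n%:Z, true).
Proof.
rewrite /sw /=; case: ifP => [/dvdzP[l E]|_]; last by congr pair; lia.
by have := @mulz_small (l - k) n%:Z 1; lia.
Qed.

Lemma inS_shift k p : Sn (shiftn n k p) = Sn p.
Proof.
by rewrite /inS /shiftn /= (addrAC _ _ (- i)) (addrAC _ _ (- 1)) !dvdzDM.
Qed.

Lemma sw_shift k p : sg (shiftn n k p) = shiftn n k (sg p).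
Proof.
rewrite /sw /shiftn /= (addrAC _ _ (- i)) dvdzDM.
by case: ifP => _ /=; congr pair; lia.
Qed.

Lemma inS_sw s : Sn s -> Sn (sg s).
Proof.
case/inSP=> k [] ->; rewrite ?sw_l ?sw_r; apply/inSP; exists k; by [right|left].
Qed.

Lemma swK s : Sn s -> sg (sg s) = s.
Proof. by case/inSP=> k [] ->; rewrite ?sw_l ?sw_r ?sw_l. Qed.

Lemma parity_sw s : parity_node (sg s) = ~~ parity_node s.
Proof. by rewrite /sw /parity_node; case: ifP => _ /=; lia. Qed.

Lemma sw_row s : (sg s).2 = s.2.
Proof. by rewrite /sw; case: ifP. Qed.

Lemma hbelow_sw_l s z : Sn s -> z != s -> z != sg s -> hbelow (sg s) z = hbelow s z.
Proof.
case: z => z r /inSP[k [] ->]; rewrite ?sw_l ?sw_r /hbelow -!pair_eqE /=; lia.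
Qed.

Lemma hbelow_sw_r s p : Sn s -> p != s -> p != sg s -> hbelow p (sg s) = hbelow p s.
Proof.
case: p => z r /inSP[k [] ->]; rewrite ?sw_l ?sw_r /hbelow -!pair_eqE /=; lia.
Qed.

Section WithWf.
Variable f : node -> node.
Hypothesis wff : wf n f.
Let fK := wf_invol wff.
Let fsh := wf_shift wff.

Lemma wf_neq p : f p != p.
Proof.
by apply/eqP=> E; have := wf_parity wff p; rewrite E; case: parity_node.
Qed.

Lemma wf_inj : injective f.
Proof. exact: inv_inj fK. Qed.

(** Applying [f] twice would translate [p] by [2 k n], hence [k = 0]; but no node is its own
    partner, because an edge changes colour. *)
Lemma wf_not_shift k p : f p != shiftn n k p.
Proof.
apply/eqP=> E; have := wf_neq p.
have k0 : k = 0.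
  by have := fK p; rewrite E fsh E /shiftn => /(congr1 fst) /=; nia.
by rewrite E k0 /shiftn mul0r addr0 -surjective_pairing eqxx.
Qed.

(** A longer arc would cross its own translate by [n]. *)
Lemma arc_short_right x y r : f (x, r) = (y, r) -> y < x + n%:Z.
Proof.
move=> E; rewrite ltNge; apply/negP => le_y.
have neq : y != x + n%:Z.
  apply/eqP=> E'; have /eqP[] := wf_not_shift 1 (x, r).
  by rewrite E /shiftn /= mul1r E'.
have := wf_planar wff (p := (x, r)) (z := (x + n%:Z, r)).
have -> : f (x + n%:Z, r) = (y + n%:Z, r).
  by have := fsh 1 (x, r); rewrite E /shiftn /= mul1r.
rewrite /side /hbelow E -!pair_eqE /= !eqxx /=; lia.
Qed.

Lemma arc_short x y r : f (x, r) = (y, r) -> `|y - x| < n%:Z.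
Proof.
move=> E; have lt1 := arc_short_right E.
have := fK (x, r); rewrite E => /arc_short_right; lia.
Qed.

(** Two nodes of S could also be joined the other way round the circle, with displacement [n - 1] up
    to sign. As [n] is odd this is even, and the colouring excludes it. *)
Lemma wf_joined s : Sn s -> Sn (f s) -> f s = sg s.
Proof.
move=> /inSP[k Es] /inSP[l Efs].
have nshift : f s != shiftn n (l - k) s by exact: wf_not_shift.
have par := wf_parity wff s.
have short : `|(f s).1 - s.1| < n%:Z.
  by case: Es Efs => [] -> [] E; apply: (@arc_short _ _ true); rewrite E.
case: Es Efs nshift par short => [] -> [] ->;
  rewrite ?sw_l ?sw_r /shiftn /parity_node /= => nsh par sh.
- by move: nsh; rewrite -pair_eqE /= mulrBl; lia.
- congr pair; suff -> : l = k by [].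
  have ev : (2 %| (l - k) * n%:Z)%Z by lia.
  have {}ev := odd_dvdzM n_odd ev.
  nia.
- congr pair; suff -> : l = k by [].
  have ev : (2 %| (l - k) * n%:Z)%Z by lia.
  have {}ev := odd_dvdzM n_odd ev.
  nia.
- by move: nsh; rewrite -pair_eqE /= mulrBl; lia.
Qed.

Local Notation f' := (stepf n i f).

Lemma stepf_in p : Sn p -> f' p = sg p.
Proof. by rewrite /stepf => ->. Qed.

Lemma stepf_out p : ~~ Sn p -> ~~ Sn (f p) -> f' p = f p.
Proof. by rewrite /stepf => /negbTE-> /negbTE->. Qed.

Lemma stepf_via p : ~~ Sn p -> Sn (f p) -> f' p = f (sg (f p)).
Proof. by rewrite /stepf => /negbTE-> ->. Qed.

(** An edge of E_i D thus runs through at most one arc of E_i: returning to S would force [p] itself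
    into S, by [wf_joined]. *)
Lemma via_notin p : ~~ Sn p -> Sn (f p) -> ~~ Sn (f (sg (f p))).
Proof.
move=> nSp Sfp; apply: contra nSp => S2.
have := wf_joined (inS_sw Sfp) S2; rewrite swK // => /wf_inj E.
by rewrite -E inS_sw.
Qed.

Lemma stepf_notin p : ~~ Sn p -> ~~ Sn (f' p).
Proof.
move=> nSp; have [Sfp|nSfp] := boolP (Sn (f p)).
  by rewrite stepf_via // via_notin.
by rewrite stepf_out.
Qed.

Lemma stepf_shift k p : f' (shiftn n k p) = shiftn n k (f' p).
Proof.
rewrite /stepf inS_shift sw_shift fsh inS_shift sw_shift fsh.
by case: ifP => // _; case: ifP.
Qed.

Lemma stepfK : involutive f'.
Proof.
move=> p; have [Sp|nSp] := boolP (Sn p).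
  by rewrite !stepf_in ?swK ?inS_sw.
have [Sfp|nSfp] := boolP (Sn (f p)); last by rewrite (stepf_out nSp) // stepf_out ?fK.
rewrite (stepf_via nSp Sfp) stepf_via ?via_notin // fK ?inS_sw //.
by rewrite swK // fK.
Qed.

Lemma stepf_parity p : parity_node (f' p) = ~~ parity_node p.
Proof.
rewrite /stepf; case: ifP => _; first exact: parity_sw.
by case: ifP => _; rewrite !(wf_parity wff, parity_sw) ?negbK.
Qed.

(** The new edge is the concatenation of two old edges and an arc of E_i. Sides add up along it, and
    the arc contributes nothing because its ends are neighbours. *)
Lemma side_via p z : ~~ Sn p -> Sn (f p) -> ~~ Sn z ->
  side f' p z = side f p z (+) side f (sg (f p)) z.
Proof.
move=> nSp Sfp nSz; rewrite /side stepf_via // hbelow_sw_l //.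
- by case: (hbelow p z); case: (hbelow (f p) z); case: (hbelow _ z).
- by apply: contraNneq nSz => ->.
- by apply: contraNneq nSz => ->; rewrite inS_sw.
Qed.

(** Here it is [z] whose new partner is reached through an arc of E_i: the side of [z] is carried
    along an old edge, across the arc between neighbours, and along a second old edge. *)
Lemma side_across p z : Sn (f z) -> z != p -> z != f p ->
  p != sg (f z) -> f p != sg (f z) -> side f p z = side f p (f (sg (f z))).
Proof.
move=> Sfz zp zfp pw fpw; rewrite (wf_planar wff zp zfp).
rewrite -[RHS](wf_planar wff (p := p) (z := sg (f z))); [|by rewrite eq_sym..].
have pz : p != f z by apply: contraNneq zfp => ->; rewrite fK.
have fpz : f p != f z by rewrite (inj_eq wf_inj) eq_sym.
by rewrite /side !(@hbelow_sw_r (f z)).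
Qed.

Lemma stepf_planar p z : z != p -> z != f' p -> side f' p z = side f' p (f' z).
Proof.
move=> zp zfp.
have side_in q : Sn p -> q != p -> q != sg p -> side f' p q = false.
  by move=> Sp q1 q2; rewrite /side stepf_in // hbelow_sw_l // addbb.
have nfz q : q != p -> q != f' p -> (f' q != p) && (f' q != f' p).
  move=> q1 q2; apply/andP; split; last by rewrite (inj_eq (inv_inj stepfK)).
  by apply: contraNneq q2 => <-; rewrite stepfK.
have [Sp|nSp] := boolP (Sn p).
  have /andP[q1 q2] := nfz _ zp zfp; move: zfp q2; rewrite (stepf_in Sp) => zfp q2.
  by rewrite !side_in.
have [Sz|nSz] := boolP (Sn z).
  have out q : ~~ Sn q -> (q != z) && (q != sg z).
    by move=> nSq; apply/andP; split; apply: contraNneq nSq => ->; rewrite ?inS_sw.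
  have /andP[pz pz'] := out p nSp.
  have /andP[qz qz'] := out _ (stepf_notin nSp).
  by rewrite (stepf_in Sz) /side !(@hbelow_sw_r z).
have nS2 : ~~ Sn (f' z) by exact: stepf_notin.
have [Sfp|nSfp] := boolP (Sn (f p)).
- rewrite !side_via //; move: zfp; rewrite stepf_via // => zfp.
  have zu : z != f p by apply: contraNneq nSz => ->.
  have zu' : z != sg (f p) by apply: contraNneq nSz => ->; rewrite inS_sw.
  have [Sfz|nSfz] := boolP (Sn (f z)); last first.
    by rewrite stepf_out // -!(wf_planar wff).
  have wu : sg (f z) != sg (f p).
    by apply: contraNneq zp => /(congr1 sg); rewrite !swK // => /wf_inj->.
  have wu' : f p != sg (f z).
    by apply: contraNneq zfp => ->; rewrite swK // fK.
  rewrite stepf_via // (@side_across p z) ?(@side_across (sg (f p)) z) //.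
  + by rewrite eq_sym.
  + by apply: contraNneq (via_notin nSp Sfp) => ->; rewrite inS_sw.
  + by apply: contraNneq nSp => ->; rewrite inS_sw.
- move: zfp; rewrite stepf_out // => zfp.
  have E q : side f' p q = side f p q by rewrite /side stepf_out.
  rewrite !E; have [Sfz|nSfz] := boolP (Sn (f z)); last first.
    by rewrite stepf_out // (wf_planar wff zp zfp).
  rewrite stepf_via // -side_across //.
  + by apply: contraNneq nSp => ->; rewrite inS_sw.
  + by apply: contraNneq nSfp => ->; rewrite inS_sw.
Qed.

Lemma wf_stepf : wf n f'.
Proof. by split; [exact: stepf_shift | exact: stepfK | exact: stepf_parity | exact: stepf_planar]. Qed.

End WithWf.

End Step.

(** * Paths through a product *)

Lemma wf_did (n : odd_nat) : wf n (partner (did n)).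
Proof.
split=> [k p|p|p|p z].
- exact: partner_shift.
- by rewrite !partner_did //= negbK -surjective_pairing.
- by rewrite partner_did // /parity_node /=; case: p.2; lia.
- case: p z => [x r] [y s]; rewrite /side /hbelow !partner_did //= => _ _.
  by case: r; case: s; rewrite /= ?addbF.
Qed.

Lemma partner_dE (n : odd_nat) (i : 'I_n) :
  partner (dE i) =1 stepf n (i : nat)%:Z (partner (did n)).
Proof.
have n_ge3 := odd_nat_ge3 n.
apply: (equivariant_ext) => [k p|k p|k r]; first exact: partner_shift.
  exact: (stepf_shift _ (wf_did n)).
have lt_i := ltn_ord i; have lt_k := ltn_ord k.
rewrite partner_ord ffunE /stepf /inS /sw !partner_did /=.
have -> : ((n %| (k : nat)%:Z - (i : nat)%:Z)%Z) = (k == i :> nat).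
  apply/idP/eqP => [dv|->]; last by rewrite subrr dvdz0.
  by have := @dvd_subn n _ 0 dv (dvdz0 _); lia.
have -> : (n %| (k : nat)%:Z - (i : nat)%:Z - 1)%Z = (k == i.+1 %% n :> nat)%N.
  apply/idP/eqP => [dv|->].
    have [lt|ge] := ltnP i.+1 n.
      by rewrite modn_small //; have := @dvd_subn n _ 0 dv (dvdz0 _); lia.
    have -> : (i.+1 %% n = 0)%N by rewrite (_ : i.+1 = n) ?modnn; lia.
    by case/dvdzP: dv => l El; have := @mulz_small (l + 1) n%:Z k%:Z; lia.
  have [lt|ge] := ltnP i.+1 n; first by rewrite modn_small //; apply/dvdzP; exists 0; lia.
  have E : (i.+1 = n)%N by lia.
  by rewrite E modnn; apply/dvdzP; exists (-1); lia.
by case: r => /=; case: eqP => //= _; case: eqP => //= _; rewrite ?partner_did.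
Qed.

#[global] Arguments trace : simpl never.

Section Trace.
Variable n : odd_nat.
Let n_odd : odd n := odd_nat_odd n.
Let n_ge3 : (3 <= n)%N := odd_nat_ge3 n.
Variables A B : rdiag n.

(* A path in the middle row that moves down (d = true) follows an edge of B. *)
Definition layer (d : bool) : node -> node := partner (if d then B else A).

Lemma layer_shift d k p : layer d (shiftn n k p) = shiftn n k (layer d p).
Proof. exact: partner_shift. Qed.

Lemma traceS k y d :
  trace A B k.+1 y d =
  if (layer d (y, d)).2 == d then trace A B k (layer d (y, d)).1 (~~ d)
  else Some (layer d (y, d)).
Proof.
by rewrite /layer {1}/trace -/trace; case: d; case: (partner _ _) => x [].
Qed.


Lemma trace_mono k l y d z : (k <= l)%N -> trace A B k y d = Some z -> trace A B l y d = Some z.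
Proof.
elim: k l y d => [//|k IH] [//|l] y d; rewrite ltnS => le; rewrite !traceS.
by case: ifP => // _; apply: IH.
Qed.

Lemma trace_shift k c y d :
  trace A B k (y + c * n%:Z) d = omap (shiftn n c) (trace A B k y d).
Proof.
elim: k y d => [//|k IH] y d; rewrite !traceS.
have -> : layer d (y + c * n%:Z, d) = shiftn n c (layer d (y, d)).
  by rewrite -layer_shift.
by rewrite /=; case: ifP => // _; rewrite IH.
Qed.

Lemma partner_dcomp p : partner (dcomp A B) p =
  let q := layer (~~ p.2) p in
  if q.2 == p.2 then q else odflt p (trace A B n.+1 q.1 p.2).
Proof.
move: p; apply: (equivariant_ext) => [k p|k p|i r]; first exact: partner_shift.
  rewrite layer_shift /=; case: ifP => // _.
  by rewrite trace_shift; case: (trace _ _ _ _ _).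
by rewrite partner_ord ffunE /layer /=; case: r; case: (partner _ _) => x [].
Qed.

Definition ends (y : int) (d : bool) (z : node) : Prop := exists k, trace A B k y d = Some z.

Lemma ends_inj y d z z' : ends y d z -> ends y d z' -> z = z'.
Proof.
move=> [k /(trace_mono (leq_maxl k _)) E] [l /(trace_mono (leq_maxr k _))].
by rewrite E => -[].
Qed.

Lemma endsS y d z : (layer d (y, d)).2 = d ->
  ends y d z <-> ends (layer d (y, d)).1 (~~ d) z.
Proof.
move=> E; split=> [[[//|k]]|[k H]]; first by rewrite traceS E eqxx; exists k.
by exists k.+1; rewrite traceS E eqxx.
Qed.

(* The composite path from a boundary node p of the product, ending in z. *)
Definition cends (p z : node) : Prop :=
  let q := layer (~~ p.2) p in if q.2 == p.2 then z = q else ends q.1 p.2 z.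

(** The middle node reached after [j] edges, and [None] once the path has left the middle row. *)
Fixpoint mid (j : nat) (y : int) (d : bool) : option int :=
  if j is j'.+1 then
    if (layer d (y, d)).2 == d then mid j' (layer d (y, d)).1 (~~ d) else None
  else Some y.

Lemma trace_None_mid j y d : trace A B j y d = None -> exists y', mid j y d = Some y'.
Proof.
elim: j y d => [|j IH] y d; first by exists y.
by rewrite traceS /=; case: ifP => // _ /IH.
Qed.

Lemma mid_trace j k y d y' : mid j y d = Some y' ->
  trace A B (j + k) y d = trace A B k y' (d (+) odd j).
Proof.
elim: j y d => [|j IH] y d; first by case=> <-; rewrite addbF.
by rewrite addSn traceS /=; case: ifP => // _ /IH->; case: d; case: (odd j).
Qed.

Lemma mid_add j k y d y' : mid j y d = Some y' -> mid (j + k) y d = mid k y' (d (+) odd j).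
Proof.
elim: j y d => [|j IH] y d; first by case=> <-; rewrite addbF.
by rewrite addSn /=; case: ifP => // _ /IH->; case: d; case: (odd j).
Qed.

Lemma mid_None_add j k y d : mid j y d = None -> mid (j + k) y d = None.
Proof.
elim: j y d => [//|j IH] y d; rewrite addSn /=; case: ifP => // _; exact: IH.
Qed.

Hypothesis wfA : wf n (partner A).
Hypothesis wfB : wf n (partner B).

Lemma wf_layer d : wf n (layer d). Proof. by case: d. Qed.

(** On such a path of odd length the last edge is a translate of the first one, reversed. Removing
    both shortens the path by two; in the end a single edge would join a node to its own
    translate. *)
Lemma mid_odd_not_shift j y d c : odd j -> mid j y d <> Some (y + c * n%:Z).
Proof.
have [m] := ubnP j; elim: m j y d => [//|m IH] [//|[|j]] y d.
  rewrite /=; case: ifP => // /eqP E _ _ [Ey].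
  have /eqP[] := wf_not_shift (wf_layer d) c (y, d).
  by rewrite [LHS]surjective_pairing E Ey.
rewrite !ltnS /= negbK => lejm oddj; rewrite -/(mid j.+1 _ _); case: ifP => // /eqP E1.
set y1 := (layer d (y, d)).1; have Ly : layer d (y, d) = (y1, d).
  by rewrite [LHS]surjective_pairing E1.
move=> Emid; case Ej: (mid j y1 (~~ d)) => [y2|]; last first.
  by have := @mid_None_add j 1 y1 (~~ d); rewrite Ej addn1 Emid => /(_ erefl).
have := mid_add 1 Ej; rewrite addn1 Emid oddj addNb addbT negbK /=.
case: ifP => // /eqP E2 [E3].
have Ly2 : layer d (y2, d) = (y + c * n%:Z, d) by rewrite [LHS]surjective_pairing E2 E3.
have : layer d (y + c * n%:Z, d) = (y1 + c * n%:Z, d).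
  by have := layer_shift d c (y, d); rewrite Ly.
rewrite -Ly2 (wf_invol (wf_layer d)) => -[E4]; rewrite E4 in Ej.
exact: (IH _ _ _ (ltnW lejm) oddj Ej).
Qed.

(** After an even number of edges the direction is the same again, so the path would repeat itself
    up to translation and never end: a shortest terminating run could be shortened by [j]. *)
Lemma mid_even_not_shift j y d c z : (0 < j)%N -> ~~ odd j -> ends y d z ->
  mid j y d <> Some (y + c * n%:Z).
Proof.
move=> j0 evj [K HK] Emid.
have exK : exists K, trace A B K y d != None by exists K; rewrite HK.
case: (ex_minnP exK) => {HK} K HK minK.
have [le|lt] := leqP K j.
  move: HK; case E: (trace A B K y d) => [z'|//] _.
  by have := trace_mono le E; rewrite -[j]addn0 (mid_trace _ Emid).
have := HK; rewrite -(subnKC (ltnW lt)) (mid_trace _ Emid) (negbTE evj) addbF trace_shift.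
case E: (trace A B (K - j) y d) => [z'|//] _.
by have := minK (K - j)%N; rewrite E => /(_ isT); rewrite leqNgt ltn_subrL j0 (leq_ltn_trans _ lt).
Qed.

(** By the two preceding lemmas the middle nodes on a path that ends have distinct residues mod [n],
    so there are at most [n] of them. *)
Lemma trace_fuel y d z : ends y d z -> trace A B n.+1 y d = Some z.
Proof.
move=> yz; case: (yz) => K0 HK0.
have exK : exists K, trace A B K y d != None by exists K0; rewrite HK0.
case: (ex_minnP exK) => -[//|K] HK minK.
have EK : trace A B K.+1 y d = Some z.
  case E: (trace A B K.+1 y d) HK => [z'|//] _.
  by rewrite (ends_inj yz (_ : ends y d z')) //; exists K.+1.
apply: (trace_mono _ EK); rewrite ltnS.
have midS (j : 'I_K.+1) : exists y', mid j y d = Some y'.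
  apply: trace_None_mid; apply/eqP; apply: contraTT (ltn_ord j) => /minK.
  by rewrite -leqNgt.
have {midS}/fin_all_exists[u Hu] := midS.
have d0 : 'I_n := Ordinal (ltnW (ltnW n_ge3)).
have injr : injective (fun j => resid (u j) d0).
  suff lt_inj (a b : 'I_K.+1) : (a < b)%N -> resid (u a) d0 != resid (u b) d0.
    move=> a b E; have [/lt_inj|/lt_inj|/ord_inj//] := ltngtP a b; by rewrite E eqxx.
  move=> lt_ab; rewrite eq_sym resid_eq; apply/negP => /dvdzP[c Ec].
  have Eb : mid (b - a) (u a) (d (+) odd a) = Some (u a + c * n%:Z).
    by rewrite -(mid_add _ (Hu a)) subnKC ?(ltnW lt_ab) // Hu -Ec addrC subrK.
  have [oab|eab] := boolP (odd (b - a)); first exact: mid_odd_not_shift oab Eb.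
  apply: mid_even_not_shift eab _ Eb; first by rewrite subn_gt0.
  by exists (K.+1 - a)%N; rewrite -(mid_trace _ (Hu a)) (subnKC (ltnW (ltn_ord a))); exact: EK.
by have := leq_card _ injr; rewrite !card_ord => /ltnW.
Qed.

End Trace.

Lemma eq_wf n (f g : node -> node) : f =1 g -> wf n f -> wf n g.
Proof.
move=> efg [fsh fK fpar fpl]; split=> [k p|p|p|p z]; rewrite -?efg //.
by rewrite /side -!efg; exact: fpl.
Qed.

(** This compares loop counts before and after a surgery, which leaves the edges on the old loops
    alone. *)
Lemma n_comp_local (T : finType) (e e' : rel T) (a : {pred T}) :
  closed e a -> closed e' a -> (forall x y, x \in a -> e x y = e' x y) ->
  n_comp e a = n_comp e' a.
Proof.
move=> cl cl' eqe; have eqc x : x \in a -> connect e x =1 connect e' x.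
  move=> ax y; apply/connectP/connectP => -[p pth ->]; exists p => //.
    elim: p x ax pth => //= z p IH x ax /andP[exz /IH->]; first by rewrite -eqe ?exz.
    by rewrite -(cl _ _ exz).
  elim: p x ax pth => //= z p IH x ax /andP[exz /IH->]; first by rewrite eqe ?exz.
  by rewrite -(cl' _ _ exz).
apply: eq_card => x; rewrite !inE andbC [RHS]andbC; case ax: (x \in a) => //=.
have E : fingraph.root e x = fingraph.root e' x by congr odflt; apply: eq_pick; exact: eqc.
by rewrite [in LHS]/roots [in RHS]/roots /= E.
Qed.

Section Composite.
Variable n : odd_nat.
Let n_ge3 : (3 <= n)%N := odd_nat_ge3 n.
Variables A B : rdiag n.
Hypothesis wfA : wf n (partner A).
Hypothesis wfB : wf n (partner B).

Lemma partner_cends p z : cends A B p z -> partner (dcomp A B) p = z.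
Proof.
rewrite partner_dcomp /cends /=; case: ifP => _; first by move=> ->.
by move=> H; rewrite (trace_fuel wfA wfB H).
Qed.

Hypothesis wfC : wf n (partner (dcomp A B)).

Lemma cends_partner p : cends A B p (partner (dcomp A B) p).
Proof.
have := wf_neq wfC p; rewrite partner_dcomp /cends /=; case: ifP => // _.
by case E: (trace _ _ _ _ _) => [z|] /=; [exists n.+1 | rewrite eqxx].
Qed.

(** The path from the exit [z] retraces the given one back to [y] and leaves [y] in the other
    direction. *)
Lemma ends_back y d z r : ends A B y d z -> cends A B z r -> ends A B y (~~ d) r.
Proof.
case=> k; elim: k y d => [//|k IH] y d; rewrite traceS.
have LK := wf_invol (wf_layer wfA wfB d) (y, d).
have [Ed|Ed] := eqVneq (layer A B d (y, d)).2 d.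
  move=> /IH {}IH /IH; rewrite negbK.
  have E : layer A B d ((layer A B d (y, d)).1, d) = (y, d).
    by rewrite (_ : (_, d) = layer A B d (y, d)) // [RHS]surjective_pairing Ed.
  by move/endsS; rewrite E; apply.
case=> Ez; have z2 : z.2 = ~~ d by rewrite -Ez; move: Ed; case: (_.2); case: d {Ez LK}.
by rewrite /cends z2 negbK -Ez LK /=; case: d {LK Ez z2 Ed}.
Qed.

(** [loop_nodes] only tests the downward direction; by this lemma the upward one gives the same
    answer. *)
Lemma ends_flip y d z : ends A B y d z -> exists r, ends A B y (~~ d) r.
Proof.
by move=> yz; exists (partner (dcomp A B) z); exact: ends_back yz (cends_partner z).
Qed.

Lemma ends_shift y d z c : ends A B y d z -> ends A B (y + c * n%:Z) d (shiftn n c z).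
Proof. by case=> k E; exists k; rewrite trace_shift E. Qed.

Lemma loopP (k : 'I_n) : reflect (exists z, ends A B (k : nat)%:Z true z) (k \notin loop_nodes A B).
Proof.
rewrite inE; apply: (iffP idP) => [|[z /(trace_fuel wfA wfB) ->] //].
by case E: (trace _ _ _ _ _) => [z|] // _; exists z; exists n.+1.
Qed.

Lemma loop_dead (k : 'I_n) d z : k \in loop_nodes A B -> ~ ends A B (k : nat)%:Z d z.
Proof.
move=> /negPn kl kz; apply: (elimN (loopP k) kl); case: d kz => [|/ends_flip//].
by exists z.
Qed.

Lemma loop_layer (k : 'I_n) d : k \in loop_nodes A B -> (layer A B d ((k : nat)%:Z, d)).2 = d.
Proof.
move=> kl; apply/eqP/negPn/negP => /negbTE H.
by case: (@loop_dead k d (layer A B d ((k : nat)%:Z, d)) kl); exists 1%N; rewrite traceS H.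
Qed.

Lemma mid_adjP (k l : 'I_n) :
  reflect (exists d c, layer A B d ((k : nat)%:Z, d) = ((l : nat)%:Z + c * n%:Z, d))
    (mid_adj A B k l).
Proof.
rewrite /mid_adj; apply: (iffP orP) => [[]/andP[r2 /eqP E]|[[] [c]]].
- have [c Ec] := node_resid (partner A ((k : nat)%:Z, false)).1 k false; rewrite E in Ec.
  by exists false, c; rewrite /layer -[RHS]Ec [LHS]surjective_pairing (negbTE r2).
- have [c Ec] := node_resid (partner B ((k : nat)%:Z, true)).1 k true; rewrite E in Ec.
  by exists true, c; rewrite /layer -[RHS]Ec [LHS]surjective_pairing r2.
- by rewrite /layer => ->; right; rewrite /= resid_shift.
- by rewrite /layer => ->; left; rewrite /= resid_shift.
Qed.

Lemma mid_adj_sym : symmetric (mid_adj A B).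
Proof.
suff imp k l : mid_adj A B k l -> mid_adj A B l k by move=> k l; apply/idP/idP; exact: imp.
case/mid_adjP=> d [c E]; apply/mid_adjP; exists d, (- c).
have := layer_shift A B d (- c) ((l : nat)%:Z + c * n%:Z, d).
rewrite -E (wf_invol (wf_layer wfA wfB d)) /shiftn /= => <-.
by congr layer; rewrite E /=; congr pair; lia.
Qed.

Lemma mid_adj_connect_sym : connect_sym (mid_adj A B).
Proof. exact: sym_connect_sym mid_adj_sym. Qed.

Lemma loop_closed : closed (mid_adj A B) (loop_nodes A B).
Proof.
apply: (intro_closed mid_adj_connect_sym) => k l /mid_adjP[d [c E]] kl.
apply/negPn/negP => /loopP[z lz].
have [z' lz'] : exists z', ends A B (l : nat)%:Z (~~ d) z'.
  by case: d {E} => /=; [exact: ends_flip lz | exists z].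
by apply: (@loop_dead k d (shiftn n c z') kl); apply/endsS; rewrite E //; exact: ends_shift.
Qed.

End Composite.

(** * Multiplication by a generator as a surgery on the left factor *)

Section Surgery.
Variable n : odd_nat.
Let n_ge3 : (3 <= n)%N := odd_nat_ge3 n.
Variables (i : int) (A A' B : rdiag n).
Hypothesis wfA : wf n (partner A).
Hypothesis wfB : wf n (partner B).
Hypothesis wfC : wf n (partner (dcomp A B)).
Hypothesis A'E : partner A' =1 stepf n i (partner A).

Local Notation C := (partner (dcomp A B)).
Local Notation Sn := (inS n i).
Local Notation sg := (sw n i).

Lemma wf_step : wf n (partner A').
Proof. by apply: eq_wf (wf_stepf i wfA) => p; rewrite A'E. Qed.

Lemma inS_bot y : ~~ Sn (y, false). Proof. by []. Qed.

Lemma layer_step d p : ~~ Sn p -> ~~ Sn (layer A B d p) -> layer A' B d p = layer A B d p.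
Proof. by case: d => // nSp nS; rewrite /layer A'E stepf_out. Qed.

Lemma trace_step k y d z : ~~ Sn z -> trace A B k y d = Some z -> trace A' B k y d = Some z.
Proof.
move=> nSz; elim: k y d => [//|k IH] y d; rewrite !traceS.
have [Ed|Ed] := eqVneq (layer A B d (y, d)).2 d.
  suff -> : layer A' B d (y, d) = layer A B d (y, d) by rewrite Ed eqxx; exact: IH.
  by case: d Ed => // Ed; apply: layer_step => //; rewrite /inS Ed.
case=> Ez; suff -> : layer A' B d (y, d) = layer A B d (y, d) by rewrite (negbTE Ed) Ez.
by case: d Ez {Ed} => // Ez; apply: layer_step => //; rewrite Ez.
Qed.

Lemma trace_step_None k y d :
  (forall k, trace A B k y d = None) -> trace A' B k y d = None.
Proof.
elim: k y d => [//|k IH] y d H; rewrite traceS.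
have Ed : (layer A B d (y, d)).2 = d.
  by apply/eqP; have := H 1%N; rewrite traceS; case: ifP.
suff -> : layer A' B d (y, d) = layer A B d (y, d).
  by rewrite Ed eqxx IH // => l; have := H l.+1; rewrite traceS Ed eqxx.
by case: d Ed {H} => // Ed; apply: layer_step => //; rewrite /inS Ed.
Qed.

(* A path of A over B that leaves through s in S continues, in A' over B, along
   the edge of A at the other node of S. *)
Lemma trace_via k y d z : Sn z -> trace A B k y d = Some z ->
  exists2 k0, (0 < k0)%N & forall K, trace A' B (k0 + K) y d =
    if (partner A (sg z)).2 then Some (partner A (sg z))
    else trace A' B K (partner A (sg z)).1 true.
Proof.
move=> Sz; elim: k y d => [//|k IH] y d; rewrite traceS.
have [Ed|Ed] := eqVneq (layer A B d (y, d)).2 d.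
  move=> /IH[k0 k00 H]; exists k0.+1 => // K; rewrite addSn traceS.
  suff -> : layer A' B d (y, d) = layer A B d (y, d) by rewrite Ed eqxx H.
  by case: d Ed {H} => // Ed; apply: layer_step => //; rewrite /inS Ed.
case=> Ez; exists 1%N => // K; rewrite add1n traceS.
case: d Ed Ez => [Ed Ez|Ed Ez].
  by move: Sz Ed; rewrite -Ez /inS; case: (_.2).
have -> : layer A' B false (y, false) = partner A (sg z).
  by rewrite /layer A'E stepf_via ?inS_bot //; move: Ez; rewrite /layer => ->.
by case: (_.2).
Qed.

Lemma cends_step p z : ~~ Sn p -> ~~ Sn z -> cends A B p z -> cends A' B p z.
Proof.
move=> nSp nSz; rewrite /cends.
have [Ed|Ed] := eqVneq (layer A B (~~ p.2) p).2 p.2.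
  by move=> Ez; rewrite layer_step ?Ed ?eqxx // -Ez.
case=> k Hk; have -> : layer A' B (~~ p.2) p = layer A B (~~ p.2) p.
  move: Ed; case p2: p.2 => //= Ed; apply: layer_step => //.
  by rewrite /inS; case: (_.2) Ed.
by rewrite (negbTE Ed); exists k; exact: trace_step.
Qed.

Lemma ends_via q : ~~ Sn (C q) ->
  Sn q -> exists K, (if (partner A q).2 then Some (partner A q)
    else trace A' B K (partner A q).1 true) = Some (C q).
Proof.
move=> nS Sq; have q2 : q.2 = true by case/andP: Sq.
have := cends_partner wfC q; rewrite /cends q2 /=.
rewrite -[layer A B false q]/(partner A q).
case: (partner A q).2 => /= [->|[k Hk]]; first by exists 0%N.
by exists k; exact: trace_step.
Qed.

Lemma cends_via p : ~~ Sn p -> Sn (C p) -> cends A' B p (C (sg (C p))).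
Proof.
move=> nSp SCp; have [K HK] := ends_via (via_notin wfC nSp SCp) (inS_sw SCp).
have := cends_partner wfC p; rewrite {1 2}/cends.
have [Ed|Ed] := eqVneq (layer A B (~~ p.2) p).2 p.2.
  move=> Ez; have p2 : p.2 = true.
    by rewrite -Ed -Ez; case/andP: SCp.
  move: Ez; rewrite /cends p2 /= -[layer A B false p]/(partner A p) => Ez.
  have -> : layer A' B false p = partner A (sg (C p)).
    by rewrite /layer A'E stepf_via // -Ez.
  by move: HK; case: (_.2) => [[]|HK] //=; exists K.
move=> [k Hk]; have E : layer A' B (~~ p.2) p = layer A B (~~ p.2) p.
  move: Ed; case p2: p.2 => //= Ed; apply: layer_step => //.
  by rewrite /inS; case: (_.2) Ed.
rewrite /cends E (negbTE Ed); have [k0 _ H] := trace_via SCp Hk.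
by exists (k0 + K)%N; rewrite H.
Qed.

(** The planarity [wfC] of the product serves as an induction hypothesis: together with [wf_stepf]
    the conclusion hands it on to the product with [A']. *)
Lemma dcomp_step : partner (dcomp A' B) =1 stepf n i C.
Proof.
move=> p; apply: (partner_cends wf_step wfB).
have [Sp|nSp] := boolP (Sn p).
  have p2 : p.2 = true by case/andP: Sp.
  by rewrite stepf_in // /cends p2 /= /layer A'E stepf_in // sw_row p2.
have [SCp|nSCp] := boolP (Sn (C p)).
  by rewrite stepf_via //; exact: cends_via.
by rewrite stepf_out //; apply: cends_step => //; exact: cends_partner.
Qed.

Lemma joined_all g : wf n g -> g (i, true) = (i + 1, true) -> forall s, Sn s -> g s = sg s.
Proof.
move=> wfg E s /inSP[k [] ->]; rewrite ?sw_l ?sw_r.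
  by have := wf_shift wfg k (i, true); rewrite E /shiftn.
by have := wf_shift wfg k (i + 1, true); rewrite -E (wf_invol wfg) E /shiftn.
Qed.

Lemma joined_in g s : wf n g -> Sn s -> Sn (g s) -> g (i, true) = (i + 1, true).
Proof.
move=> wfg Ss Sgs; have := wf_joined wfg Ss Sgs.
have sh k : g (i + k * n%:Z, true) = (i + 1 + k * n%:Z, true) -> g (i, true) = (i + 1, true).
  move=> E; have := wf_shift wfg (- k) (i + k * n%:Z, true); rewrite E /shiftn /= => E'.
  by rewrite (_ : (i, true) = (i + k * n%:Z + - k * n%:Z, true)) ?E'; congr pair; lia.
case/inSP: Ss => k [] -> ; rewrite ?sw_l ?sw_r => E; first exact: sh E.
by apply: (sh k); rewrite -E (wf_invol wfg).
Qed.

Hypothesis njA : partner A (i, true) != (i + 1, true).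

Lemma step_dead (k : 'I_n) : k \in loop_nodes A B -> k \in loop_nodes A' B.
Proof.
move=> kl; apply/negPn/negP => /(loopP wf_step wfB)[z [m]].
rewrite trace_step_None // => l; case E: (trace _ _ _ _ _) => [z'|//].
by case: (@loop_dead _ _ _ wfA wfB wfC k true z' kl); exists l.
Qed.

Lemma step_adj (k l : 'I_n) : k \in loop_nodes A B -> mid_adj A B k l = mid_adj A' B k l.
Proof.
move=> kl; rewrite /mid_adj; suff -> : partner A' ((k : nat)%:Z, false) = partner A ((k : nat)%:Z, false) by [].
have := loop_layer wfA wfB wfC false kl; rewrite /layer => E.
by rewrite A'E stepf_out //; rewrite /inS E.
Qed.

Hypothesis wfC' : wf n (partner (dcomp A' B)).

Lemma step_loop_closed : closed (mid_adj A' B) (loop_nodes A B).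
Proof.
apply: (intro_closed (mid_adj_connect_sym wf_step wfB)) => k l kl kin.
by rewrite -(loop_closed wfA wfB wfC (x := k)) // step_adj.
Qed.

(** A path that used to end in S now goes on from the other node of its arc, and ends outside S
    because the product does not join the two. So no new node becomes trapped on a loop. *)
Lemma nloops_step_open : C (i, true) != (i + 1, true) -> nloops A' B = nloops A B.
Proof.
move=> njC; rewrite /nloops.
have eqa : loop_nodes A' B =i loop_nodes A B.
  move=> k; apply/idP/idP; last exact: step_dead.
  apply: contraLR => /(loopP wfA wfB)[z [m Hm]].
  apply/(loopP wf_step wfB); have [Sz|nSz] := boolP (Sn z); last first.
    by exists z, m; exact: trace_step.
  have nSC : ~~ Sn (C (sg z)).
    by apply: contraNN njC => SC; apply/eqP; apply: joined_in SC => //; exact: inS_sw.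
  have [K HK] := ends_via nSC (inS_sw Sz).
  have [k0 _ H] := trace_via Sz Hm.
  by exists (C (sg z)), (k0 + K)%N; rewrite H.
rewrite (eq_n_comp_r eqa) [RHS](n_comp_local (e' := mid_adj A' B)) //.
- exact: loop_closed.
- exact: step_loop_closed.
- by move=> k l; exact: step_adj.
Qed.

(** Up to its last middle node the path survives the surgery. That node is, up to translation, the
    neighbour in [A] of [i] or of [i + 1], and the surgery joins these two neighbours. *)
Lemma connect_to_exit (d0 : 'I_n) k y d z : (partner A (i, true)).2 = false -> Sn z -> trace A B k y d = Some z ->
  connect (mid_adj A' B) (resid y d0) (resid (partner A (i, true)).1 d0).
Proof.
move=> Ai2 Sz; elim: k y d => [//|k IH] y d; rewrite traceS.
have [c Ec] := node_resid y d0 d.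
set r := resid y d0 in Ec *; have [Ed|Ed] := eqVneq (layer A B d (y, d)).2 d.
  move=> /IH; apply: connect_trans; apply: connect1.
  have [c' Ec'] := node_resid (layer A B d (y, d)).1 d0 d.
  apply/mid_adjP; exists d, (c' - c).
  have -> : layer A' B d ((r : nat)%:Z, d) = layer A B d ((r : nat)%:Z, d).
    case: d Ed Ec {Ec'} => // Ed Ec; apply: layer_step => //.
    by rewrite -(@inS_shift n i c) -layer_shift -Ec /inS Ed.
  have : shiftn n c (layer A B d ((r : nat)%:Z, d)) =
    shiftn n c' ((resid (layer A B d (y, d)).1 d0 : nat)%:Z, d).
    by rewrite -layer_shift -Ec -Ec' [LHS]surjective_pairing Ed.
  by move/(congr1 (shiftn n (- c))); rewrite !shiftnD subrr shiftn0.
case=> Ez; have Ed0 : d = false.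
  by move: Sz Ed; rewrite -Ez /inS; case: (_.2); case: (d).
subst d; have Ay : partner A z = (y, false) by rewrite -Ez (wf_invol wfA).
move: Sz => /inSP[l [] El].
  suff -> : r = resid (partner A (i, true)).1 d0 by exact: connect0.
  have := wf_shift wfA l (i, true); rewrite {1}/shiftn -El Ay /= => -[Ey _].
  apply/eqP; rewrite /r resid_eq Ey addrAC subrr add0r; exact: dvdz_mull.
apply: connect1; apply/mid_adjP.
have [c' Ec'] := node_resid (partner A (i, true)).1 d0 false.
exists false, (c' + l - c).
have : layer A' B false (y, false) = shiftn n l (partner A (i, true)).
  have Az : partner A (y, false) = z by rewrite -Ay (wf_invol wfA).
  have Sz : Sn z by rewrite El; apply/inSP; exists l; right.
  by rewrite /layer A'E (stepf_via (inS_bot y)) Az // El sw_r -(wf_shift wfA).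
rewrite Ec layer_shift => /(congr1 (shiftn n (- c))); rewrite !shiftnD subrr.
have Ai : partner A (i, true) = shiftn n c' ((resid (partner A (i, true)).1 d0 : nat)%:Z, false).
  by rewrite -Ec' -Ai2 -surjective_pairing.
by rewrite {1}Ai !shiftnD shiftn0 -addrA.
Qed.

(** The edge of the product from [i] to [i + 1] is closed up by the arc of E_i. Its middle nodes
    form exactly one new component. *)
Lemma nloops_step_close : C (i, true) = (i + 1, true) -> nloops A' B = (nloops A B).+1.
Proof.
move=> jC; have jCs := joined_all wfC jC.
(* An edge of [A] from S that stays in the top row would be an edge of the product, hence join two
   nodes of S, against [njA]. *)
have bot s : Sn s -> (partner A s).2 = false.
  move=> Ss; apply/negbTE/negP => As2; have := cends_partner wfC s.
  have s2 : s.2 = true by case/andP: Ss.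
  rewrite /cends s2 -[layer A B (~~ true) s]/(partner A s) As2 /= (jCs _ Ss) => E.
  by case/eqP: njA; apply: (joined_in wfA Ss); rewrite -E inS_sw.
have Si : Sn (i, true) by apply/inSP; exists 0; left; rewrite mul0r addr0.
have via s : Sn s -> exists2 k0, (0 < k0)%N & forall K,
    trace A' B (k0 + K) (partner A s).1 true = trace A' B K (partner A s).1 true.
  move=> Ss; have s2 : s.2 = true by case/andP: Ss.
  have := cends_partner wfC s; rewrite /cends s2 -[layer A B (~~ true) s]/(partner A s) (bot _ Ss) /=.
  rewrite jCs // => -[k Hk]; have [k0 k00 H] := trace_via (inS_sw Ss) Hk.
  by exists k0 => // K; rewrite H swK // bot.
(* By [via] the path comes back to its starting point after [k0 > 0] edges, so no amount of fuel
   lets it end. *)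
have loop s K : Sn s -> trace A' B K (partner A s).1 true = None.
  move=> Ss; have [k0 k00 H] := via s Ss.
  have [m] := ubnP K; elim: m K => // m IH K ltK.
  have [le|lt] := leqP K k0.
    case E: (trace _ _ _ _ _) => [z|//].
    by have := trace_mono le E; rewrite -[k0]addn0 H.
  by rewrite -(subnKC (ltnW lt)) H IH // (leq_trans _ (ltnSE ltK)) // ltn_subrL k00 (leq_ltn_trans _ lt).
(* The middle nodes of the edges of the product that end in S; these become the new loop. *)
pose b : {pred 'I_n} :=
  [pred k : 'I_n | if trace A B n.+1 (k : nat)%:Z true is Some z then Sn z else false].
have bP (k : 'I_n) : reflect (exists2 z, ends A B (k : nat)%:Z true z & Sn z) (k \in b).
  rewrite inE; apply: (iffP idP) => [|[z /(trace_fuel wfA wfB)->]//].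
  by case E: (trace _ _ _ _ _) => [z|//] Sz; exists z => //; exists n.+1.
have disj (k : 'I_n) : k \in b -> k \notin loop_nodes A B.
  by case/bP=> z kz _; apply/(loopP wfA wfB); exists z.
have eqa (k : 'I_n) : (k \in loop_nodes A' B) = (k \in loop_nodes A B) || (k \in b).
  apply/idP/idP => [|/orP[/step_dead//|]]; last first.
    case/bP=> z [m Hm] Sz; have [k0 k00 H] := trace_via Sz Hm.
    apply/negPn/negP => /(loopP wf_step wfB)[z' [l Hl]].
    have := trace_mono (leq_addl k0 l) Hl.
    by rewrite H bot ?inS_sw // loop // inS_sw.
  apply: contraLR; rewrite negb_or => /andP[/(loopP wfA wfB)[z kz] nb].
  apply/(loopP wf_step wfB); case: kz => m Hm; exists z, m; apply: trace_step => //.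
  by apply: contra nb => Sz; apply/bP; exists z => //; exists m.
pose d0 : 'I_n := Ordinal (ltnW (ltnW n_ge3)).
set x := resid (partner A (i, true)).1 d0.
have cs := mid_adj_connect_sym wf_step wfB.
have xb : x \in b.
  have := cends_partner wfC (i, true); rewrite /cends -[layer A B (~~ _) _]/(partner A (i, true)).
  rewrite bot //= jC => xz.
  have [c Ec] := node_resid (partner A (i, true)).1 d0 true.
  apply/bP; exists (shiftn n (- c) (i + 1, true)).
    have := ends_shift (- c) xz; congr ends; case: Ec => ->; rewrite -/x; lia.
  by rewrite inS_shift; apply/inSP; exists 0; right; rewrite mul0r addr0.
have cl_b : closed (mid_adj A' B) b.
  apply: (intro_closed cs) => k l kl kb.
  have := loop_closed wf_step wfB wfC' kl; rewrite !eqa kb orbT => /esym/orP[|//].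
  by rewrite -(step_loop_closed kl) (negbTE (disj _ kb)).
have eqb : b =i connect (mid_adj A' B) x.
  move=> k; apply/idP/idP => [/bP[z [m Hm] Sz]|xk]; last first.
    by rewrite -(closed_connect cl_b xk).
  rewrite inE cs; have := connect_to_exit d0 (bot _ Si) Sz Hm.
  by have := @resid_shift n k d0 0; rewrite mul0r addr0 => ->.
rewrite /nloops; transitivity (n_comp (mid_adj A' B) (loop_nodes A B) + n_comp (mid_adj A' B) b)%N.
  rewrite /n_comp_mem -cardUI [X in (_ + X)%N]eq_card0 ?addn0.
    by apply: eq_card => k; have := eqa k; rewrite !inE => ->; rewrite andb_orr.
  move=> k; rewrite !inE; apply/negP => /andP[/andP[_ ka] /andP[_ kb]].
  by have := disj k kb; rewrite inE ka.
rewrite (eq_n_comp_r eqb) n_comp_connect // addn1; congr S.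
apply/esym/n_comp_local => //; first exact: loop_closed.
  exact: step_loop_closed.
by move=> k l; exact: step_adj.
Qed.

End Surgery.

(** * Associativity of the product and the cocycle of closed loops *)

Section Monoid.
Variable n : odd_nat.
Implicit Types (A B D : rdiag n) (i : 'I_n).

Lemma dcomp_did D : wf n (partner D) -> dcomp (did n) D = D.
Proof.
move=> wfD; apply: partner_ext => p; apply: (partner_cends (wf_did n) wfD).
have up x : ends (did n) D x false (x, true).
  by exists 1%N; rewrite traceS /layer partner_did.
rewrite /cends; case: p => x r; case: r => /=.
  rewrite {1}/layer partner_did /= /layer partner_did /=.
  case E: (partner D (x, true)) => [y []]; last first.
    by exists 1%N; rewrite traceS /layer E.
  by apply/endsS; rewrite /layer E //; exact: up.
rewrite -[layer _ _ _ _]/(partner D (x, false)); case: (partner D (x, false)) => [y []] /=; last by [].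
exact: up.
Qed.

Lemma partner_dcomp_dE i D : wf n (partner D) ->
  partner (dcomp (dE i) D) =1 stepf n (i : nat)%:Z (partner D).
Proof.
move=> wfD p; have E := dcomp_did wfD.
by rewrite (dcomp_step (wf_did n) wfD _ (partner_dE i)) E.
Qed.

Lemma inTL_wf D : inTL D -> wf n (partner D).
Proof.
elim=> [|i {}D _ wfD]; first exact: wf_did.
by apply: eq_wf (wf_stepf i wfD) => p; rewrite partner_dcomp_dE.
Qed.

Lemma nloops_did D : inTL D -> nloops (did n) D = 0%N.
Proof.
move=> TD; have wfD := inTL_wf TD; have E := dcomp_did wfD.
have wfE : wf n (partner (dcomp (did n) D)) by rewrite E.
apply: eq_card0 => k; rewrite inE; apply/negbTE; rewrite negb_and; apply/orP; right.
apply/(loopP (wf_did n) wfD); have := cends_partner wfE ((k : nat)%:Z, true).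
rewrite /cends -[layer _ _ (~~ _) _]/(partner (did n) ((k : nat)%:Z, true)) partner_did /=.
by move=> H; exists (partner (dcomp (did n) D) ((k : nat)%:Z, true)).
Qed.

Lemma nloops_dE i D : inTL D ->
  nloops (dE i) D = (partner D ((i : nat)%:Z, true) == ((i : nat)%:Z + 1, true)).
Proof.
move=> TD; have wfD := inTL_wf TD; have E := dcomp_did wfD.
have wfE : wf n (partner (dcomp (did n) D)) by rewrite E.
have wf' : wf n (partner (dcomp (dE i) D)) by apply: inTL_wf; constructor.
have nj : partner (did n) ((i : nat)%:Z, true) != ((i : nat)%:Z + 1, true).
  by rewrite partner_did -pair_eqE /= andbF.
have nl0 := nloops_did TD.
case: eqP => [j|/eqP j].
  by rewrite (nloops_step_close (wf_did n) wfD wfE (partner_dE i)) ?E ?nl0.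
by rewrite (nloops_step_open (wf_did n) wfD wfE (partner_dE i)) ?E ?nl0.
Qed.

Lemma dcomp_dE_joined i D : inTL D ->
  partner D ((i : nat)%:Z, true) = ((i : nat)%:Z + 1, true) -> dcomp (dE i) D = D.
Proof.
move=> TD jD; have wfD := inTL_wf TD; apply: partner_ext => p.
rewrite partner_dcomp_dE // /stepf; case: ifP => [Sp|nSp].
  by rewrite (joined_all wfD jD).
case: ifP => // Sfp; have := joined_all wfD jD Sfp; rewrite (wf_invol wfD) => E.
by rewrite E inS_sw in nSp.
Qed.

Lemma dcomp_dEA i A B : inTL A -> wf n (partner B) -> wf n (partner (dcomp A B)) ->
  dcomp (dcomp (dE i) A) B = dcomp (dE i) (dcomp A B).
Proof.
move=> TA wfB wfC; apply: partner_ext => p.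
by rewrite partner_dcomp_dE // (dcomp_step (inTL_wf TA) wfB wfC (partner_dcomp_dE i (inTL_wf TA))).
Qed.

Lemma inTL_dcomp A B : inTL A -> inTL B -> inTL (dcomp A B).
Proof.
move=> TA TB; have wfB := inTL_wf TB; elim: TA => [|i {}A TA IH]; first by rewrite dcomp_did.
by rewrite dcomp_dEA //; [constructor | exact: inTL_wf].
Qed.

Lemma dcompA A B D : inTL A -> inTL B -> inTL D -> dcomp (dcomp A B) D = dcomp A (dcomp B D).
Proof.
move=> TA TB TD; elim: TA => [|i {}A TA IH].
  by rewrite !dcomp_did //; apply: inTL_wf => //; exact: inTL_dcomp.
have TAB := inTL_dcomp TA TB; have TBD := inTL_dcomp TB TD.
rewrite !dcomp_dEA ?IH //; apply: inTL_wf => //; exact: inTL_dcomp.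
Qed.

(** A loop closed by E_i in E_i A B is closed already against [A], or only once [B] is attached.
    Both sides count it once. *)
Lemma nloops_dE_cocycle i A B : inTL A -> inTL B ->
  (nloops (dE i) A + nloops (dcomp (dE i) A) B = nloops A B + nloops (dE i) (dcomp A B))%N.
Proof.
move=> TA TB; have TAB := inTL_dcomp TA TB; have TA' := inTL_E i TA.
have [jA|njA] := eqVneq (partner A ((i : nat)%:Z, true)) ((i : nat)%:Z + 1, true).
  rewrite !nloops_dE // jA dcomp_dE_joined // addnC partner_dcomp /layer /= jA /=.
  by [].
have st := partner_dcomp_dE i (inTL_wf TA).
rewrite !nloops_dE // (negbTE njA) add0n; case: eqP => [jC|/eqP njC].
  rewrite (nloops_step_close _ _ _ st) ?addn1 //; apply: inTL_wf => //; exact: inTL_dcomp.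
rewrite (nloops_step_open _ _ _ st) ?addn0 //; apply: inTL_wf => //; exact: inTL_dcomp.
Qed.

Lemma nloops_cocycle A B D : inTL A -> inTL B -> inTL D ->
  (nloops A B + nloops (dcomp A B) D = nloops B D + nloops A (dcomp B D))%N.
Proof.
move=> TA TB TD; have wfB := inTL_wf TB; have TBD := inTL_dcomp TB TD.
elim: TA => [|i {}A TA IH]; first by rewrite dcomp_did // !nloops_did // addn0.
have TAB := inTL_dcomp TA TB.
have := nloops_dE_cocycle i TA TB; have := nloops_dE_cocycle i TAB TD.
have := nloops_dE_cocycle i TA TBD; rewrite dcompA // -(dcomp_dEA i TA wfB (inTL_wf TAB)); lia.
Qed.

Lemma inTL_dE i : inTL (dE i).
Proof.
rewrite (_ : dE i = dcomp (dE i) (did n)); first by do 2!constructor.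
by apply: partner_ext => p; rewrite partner_dcomp_dE ?partner_dE //; exact: wf_did.
Qed.

End Monoid.

(** * Rows, levels and displacement *)

Section Rows.
Variable n : odd_nat.
Let n_odd : odd n := odd_nat_odd n.
Let n_ge3 : (3 <= n)%N := odd_nat_ge3 n.
Implicit Types (A B D : rdiag n) (r : bool).

(** The lift to the integers of equality of [rowInv]: the horizontal edges of row [r] and the
    starting points of strands agree, while the other ends of strands are free. *)
Definition same_row r D D' := forall x,
  (partner D' (x, r)).2 = (partner D (x, r)).2 /\
  ((partner D (x, r)).2 = r -> partner D' (x, r) = partner D (x, r)).

Lemma same_row_refl r D : same_row r D D. Proof. by []. Qed.

Lemma same_row_sym r D D' : same_row r D D' -> same_row r D' D.
Proof. by move=> H x; have [E1 E2] := H x; split=> // E; rewrite E2 // -E1. Qed.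

Lemma same_row_trans r D2 D1 D3 : same_row r D1 D2 -> same_row r D2 D3 -> same_row r D1 D3.
Proof.
move=> H1 H2 x; have [E1 E2] := H1 x; have [E3 E4] := H2 x.
by split=> [|E]; rewrite ?E3 // E4 ?E2 ?E1.
Qed.

Lemma same_row_rowInv r D D' : same_row r D D' -> rowInv D' r = rowInv D r.
Proof.
move=> H; apply/ffunP=> k; rewrite !ffunE /= -!partner_ord.
by have [-> E] := H (k : nat)%:Z; case: eqP => // /E->.
Qed.

(** Two partners with the same residue differ by a multiple of [n], which is even by the colouring,
    hence by a multiple of [2n] as [n] is odd. Both being at distance less than [n], they
    coincide. *)
Lemma rowInv_same_row r D D' : wf n (partner D) -> wf n (partner D') ->
  rowInv D' r = rowInv D r -> same_row r D D'.
Proof.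
move=> wfD wfD' eqD x.
suff Hk (k : 'I_n) : (partner D' ((k : nat)%:Z, r)).2 = (partner D ((k : nat)%:Z, r)).2 /\
    ((partner D ((k : nat)%:Z, r)).2 = r ->
     partner D' ((k : nat)%:Z, r) = partner D ((k : nat)%:Z, r)).
  have [k [c ->]] := node_decomp n (x, r); have [E1 E2] := Hk k.
  by rewrite !partner_shift /=; split=> // /E2->.
have /ffunP/(_ k) := eqD; rewrite !ffunE /= -!partner_ord.
have nfix (D0 : rdiag n) : wf n (partner D0) -> (partner D0 ((k : nat)%:Z, r)).2 = r ->
    resid (partner D0 ((k : nat)%:Z, r)).1 k != k.
  move=> wf0 E; apply/eqP => Ek.
  have [c Ec] := node_resid (partner D0 ((k : nat)%:Z, r)).1 k r.
  have /eqP[] := wf_not_shift wf0 c ((k : nat)%:Z, r).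
  by rewrite Ek in Ec; rewrite -Ec [LHS]surjective_pairing E.
have := nfix _ wfD; have := nfix _ wfD'; have := wf_parity wfD ((k : nat)%:Z, r).
have := wf_parity wfD' ((k : nat)%:Z, r).
case E: (partner D _) => [y s]; case E': (partner D' _) => [y' s'] /=.
case: (eqVneq s r) => [Es|ns]; case: (eqVneq s' r) => [Es'|ns'].
- move=> p1 p2 _ _ /eqP; rewrite resid_eq => /dvdzP[c Ec]; subst s s'; split=> // _.
  congr pair; have sh := arc_short wfD E; have sh' := arc_short wfD' E'.
  have ev : (2 %| c * n%:Z)%Z by rewrite -Ec; move: p1 p2; rewrite /parity_node /=; case: (r); lia.
  have /dvdzP[c' Ec'] := odd_dvdzM n_odd ev.
  have Ey : y' - y = c' * (2 * n%:Z) by rewrite Ec Ec' mulrA.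
  have c0 : c' = 0 by apply: (mulz_small Ey); lia.
  by move: Ey; rewrite c0; lia.
- by move=> _ _ _ /(_ Es)/eqP nk Ek; case: nk; rewrite -Ek.
- by move=> _ _ /(_ Es')/eqP nk _ Ek; case: nk.
- move=> *; split; last by move=> Es; rewrite Es eqxx in ns.
  by move: ns ns'; case: (s) (s') (r) => [] [] [].
Qed.

Definition same_opt r (o o' : option node) :=
  omap snd o' = omap snd o /\ (forall z, o = Some z -> z.2 = r -> o' = Some z).

Lemma same_opt_Some r z z' : z'.2 = z.2 -> (z.2 = r -> z' = z) -> same_opt r (Some z) (Some z').
Proof. by move=> E1 E2; split=> [/=|_ [<-] /E2->//]; rewrite E1. Qed.

Lemma same_opt_odflt r o o' p : same_opt r o o' ->
  (odflt p o').2 = (odflt p o).2 /\ ((odflt p o).2 = r -> odflt p o' = odflt p o).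
Proof.
case: o o' => [z|] [z'|] [] //= [] E1 E2; split=> // E.
by have [] := E2 z erefl E.
Qed.

Lemma trace_same_row A B B' k y d : same_row true B B' ->
  same_opt true (trace A B k y d) (trace A B' k y d).
Proof.
move=> H; elim: k y d => [//|k IH] y d; rewrite !traceS /layer; case: d => /=; last first.
  by case: ifP => _ //; exact: same_opt_Some.
have [E1 E2] := H y; rewrite E1; case: ifP => [/eqP Et|Et]; first by rewrite E2.
by apply: same_opt_Some => // E; rewrite E in Et.
Qed.

Lemma trace_same_row_bot A A' B k y d : same_row false A A' ->
  same_opt false (trace A B k y d) (trace A' B k y d).
Proof.
move=> H; elim: k y d => [//|k IH] y d; rewrite !traceS /layer; case: d => /=.
  by case: ifP => _ //; exact: same_opt_Some.
have [E1 E2] := H y; rewrite E1; case: ifP => [/eqP Et|Et]; first by rewrite E2.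
by apply: same_opt_Some => // E; rewrite E in Et.
Qed.

Lemma dcomp_same_row A B B' : same_row true B B' -> same_row true (dcomp A B) (dcomp A B').
Proof.
move=> H x; rewrite !partner_dcomp -![layer _ _ _ _]/(partner A (x, true)) /=.
case: ifP => // _; set y := (partner A _).1.
exact: (same_opt_odflt (x, true) (trace_same_row A n.+1 y true H)).
Qed.

Lemma nloops_same_row A A' B B' : same_row false A A' -> same_row true B B' ->
  nloops A' B' = nloops A B.
Proof.
move=> HA HB; rewrite /nloops.
have eqm : mid_adj A' B' =2 mid_adj A B.
  move=> k l; rewrite /mid_adj; have [-> EA] := HA (k : nat)%:Z; have [-> EB] := HB (k : nat)%:Z.
  congr orb; [case: (_.2) EA => // EA| case: (_.2) EB => // EB]; by rewrite ?EA ?EB.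
rewrite (eq_n_comp (eq_connect eqm)); apply: eq_n_comp_r => k; rewrite !inE.
have [E1 _] := trace_same_row_bot B' n.+1 (k : nat)%:Z true HA.
have [E2 _] := trace_same_row A n.+1 (k : nat)%:Z true HB.
by move: E1 E2; do 3!case: (trace _ _ _ _ _) => [?|].
Qed.

Lemma periodic_resid (V : Type) (H : int -> V) : (forall x k, H (x + k * n%:Z) = H x) ->
  forall x (d : 'I_n), H (resid x d : nat)%:Z = H x.
Proof. by move=> per x d; have [k [->]] := node_resid x d true; rewrite per resid_shift. Qed.

(** The strands match residues of bottom ends with residues of top ends, and a periodic [H] sees
    only residues. *)
Lemma sum_bot_top D (H : int -> int) : wf n (partner D) ->
  (forall x k, H (x + k * n%:Z) = H x) ->
  \sum_(j : 'I_n | (D (j, false)).2) H (D (j, false)).1 =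
  \sum_(k : 'I_n | ~~ (D (k, true)).2) H (k : nat)%:Z.
Proof.
move=> wfD per.
pose h r (j : 'I_n) := resid (D (j, r)).1 j.
have hE r (j : 'I_n) : (D (j, r)).2 = ~~ r -> exists c,
    D (j, r) = ((h r j : nat)%:Z + c * n%:Z, ~~ r) /\
    D (h r j, ~~ r) = ((j : nat)%:Z + (- c) * n%:Z, r).
  move=> E; have [c Ec] := node_resid (D (j, r)).1 j (~~ r); exists c.
  have E1 : D (j, r) = ((h r j : nat)%:Z + c * n%:Z, ~~ r) by rewrite [LHS]surjective_pairing E Ec.
  split=> //; have := wf_invol wfD ((j : nat)%:Z, r); rewrite partner_ord E1.
  have := partner_shift_ord D (h r j) (~~ r) c; rewrite {1}/shiftn /= => ->.
  by case: (D _) => y s; rewrite /shiftn /= => -[<- <-]; congr pair; lia.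
have hK r (j : 'I_n) : (D (j, r)).2 = ~~ r -> h (~~ r) (h r j) = j.
  by move=> /hE[c [_ E]]; rewrite /h -/(h r j) E resid_shift.
have hthr r (j : 'I_n) : (D (j, r)).2 = ~~ r -> (D (h r j, ~~ r)).2 = r.
  by move=> /hE[c [_ ->]].
rewrite [RHS](reindex_onto (h false) (h true)) /=; last first.
  by move=> k /negbTE/(hK true).
apply: eq_big => j => [|Ej]; last by rewrite (periodic_resid per).
apply/idP/andP => [Ej|[thr /eqP Ej]].
  by rewrite (hK false) // (hthr false).
by rewrite -Ej; apply: (hthr true); exact: negbTE.
Qed.

Definition nvert_bot D : nat := #|[pred j : 'I_n | (D (j, false)).2]|.

Lemma nvert_botE D : wf n (partner D) -> nvert_bot D = nvert D.
Proof.
move=> wfD; apply/eqP; rewrite -eqz_nat; apply/eqP.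
have := @sum_bot_top D (fun _ => 1) wfD (fun _ _ => erefl).
by rewrite !sumr_const /= /nvert_bot /nvert !natz.
Qed.

End Rows.

Section Levels.
Variable n : odd_nat.
Let n_odd : odd n := odd_nat_odd n.
Let n_ge3 : (3 <= n)%N := odd_nat_ge3 n.
Implicit Types (A B D : rdiag n) (r : bool).

Lemma same_row_ord r D D' :
  (forall k : 'I_n, (D' (k, r)).2 = (D (k, r)).2 /\ ((D (k, r)).2 = r -> D' (k, r) = D (k, r))) ->
  same_row r D D'.
Proof.
move=> H x; have [k [c ->]] := node_decomp n (x, r); rewrite !partner_shift_ord /=.
by have [E1 E2] := H k; split=> // /E2->.
Qed.

Lemma same_row_nvert D D' : same_row true D D' -> nvert D' = nvert D.
Proof.
move=> H; apply: eq_card => k; rewrite !inE -!partner_ord.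
by have [-> _] := H (k : nat)%:Z.
Qed.

Lemma dcomp_top A B x : (partner A (x, true)).2 -> partner (dcomp A B) (x, true) = partner A (x, true).
Proof. by move=> E; rewrite partner_dcomp /= -[layer _ _ _ _]/(partner A (x, true)) E. Qed.

Lemma dcomp_bot A B x : (partner B (x, false)).2 = false ->
  partner (dcomp A B) (x, false) = partner B (x, false).
Proof. by move=> E; rewrite partner_dcomp /= -[layer _ _ _ _]/(partner B (x, false)) E. Qed.

Lemma nvert_dcomp_l A B : (nvert (dcomp A B) <= nvert A)%N.
Proof.
apply: subset_leq_card; apply/subsetP => k; rewrite !inE -!partner_ord.
by apply: contra => E'; rewrite dcomp_top.
Qed.

Lemma nvert_bot_dcomp A B : (nvert_bot (dcomp A B) <= nvert_bot B)%N.
Proof.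
apply: subset_leq_card; apply/subsetP => k; rewrite !inE -!partner_ord.
by apply: contraTT => /negbTE E'; rewrite dcomp_bot // E'.
Qed.

Lemma nvert_dcomp_r A B : inTL A -> inTL B -> (nvert (dcomp A B) <= nvert B)%N.
Proof.
move=> TA TB; have /inTL_wf wfC := inTL_dcomp TA TB.
by rewrite -!nvert_botE //; [exact: nvert_bot_dcomp | exact: inTL_wf].
Qed.

(** Horizontal edges at the top of [A] persist in the product, so its top strand ends are among
    those of [A]; equal numbers make the two sets equal. *)
Lemma dcomp_same_top A B : nvert (dcomp A B) = nvert A -> same_row true A (dcomp A B).
Proof.
move=> E; apply: same_row_ord => k.
have [H|H] := boolP (A (k, true)).2.
  by have := @dcomp_top A B k; rewrite !partner_ord => ->.
split=> //.
have sub : [pred k : 'I_n | ~~ (dcomp A B (k, true)).2] \subset [pred k : 'I_n | ~~ (A (k, true)).2].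
  apply/subsetP => l; rewrite !inE -!partner_ord.
  by apply: contra => E'; rewrite dcomp_top.
have /subset_cardP/(_ sub)/(_ k) := E.
by rewrite !inE H => /negbTE->.
Qed.

Lemma dcomp_same_bot A B : inTL A -> inTL B ->
  nvert (dcomp A B) = nvert B -> same_row false B (dcomp A B).
Proof.
move=> TA TB; have wfC := inTL_wf (inTL_dcomp TA TB); have wfB := inTL_wf TB.
rewrite -!nvert_botE // => E; apply: same_row_ord => k.
case H : (B (k, false)).2; last first.
  by have := @dcomp_bot A B k; rewrite !partner_ord H => ->.
split=> //; have sub : [pred k : 'I_n | (dcomp A B (k, false)).2] \subset [pred k : 'I_n | (B (k, false)).2].
  apply/subsetP => l; rewrite !inE -!partner_ord.
  by apply: contraTT => /negbTE E'; rewrite dcomp_bot // E'.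
have /subset_cardP/(_ sub)/(_ k) := E.
by rewrite !inE H.
Qed.

Lemma nvert_did : nvert (did n) = n.
Proof.
rewrite -[RHS]card_ord; apply: eq_card => k.
by rewrite !inE ffunE.
Qed.

(* Horizontal edges of the top row pair left ends with right ends. *)
End Levels.

(** * Total displacement of the strands and its relation to w *)

Section Displacement.
Variable n : odd_nat.
Let n_odd : odd n := odd_nat_odd n.
Let n_ge3 : (3 <= n)%N := odd_nat_ge3 n.
Implicit Types (A B D : rdiag n) (r : bool).

(* For fixed rows this is n times wnum up to a constant (delta_wnum_diff), but it
   is easier to follow along a composition. *)
Definition delta D : int :=
  \sum_(j : 'I_n | (D (j, false)).2) ((D (j, false)).1 - (j : nat)%:Z).

Lemma bot_thru_same D D' (j : 'I_n) : same_row false D D' -> (D' (j, false)).2 = (D (j, false)).2.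
Proof. by move=> H; have [] := H (j : nat)%:Z; rewrite !partner_ord. Qed.

Lemma delta_diff D D' : same_row false D D' ->
  delta D' - delta D = \sum_(j : 'I_n | (D (j, false)).2) ((D' (j, false)).1 - (D (j, false)).1).
Proof.
move=> H; rewrite /delta (eq_bigl _ _ (fun j => bot_thru_same j H)) -sumrB.
by apply: eq_bigr => j _; lia.
Qed.

Definition exit_up A D (y : int) : int := (odflt (y, true) (trace A D n.+1 y false)).1.

Lemma exit_up_periodic A D y k : exit_up A D (y + k * n%:Z) - (y + k * n%:Z) = exit_up A D y - y.
Proof.
rewrite /exit_up trace_shift; case: (trace _ _ _ _ _) => [[x s]|] /=; lia.
Qed.

Lemma top_thru_bot D (k : 'I_n) : wf n (partner D) -> ~~ (D (k, true)).2 ->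
  exists y, partner D (y, false) = ((k : nat)%:Z, true).
Proof.
move=> wfD nk; have := wf_invol wfD ((k : nat)%:Z, true); rewrite partner_ord.
by case: (D _) nk => y [] //= _; exists y.
Qed.

(** If no strand is lost, [A] prolongs each strand of [D] by an amount that is periodic in its top
    end, so the total gain can be summed over the top ends. *)
Lemma delta_dcomp_exit A D : inTL A -> inTL D -> nvert (dcomp A D) = nvert D ->
  delta (dcomp A D) - delta D =
  \sum_(k : 'I_n | ~~ (D (k, true)).2) (exit_up A D (k : nat)%:Z - (k : nat)%:Z).
Proof.
move=> TA TD Hn; have sb := dcomp_same_bot TA TD Hn.
rewrite (delta_diff sb) -(sum_bot_top (H := fun y => exit_up A D y - y)); last exact: exit_up_periodic.
  apply: eq_bigr => j Dj; congr (_ - _).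
  have [] := sb (j : nat)%:Z; rewrite !partner_ord Dj => C2 _.
  have := partner_dcomp A D ((j : nat)%:Z, false); rewrite /= -[layer _ _ _ _]/(partner D ((j : nat)%:Z, false)).
  rewrite !partner_ord Dj /= => E; rewrite E /exit_up; rewrite E in C2.
  by case: (trace _ _ _ _ _) C2.
exact: inTL_wf.
Qed.

(** The gain is a sum over the top ends of strands, and the paths through [A] see only the top row
    of the lower factor. *)
Lemma delta_dcomp A D D' : inTL A -> inTL D -> inTL D' -> same_row true D D' ->
  nvert (dcomp A D) = nvert D ->
  delta (dcomp A D') - delta D' = delta (dcomp A D) - delta D.
Proof.
move=> TA TD TD' st Hn.
have Hn' : nvert (dcomp A D') = nvert D'.
  by rewrite (same_row_nvert (dcomp_same_row A st)) Hn (same_row_nvert st).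
rewrite !delta_dcomp_exit //; apply: eq_big => k.
  by have [] := st (k : nat)%:Z; rewrite !partner_ord => ->.
move=> nk; congr (_ - _); have nk' : ~~ (D (k, true)).2.
  by have [] := st (k : nat)%:Z; rewrite !partner_ord => <-.
have [y Ey] := top_thru_bot (inTL_wf TD) nk'.
have [] := dcomp_same_bot TA TD Hn y; rewrite Ey => C2 _.
have := partner_dcomp A D (y, false); rewrite /= -[layer _ _ _ _]/(partner D (y, false)) Ey /= => E.
rewrite E in C2; have [_ H] := trace_same_row A n.+1 (k : nat)%:Z false st.
rewrite /exit_up; case: (trace A D _ _ _) C2 H => [z|//] z2 /(_ z erefl).
by move=> ->; rewrite // -z2.
Qed.

(** The arc (i+1, i+2) moves to (i, i+1), and the strand that ended at [i] now ends at [i + 2]; all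
    other strands stay. *)
Lemma delta_slide D (i : 'I_n) : inTL D ->
  partner D ((i : nat)%:Z + 1, true) = ((i : nat)%:Z + 2, true) ->
  (D (i, true)).2 = false -> nvert (dcomp (dE i) D) = nvert D ->
  delta (dcomp (dE i) D) = delta D + 2.
Proof.
move=> TD j1 Di Hn; have TE := inTL_dE i.
have wfD := inTL_wf TD.
apply/eqP; rewrite addrC -subr_eq; apply/eqP.
rewrite (delta_diff (dcomp_same_bot TE TD Hn)).
pose H (x : int) : int := if (n %| x - (i : nat)%:Z)%Z then 2 else 0.
transitivity (\sum_(j : 'I_n | (D (j, false)).2) H (D (j, false)).1).
  apply: eq_bigr => j Dj; rewrite -!partner_ord partner_dcomp_dE //.
  have Dj' : partner D ((j : nat)%:Z, false) = ((D (j, false)).1, true).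
    by rewrite partner_ord -Dj -surjective_pairing.
  rewrite /stepf /= Dj' /inS /= /H.
  case: ifP => [/orP[dv|dv]|]; last by move/negbT; rewrite negb_or => /andP[/negbTE-> _]; rewrite subrr.
    have [c Ec] := dvdzP dv.
    rewrite /sw /= dv (_ : (_, true) = shiftn n c ((i : nat)%:Z + 1, true)).
      by rewrite wf_shift // j1 /=; lia.
    by rewrite /shiftn /=; congr pair; lia.
  have [c Ec] := dvdzP dv.
  have := wf_invol wfD ((j : nat)%:Z, false); rewrite Dj'.
  rewrite (_ : (_, true) = shiftn n c ((i : nat)%:Z + 1, true)); first by rewrite wf_shift // j1.
  by rewrite /shiftn /=; congr pair; lia.
rewrite (sum_bot_top (H := H)) //; last first.
  by move=> x k; rewrite /H addrAC dvdzDM.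
rewrite (bigD1 i) /=; last by rewrite Di.
rewrite {1}/H subrr dvdz0 big1 ?addr0 // => k /andP[_ ki].
rewrite /H; case: ifP => // dv; case/eqP: ki; apply: ord_inj.
have := ltn_ord k; have := ltn_ord i => li lk.
have := @dvd_subn n _ 0 dv (dvdz0 _); lia.
Qed.

(** The number of the cell containing [x] when the line is cut at 1/2 + k n: cell 0 consists of 1,
    ..., n, whence the shift by one. So [wnum] sums the changes of cell along the strands. *)
Definition cpos (x : int) : int := ((x - 1) %/ n%:Z)%Z.
Definition rpos (x : int) : int := ((x - 1) %% n%:Z)%Z.

Lemma cpos_rpos (x : int) : x = cpos x * n%:Z + rpos x + 1.
Proof. by rewrite /cpos /rpos -divz_eq subrK. Qed.

Lemma cposS (x : int) : cpos (x + 1) - cpos x = ((n%:Z %| x)%Z : nat)%:Z.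
Proof.
rewrite /cpos addrK; have n0 : n%:Z != 0 by lia.
have npos : 0 < n%:Z by lia.
have := divz_eq (x - 1) n%:Z; have := ltz_pmod (x - 1) npos; have := modz_ge0 (x - 1) n0.
set q := (_ %/ _)%Z; set s := (_ %% _)%Z => s0 sn E.
have -> : x = q * n%:Z + (s + 1) by lia.
rewrite divzMDl // addrAC subrr add0r.
have [Es|lt] : s + 1 = n%:Z \/ s + 1 < n%:Z by lia.
  rewrite Es divzz n0 (_ : (n%:Z %| _)%Z) //.
  by apply/dvdzP; exists (q + 1); lia.
rewrite divz_small; last by lia.
suff /negbTE-> : ~~ (n%:Z %| (q * n%:Z + (s + 1)))%Z by [].
by rewrite addrC dvdzDM not_dvd_small //; lia.
Qed.

Lemma nmultE (a b : int) : a < b -> (nmult n a (b - 1))%:Z = cpos b - cpos a.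
Proof.
move=> ab; rewrite /nmult ifT; last by lia.
have -> : absz (b - 1 - a + 1) = absz (b - a) by lia.
rewrite [in RHS](_ : b = a + (absz (b - a))%:Z); last by lia.
elim: (absz (b - a)) => [|m IH]; first by rewrite big_ord0 addr0 subrr.
rewrite big_ord_recr /= PoszD IH -cposS (_ : a + m.+1%:Z = a + m%:Z + 1); last by lia.
by rewrite addrC addrA subrK.
Qed.

Lemma wnumE D : wnum D = \sum_(j : 'I_n | (D (j, false)).2) (cpos (D (j, false)).1 - cpos (j : nat)%:Z).
Proof.
rewrite /wnum [RHS]big_mkcond; apply: eq_bigr => j _ /=; case: ifP => // _.
case: ifP => [lt|nlt]; first exact: nmultE.
case: ifP => [lt|nlt']; first by rewrite nmultE // opprB.
have -> : (D (j, false)).1 = (j : nat)%:Z by apply/eqP; rewrite eq_le !leNgt nlt nlt'.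
by rewrite subrr.
Qed.

Lemma rpos_periodic x k : rpos (x + k * n%:Z) = rpos x.
Proof. by rewrite /rpos addrAC addrC modzMDl. Qed.

(** The displacement of a strand is [n] times its change of cell plus its change of position within
    the cell. The latter, summed over all strands, depends only on the two rows. *)
Lemma delta_wnum D : wf n (partner D) -> delta D = wnum D * n%:Z +
  (\sum_(k : 'I_n | ~~ (D (k, true)).2) rpos (k : nat)%:Z
   - \sum_(j : 'I_n | (D (j, false)).2) rpos (j : nat)%:Z).
Proof.
move=> wfD; rewrite -(sum_bot_top (H := rpos)) //; last exact: rpos_periodic.
rewrite wnumE mulr_suml -sumrB -big_split; apply: eq_bigr => j _ /=.
have := cpos_rpos (D (j, false)).1; have := cpos_rpos (j : nat)%:Z.
move: (D (j, false)).1 (j : nat)%:Z => x y; move: (cpos x) (cpos y) (rpos x) (rpos y) => *; lia.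
Qed.

Lemma delta_wnum_diff D D' : wf n (partner D) -> wf n (partner D') ->
  same_row true D D' -> same_row false D D' ->
  delta D' - delta D = (wnum D' - wnum D) * n%:Z.
Proof.
move=> wfD wfD' st sb; rewrite !delta_wnum //.
have -> : \sum_(k : 'I_n | ~~ (D' (k, true)).2) rpos (k : nat)%:Z =
    \sum_(k : 'I_n | ~~ (D (k, true)).2) rpos (k : nat)%:Z.
  by apply: eq_bigl => j; have [] := st (j : nat)%:Z; rewrite !partner_ord => ->.
rewrite [\sum_(j | (D' (j, false)).2) _](eq_bigl _ _ (fun j => bot_thru_same j sb)).
by rewrite opprD addrACA subrr addr0 mulrBl.
Qed.

Lemma delta_even D : wf n (partner D) -> (2 %| delta D)%Z.
Proof.
move=> wfD; apply: (big_ind (fun x => (2 %| x)%Z)) => [|x y|j Dj]; [by []|lia|].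
have := wf_parity wfD ((j : nat)%:Z, false); rewrite partner_ord /parity_node Dj /=; lia.
Qed.

Lemma wnum_parity D D' : wf n (partner D) -> wf n (partner D') ->
  same_row true D D' -> same_row false D D' -> (2 %| wnum D' - wnum D)%Z.
Proof.
move=> wfD wfD' st sb; apply: (odd_dvdzM n_odd); rewrite -delta_wnum_diff //.
by have := delta_even wfD; have := delta_even wfD'; lia.
Qed.

Lemma thru_mono D b b' a a' : wf n (partner D) ->
  partner D (b, false) = (a, true) -> partner D (b', false) = (a', true) -> (b < b') = (a < a').
Proof.
move=> wfD E E'; have [Eb|ne] := eqVneq b b'.
  by move: E; rewrite Eb E' => -[->]; rewrite !ltxx.
have na : a != a'.
  apply: contraNneq ne => Ea; apply/eqP; move: E'; rewrite -Ea -E.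
  by move/(wf_inj wfD) => -[].
have := wf_planar wfD (p := (b, false)) (z := (b', false)).
rewrite /side /hbelow E E' -!pair_eqE /=; lia.
Qed.

(* If D and D' have the same rows and D' moves some strand to the right of where
   D puts it, it moves no strand to the left: D^-1 D' preserves the order of the
   bottom ends of strands. *)
Lemma same_sign D D' b b0 x y x0 y0 : wf n (partner D) -> wf n (partner D') ->
  same_row true D D' -> same_row false D D' ->
  partner D (b, false) = (x, true) -> partner D' (b, false) = (y, true) ->
  partner D (b0, false) = (x0, true) -> partner D' (b0, false) = (y0, true) ->
  x < y -> x0 <= y0.
Proof.
move=> wfD wfD' st sb Eb Eb' E0 E0' lt.
wlog lb : b0 x0 y0 E0 E0' / b < b0 => [IH|].
  pose c : int := (absz (b - b0))%:Z + 1.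
  have := IH (b0 + c * n%:Z) (x0 + c * n%:Z) (y0 + c * n%:Z).
  have := partner_shift D c (b0, false); rewrite E0 /shiftn /= => ->.
  have := partner_shift D' c (b0, false); rewrite E0' /shiftn /= => ->.
  by move=> /(_ erefl erefl); nia.
rewrite leNgt; apply/negP => lt0.
(* Put g = D^-1 D' on bottom ends. The iterates of g from [b] increase and stay below [b0], since
   g(b) < g(b0) < b0; but only finitely many integers lie between. *)
have [m] := ubnP (absz (b0 - b)); elim: m b x y Eb Eb' lt lb => // m IH b x y Eb Eb' lt lb ltm.
have thr : (partner D (y, true)).2 = false.
  by have [<- _] := st y; rewrite -Eb' (wf_invol wfD').
case E1: (partner D (y, true)) thr => [b1 s] /= Es; subst s.
have {}E1 : partner D (b1, false) = (y, true) by rewrite -E1 (wf_invol wfD).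
have [z E1'] : exists z, partner D' (b1, false) = (z, true).
  have [] := sb b1; rewrite E1.
  by case: (partner D' (b1, false)) => z [] // _; exists z.
have lbb1 : b < b1 by rewrite (thru_mono wfD Eb E1).
apply: (IH b1 y z) => //.
- by rewrite -(thru_mono wfD' Eb' E1').
- by rewrite (thru_mono wfD E1 E0) (lt_trans _ lt0) // -(thru_mono wfD' Eb' E0').
- have : b1 < b0 by rewrite (thru_mono wfD E1 E0) (lt_trans _ lt0) // -(thru_mono wfD' Eb' E0').
  lia.
Qed.

(** By [same_sign] the differences between the top ends under [D] and [D'] all have the same sign.
    Their sum is zero, so each vanishes. *)
Lemma same_rows_delta_inj D D' : wf n (partner D) -> wf n (partner D') ->
  same_row true D D' -> same_row false D D' -> delta D' = delta D -> D' = D.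
Proof.
move=> wfD wfD' st sb /eqP; rewrite -subr_eq0 (delta_diff sb) => /eqP sum0.
have strand (j : 'I_n) : (D (j, false)).2 -> exists x y,
    partner D ((j : nat)%:Z, false) = (x, true) /\ partner D' ((j : nat)%:Z, false) = (y, true).
  move=> Dj; have := bot_thru_same j sb; rewrite Dj !partner_ord.
  by case: (D _) Dj => x [] // _; case: (D' _) => y [] // _; exists x, y.
have nlt (j : 'I_n) : (D (j, false)).2 -> ~~ ((D (j, false)).1 < (D' (j, false)).1).
  move=> Dj; have [x [y [Ex Ey]]] := strand j Dj; apply/negP => lt.
  have := sum0; rewrite (bigD1 j) //= => /eqP; rewrite paddr_eq0.
  - by move/andP=> [/eqP]; lia.
  - lia.
  - apply: sumr_ge0 => k /andP[Dk _]; have [x' [y' [Ex' Ey']]] := strand k Dk.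
    have := same_sign wfD wfD' st sb Ex Ey Ex' Ey'.
    by move: Ex Ey Ex' Ey' lt; rewrite !partner_ord => -> -> -> -> /= lt /(_ lt); rewrite subr_ge0.
have ngt (j : 'I_n) : (D (j, false)).2 -> ~~ ((D' (j, false)).1 < (D (j, false)).1).
  move=> Dj; have [x [y [Ex Ey]]] := strand j Dj; apply/negP => lt.
  have := sum0; rewrite (bigD1 j) //= => /eqP; rewrite -oppr_eq0 opprD -sumrN paddr_eq0.
  - by move/andP=> [/eqP]; lia.
  - lia.
  - apply: sumr_ge0 => k /andP[Dk _]; have [x' [y' [Ex' Ey']]] := strand k Dk.
    have := same_sign wfD' wfD (same_row_sym st) (same_row_sym sb) Ey Ex Ey' Ex'.
    by move: Ex Ey Ex' Ey' lt; rewrite !partner_ord => -> -> -> -> /= lt /(_ lt); rewrite opprB subr_ge0.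
have bot p : p.2 = false -> partner D' p = partner D p.
  have [k [c ->]] := node_decomp n p; rewrite !partner_shift /= => ->; congr shiftn.
  have [E1 E2] := sb (k : nat)%:Z.
  case Dk: (partner D ((k : nat)%:Z, false)).2; last by rewrite E2 // Dk.
  rewrite [LHS]surjective_pairing [RHS]surjective_pairing E1 Dk; congr pair.
  rewrite partner_ord in Dk; have := nlt k Dk; have := ngt k Dk; rewrite !partner_ord; lia.
apply: partner_ext => -[x []]; last exact: bot.
have [E1 E2] := st x; case Dx: (partner D (x, true)) => [y []].
  by rewrite E2 ?Dx.
apply: (wf_inj wfD'); rewrite (wf_invol wfD') bot //.
by rewrite -Dx (wf_invol wfD).
Qed.

End Displacement.

(** * Sliding arcs into standard position *)

Lemma stepf_periodic (n : odd_nat) (i c : int) f p :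
  stepf n (i + c * n%:Z) f p = stepf n i f p.
Proof.
have dv (x : int) : (n%:Z %| x - (i + c * n%:Z))%Z = (n%:Z %| x - i)%Z.
  by rewrite -(dvdzDM n%:Z (x - i) (- c)) (_ : x - i + _ = x - (i + c * n%:Z)) //; lia.
have inSE q : inS n (i + c * n%:Z) q = inS n i q.
  rewrite /inS !dv; congr (_ && (_ || _)).
  by rewrite -(dvdzDM n%:Z (q.1 - i - 1) (- c)) (_ : q.1 - i - 1 + _ = q.1 - (i + c * n%:Z) - 1) //; lia.
have swE q : sw n (i + c * n%:Z) q = sw n i q by rewrite /sw dv.
by rewrite /stepf !inSE !swE.
Qed.

Lemma sum_nat_lt3 (T : finType) (F G : T -> nat) (a b c : T) :
  a != b -> a != c -> b != c -> (forall k, k != a -> k != b -> k != c -> F k = G k) ->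
  (F a + F b + F c < G a + G b + G c)%N -> (\sum_k F k < \sum_k G k)%N.
Proof.
move=> ab ac bc eqFG lt.
have split3 H : (\sum_k H k = H a + H b + H c +
    \sum_(k | (k != a) && (k != b) && (k != c)) H k)%N.
  by rewrite (bigD1 a) // (bigD1 b) 1?eq_sym // (bigD1 c) ?[c == _]eq_sym ?ac ?bc //= !addnA.
rewrite !split3 (eq_bigr G) => [|k /andP[/andP[ka kb] kc]]; last exact: eqFG.
by rewrite ltn_add2r.
Qed.

Section Slide.
Variable n : odd_nat.
Let n_odd : odd n := odd_nat_odd n.
Let n_ge3 : (3 <= n)%N := odd_nat_ge3 n.
Implicit Types (A B D X : rdiag n) (i : 'I_n).

Definition reach D D' := exists2 X, inTL X & dcomp X D = D'.

(** Generating the same left ideal (Green's L-equivalence), loop scalars disregarded. *)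
Definition mutual D D' := reach D D' /\ reach D' D.

Lemma reach_refl D : inTL D -> reach D D.
Proof. by move=> TD; exists (did n); [constructor | apply/dcomp_did/inTL_wf]. Qed.

Lemma reach_trans D2 D1 D3 : inTL D1 -> reach D1 D2 -> reach D2 D3 -> reach D1 D3.
Proof.
move=> TD [X TX <-] [Y TY <-]; exists (dcomp Y X); first exact: inTL_dcomp.
by rewrite dcompA.
Qed.

Lemma reach_inTL D D' : inTL D -> reach D D' -> inTL D'.
Proof. by move=> TD [X TX <-]; exact: inTL_dcomp. Qed.

Lemma mutual_trans D2 D1 D3 : inTL D1 -> mutual D1 D2 -> mutual D2 D3 -> mutual D1 D3.
Proof.
move=> TD [r12 r21] [r23 r32]; have TD2 := reach_inTL TD r12.
split; first exact: reach_trans r12 r23.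
by apply: reach_trans r32 r21; exact: reach_inTL r23.
Qed.

Lemma mutual_inTL D D' : inTL D -> mutual D D' -> inTL D'.
Proof. by move=> TD [/(reach_inTL TD)]. Qed.

Lemma reach_nvert D D' : inTL D -> reach D D' -> (nvert D' <= nvert D)%N.
Proof. by move=> TD [X TX <-]; exact: nvert_dcomp_r. Qed.

Lemma mutual_nvert D D' : inTL D -> mutual D D' -> nvert D' = nvert D.
Proof.
move=> TD [r r']; apply/eqP; rewrite eqn_leq reach_nvert //=.
by apply: reach_nvert r'; exact: reach_inTL r.
Qed.

Section OneSlide.
Variables (D : rdiag n) (i : 'I_n).
Hypothesis TD : inTL D.
Hypothesis arc : partner D ((i : nat)%:Z + 1, true) = ((i : nat)%:Z + 2, true).
Local Notation f := (partner D).
Local Notation I := ((i : nat)%:Z).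
Let wfD := inTL_wf TD.
Let D1 := dcomp (dE i) D.
Let f1E := partner_dcomp_dE i wfD.

Lemma slide_inTL : inTL D1. Proof. by apply: inTL_dcomp => //; exact: inTL_dE. Qed.

Lemma slide_arc k : f (I + 1 + k * n%:Z, true) = (I + 2 + k * n%:Z, true).
Proof. by have := wf_shift wfD k (I + 1, true); rewrite arc. Qed.

Lemma slide_arc' k : f (I + 2 + k * n%:Z, true) = (I + 1 + k * n%:Z, true).
Proof. by rewrite -slide_arc (wf_invol wfD). Qed.

Lemma inS_l k : inS n I (I + k * n%:Z, true).
Proof. by apply/inSP; exists k; left. Qed.

Lemma inS_r k : inS n I (I + 1 + k * n%:Z, true).
Proof. by apply/inSP; exists k; right. Qed.

Lemma nin_2 k : inS n I (I + 2 + k * n%:Z, true) = false.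
Proof.
apply/negbTE/inSP => -[l [] [E]].
  by have := @mulz_small (l - k) n%:Z 2; lia.
by have := @mulz_small (l - k) n%:Z 1; lia.
Qed.

Lemma slide_l k : partner D1 (I + k * n%:Z, true) = (I + 1 + k * n%:Z, true).
Proof. by rewrite f1E stepf_in ?inS_l // sw_l. Qed.

Lemma slide_r k : partner D1 (I + 1 + k * n%:Z, true) = (I + k * n%:Z, true).
Proof. by rewrite f1E stepf_in ?inS_r // sw_r. Qed.

Lemma slide_2 k : partner D1 (I + 2 + k * n%:Z, true) = f (I + k * n%:Z, true).
Proof. by rewrite f1E /stepf nin_2 slide_arc' inS_r sw_r. Qed.

Lemma slide_via k p : f p = (I + k * n%:Z, true) -> ~~ inS n I p ->
  partner D1 p = (I + 2 + k * n%:Z, true).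
Proof. by move=> E nS; rewrite f1E stepf_via // E ?inS_l // sw_l slide_arc. Qed.

Lemma slide_other p : (forall k, p != (I + 2 + k * n%:Z, true)) ->
  (forall k, f p != (I + k * n%:Z, true)) -> ~~ inS n I p -> partner D1 p = f p.
Proof.
move=> n2 nfi nS; rewrite f1E stepf_out //; apply/inSP => -[k [] E].
  by move: (nfi k); rewrite E eqxx.
by case/eqP: (n2 k); rewrite -slide_arc -E (wf_invol wfD).
Qed.

(** This is the relation E_(i+1) E_i E_(i+1) = E_(i+1) applied to a diagram whose top row has the
    arc (i+1, i+2). *)
Lemma slide_back : exists2 j : 'I_n, exists c, I + 1 = (j : nat)%:Z + c * n%:Z & dcomp (dE j) D1 = D.
Proof.
pose j := resid (I + 1) i; have [c [Ec]] := node_resid (I + 1) i true.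
exists j; first by exists c.
have swj k : sw n (I + 1) (I + 1 + k * n%:Z, true) = (I + 2 + k * n%:Z, true).
  by rewrite sw_l; congr pair; lia.
have swj' k : sw n (I + 1) (I + 2 + k * n%:Z, true) = (I + 1 + k * n%:Z, true).
  by rewrite (_ : I + 2 = I + 1 + 1) ?sw_r //; lia.
have inj k : inS n (I + 1) (I + 1 + k * n%:Z, true) by apply/inSP; exists k; left.
have inj2 k : inS n (I + 1) (I + 2 + k * n%:Z, true).
  by apply/inSP; exists k; right; congr pair; lia.
have fj : f (I + 1, true) = (I + 1 + 1, true) by rewrite arc; congr pair; lia.
apply: partner_ext => p; rewrite partner_dcomp_dE; last exact: inTL_wf slide_inTL.
rewrite -(stepf_periodic _ _ c) -Ec.
have [Sj|nSj] := boolP (inS n (I + 1) p).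
  by rewrite stepf_in // (joined_all wfD fj).
have [Si|nSi] := boolP (inS n I p).
  have [k Ep] : exists k, p = (I + k * n%:Z, true).
    case/inSP: Si => k [] E; first by exists k.
    by rewrite E inj in nSj.
  by rewrite /stepf (negbTE nSj) Ep slide_l inj swj slide_2.
have [Sq|nSq] := boolP (inS n I (f p)).
  have [k Eq] : exists k, f p = (I + k * n%:Z, true).
    case/inSP: Sq => k [] E; first by exists k.
    by case/negP: nSj; rewrite -[p](wf_invol wfD) E slide_arc.
  by rewrite /stepf (negbTE nSj) (slide_via Eq nSi) inj2 swj' slide_r Eq.
have f1p : partner D1 p = f p by rewrite f1E stepf_out.
rewrite /stepf (negbTE nSj) f1p ifN //; apply/negP => Sfj.
case/negP: nSj; have := joined_all wfD fj Sfj; rewrite (wf_invol wfD) => ->.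
exact: inS_sw.
Qed.

Lemma slide_mutual : mutual D D1.
Proof.
split; first by exists (dE i); [exact: inTL_dE|].
by have [j _ E] := slide_back; exists (dE j); [exact: inTL_dE|].
Qed.

End OneSlide.
End Slide.

(** * Removing nested arcs *)

Section Normalize.
Variable n : odd_nat.
Let n_odd : odd n := odd_nat_odd n.
Let n_ge3 : (3 <= n)%N := odd_nat_ge3 n.
Implicit Types (A B D X : rdiag n) (i : 'I_n).

Definition unnested D := forall x y, partner D (x, true) = (y, true) -> x < y -> y = x + 1.

Definition arc_len D (k : 'I_n) : nat :=
  if (D (k, true)).2 && ((k : nat)%:Z < (D (k, true)).1) then absz ((D (k, true)).1 - (k : nat)%:Z) else 0%N.

Lemma arc_len_shift D x y (d : 'I_n) r : partner D (x, true) = (y, r) ->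
  arc_len D (resid x d) = if r && (x < y) then absz (y - x) else 0%N.
Proof.
have [k [Ex]] := node_resid x d true; set j := resid x d in Ex *.
have := partner_shift_ord D j true k; rewrite /shiftn /= -Ex => -> [<- <-].
rewrite /arc_len Ex ltrD2r; case: ifP => // _; congr absz; lia.
Qed.

Lemma resid_ord i (d : 'I_n) : resid (i : nat)%:Z d = i.
Proof. by have := resid_shift i d 0; rewrite mul0r addr0. Qed.

Lemma resid_neq x y (d : 'I_n) : x != y -> - n%:Z < x - y -> x - y < n%:Z -> resid x d != resid y d.
Proof. by move=> ne lo hi; rewrite resid_eq not_dvd_small // subr_eq0. Qed.

Lemma not_resid_shift x (d k : 'I_n) c : k != resid x d -> (k : nat)%:Z != x + c * n%:Z.
Proof.
apply: contraNneq => E; apply/eqP; rewrite -(resid_ord k d); apply/eqP.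
by rewrite resid_eq E addrAC subrr add0r dvdz_mull.
Qed.

(** The arcs (i, y) and (i+1, i+2) become (i, i+1) and (i+2, y), so the total arc length drops by
    2. *)
Lemma nested_slide D i y : inTL D ->
  partner D ((i : nat)%:Z + 1, true) = ((i : nat)%:Z + 2, true) ->
  partner D ((i : nat)%:Z, true) = (y, true) -> (i : nat)%:Z + 2 < y ->
  (\sum_k arc_len (dcomp (dE i) D) k < \sum_k arc_len D k)%N.
Proof.
move=> TD arc Ei lty; have wfD := inTL_wf TD.
have E k : partner D ((i : nat)%:Z + k * n%:Z, true) = (y + k * n%:Z, true).
  by have := wf_shift wfD k ((i : nat)%:Z, true); rewrite Ei.
have l0 := slide_l i TD 0; have l1 := slide_r i TD 0; have l2 := slide_2 TD arc 0.
have a2 := slide_arc' TD arc 0.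
rewrite !mul0r !addr0 in l0 l1 l2 a2; rewrite Ei in l2.
apply: (sum_nat_lt3 (a := resid (i : nat)%:Z i) (b := resid ((i : nat)%:Z + 1) i)
  (c := resid ((i : nat)%:Z + 2) i)); try by apply: resid_neq; lia.
  move=> k k0 k1 k2.
  have n0 := fun c => not_resid_shift c k0; have n1 := fun c => not_resid_shift c k1.
  have n2 := fun c => not_resid_shift c k2.
  have nS : ~~ inS n (i : nat)%:Z ((k : nat)%:Z, true).
    by apply/inSP => -[c [] [Ek]]; [case/eqP: (n0 c) | case/eqP: (n1 c)].
  have [Sk|nSk] := boolP (inS n (i : nat)%:Z (partner D ((k : nat)%:Z, true))).
    have [c Ec] : exists c, partner D ((k : nat)%:Z, true) = ((i : nat)%:Z + c * n%:Z, true).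
      case/inSP: Sk => c [] Ec; first by exists c.
      by case/eqP: (n2 c); move: Ec; rewrite -(slide_arc' TD arc) => /(wf_inj wfD)[].
    have Ek : (k : nat)%:Z = y + c * n%:Z.
      by have := E c; rewrite -Ec (wf_invol wfD) => -[].
    rewrite -(resid_ord k k) (arc_len_shift k (slide_via TD arc Ec nS)) (arc_len_shift k Ec).
    by rewrite !ifF //; lia.
  rewrite /arc_len -!partner_ord slide_other //.
    by move=> c; apply/eqP => -[Ek]; case/eqP: (n2 c).
  by move=> c; apply: contraNneq nSk => ->; exact: inS_l.
rewrite (arc_len_shift i l0) (arc_len_shift i l1) (arc_len_shift i l2).
rewrite (arc_len_shift i Ei) (arc_len_shift i arc) (arc_len_shift i a2) /=.
by do !case: ifP; lia.
Qed.

(** By planarity the partner of [x + 1] lies under the arc from [x]. It is [x + 2], or the search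
    continues with the shorter arc from [x + 1]. *)
Lemma nested_inner D x y : wf n (partner D) -> partner D (x, true) = (y, true) -> x + 1 < y ->
  exists x' y', [/\ partner D (x', true) = (y', true),
    partner D (x' + 1, true) = (x' + 2, true) & x' + 2 < y'].
Proof.
move=> wfD; have [m] := ubnP (absz (y - x)); elim: m x y => // m IH x y ltm E lt.
have pl := wf_planar wfD (p := (x, true)) (z := (x + 1, true)).
case E1: (partner D (x + 1, true)) pl => [z s].
have ne := wf_neq wfD (x + 1, true); rewrite E1 in ne.
have nx : (z, s) != (x, true).
  apply/eqP => Ez; have := wf_invol wfD (x + 1, true); rewrite E1 Ez E => -[]; lia.
have ny : (z, s) != (y, true).
  by apply/eqP => Ez; have := wf_inj wfD (etrans E1 (etrans Ez (esym E))); case; lia.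
rewrite /side /hbelow E; move: ne nx ny; rewrite -!pair_eqE /=; case: s E1 => E1; last by lia.
move=> ne nx ny pl; have [Ez|nz] := eqVneq z (x + 2).
  by exists x, y; split=> //; [rewrite E1 Ez | lia].
by apply: (IH (x + 1) z) => //; lia.
Qed.

Lemma unnest D : inTL D -> exists2 D', mutual D D' & unnested D'.
Proof.
have [m] := ubnP (\sum_k arc_len D k)%N; elim: m D => // m IH D ltm TD.
have wfD := inTL_wf TD.
case: (classic (unnested D)) => [un|nun]; first by exists D => //; split; exact: reach_refl.
have [x [y [E lt]]] : exists x y, partner D (x, true) = (y, true) /\ x + 1 < y.
  apply: NNPP => H; apply: nun => x y E lt; apply: NNPP => ne; apply: H; exists x, y; split=> //; lia.
have [x' [y' [Ex Ex1 lt']]] := nested_inner wfD E lt.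
have [i [c [Ei]]] := node_decomp n (x', true).
have sh a b : partner D (a, true) = (b, true) -> partner D (a - c * n%:Z, true) = (b - c * n%:Z, true).
  by move=> Eab; have := wf_shift wfD (- c) (a, true); rewrite Eab /shiftn /= mulNr.
have arc : partner D ((i : nat)%:Z + 1, true) = ((i : nat)%:Z + 2, true).
  by have := sh _ _ Ex1; rewrite Ei; congr (partner D (_, _) = (_, _)); lia.
have Ey : partner D ((i : nat)%:Z, true) = (y' - c * n%:Z, true).
  by have := sh _ _ Ex; rewrite Ei; congr (partner D (_, _) = (_, _)); lia.
have lt1 : (\sum_k arc_len (dcomp (dE i) D) k < m)%N.
  by apply: leq_trans (nested_slide TD arc Ey _) ltm; lia.
have [D' mu un] := IH _ lt1 (slide_inTL i TD).
by exists D' => //; apply: mutual_trans mu => //; exact: slide_mutual.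
Qed.

End Normalize.

Lemma sum_nat_change2 (T : finType) (F G : T -> nat) (a b : T) :
  a != b -> (forall k, k != a -> k != b -> F k = G k) ->
  (\sum_k F k + (G a + G b) = \sum_k G k + (F a + F b))%N.
Proof.
move=> ab eqFG; have split2 H : (\sum_k H k = H a + H b + \sum_(k | (k != a) && (k != b)) H k)%N.
  by rewrite (bigD1 a) // (bigD1 b) 1?eq_sym //= addnA.
rewrite !split2 (eq_bigr G) => [|k /andP[ka kb]]; last exact: eqFG.
by rewrite addnAC [RHS]addnAC [(F a + F b + _)%N]addnC.
Qed.

(** * Sliding short arcs to the left over strands *)

Section Pattern.
Variable n : odd_nat.
Let n_odd : odd n := odd_nat_odd n.
Let n_ge3 : (3 <= n)%N := odd_nat_ge3 n.
Implicit Types (A B D X : rdiag n) (i : 'I_n).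

Definition is_arc D (x : int) := partner D (x, true) == (x + 1, true).

Definition arc_pos D (k : 'I_n) : nat := if is_arc D (k : nat)%:Z then k : nat else 0%N.

Definition pos_sum D : nat := (\sum_k arc_pos D k)%N.

Section ThruSlide.
Variables (D : rdiag n) (i : 'I_n).
Hypothesis TD : inTL D.
Local Notation I := ((i : nat)%:Z).
Hypothesis arc : partner D (I + 1, true) = (I + 2, true).
Hypothesis thr : (D (i, true)).2 = false.
Let wfD := inTL_wf TD.
Let D1 := dcomp (dE i) D.

Lemma thru_shift k : (partner D (I + k * n%:Z, true)).2 = false.
Proof. by have := partner_shift_ord D i true k; rewrite /shiftn /= => ->. Qed.

Lemma slide_thru (p : node) : p.2 -> ~~ inS n I p ->
  (partner D1 p).2 = false /\ (exists c, p = (I + 2 + c * n%:Z, true)) \/ partner D1 p = partner D p.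
Proof.
move=> p2 nS; case: (classic (exists c, p = (I + 2 + c * n%:Z, true))) => [[c Ec]|nc].
  by left; split; [rewrite Ec slide_2 // thru_shift | exists c].
right; apply: slide_other => // k; apply/eqP => E; first by apply: nc; exists k.
by have := thru_shift k; rewrite -E (wf_invol wfD) p2.
Qed.

Lemma slide_thru_unnested : unnested D -> unnested D1.
Proof.
move=> un x y E lt; have [Sx|nS] := boolP (inS n I (x, true)).
  case/inSP: Sx => k [] [Ex].
    by move: E; rewrite Ex slide_l // => -[<-]; lia.
  by move: E lt; rewrite Ex slide_r // => -[<-]; lia.
case: (slide_thru (p := (x, true)) erefl nS); rewrite E; first by case.
by move=> E'; apply: un.
Qed.

Lemma slide_thru_delta : delta D1 = delta D + 2.
Proof. by apply: delta_slide => //; apply: mutual_nvert => //; exact: slide_mutual. Qed.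

(** The sum of positions falls by 1, except when the arc crosses the cut from 0 to [n - 1], where it
    rises by [n - 1]. The residue of [i + 1] covers both cases. *)
Lemma slide_thru_pos : (pos_sum D1 + resid (I + 1) i = pos_sum D + i)%N.
Proof.
have i1 : i != resid (I + 1) i by rewrite -{1}(resid_ord i i) resid_neq //; lia.
have D1i : arc_pos D1 i = i.
  by rewrite /arc_pos /is_arc; have := slide_l i TD 0; rewrite mul0r !addr0 => ->; rewrite eqxx.
have Di : arc_pos D i = 0%N.
  rewrite /arc_pos /is_arc partner_ord ifN //; by apply/eqP => E; have := thr; rewrite E.
have [c [Ec]] := node_resid (I + 1) i true.
have per (D0 : rdiag n) a b : partner D0 (I + 1, true) = (I + 1 + a, b) ->
    is_arc D0 (resid (I + 1) i : nat)%:Z = (a == 1) && b.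
  rewrite /is_arc {1}Ec; have := partner_shift D0 c ((resid (I + 1) i : nat)%:Z, true).
  rewrite /shiftn /= => -> [E Eb]; rewrite [X in X == _]surjective_pairing -pair_eqE /= Eb.
  by rewrite eqb_id; congr (_ && _); lia.
have D1r : arc_pos D1 (resid (I + 1) i) = 0%N.
  rewrite /arc_pos (per _ (-1) true) //.
  by have := slide_r i TD 0; rewrite mul0r !addr0 => ->; congr pair; lia.
have Dr : arc_pos D (resid (I + 1) i) = resid (I + 1) i.
  by rewrite /arc_pos (per _ 1 true) ?eqxx // arc; congr pair; lia.
have := @sum_nat_change2 _ (arc_pos D1) (arc_pos D) _ _ i1.
rewrite D1i Di D1r Dr add0n addn0; apply=> k k0 k1.
rewrite /arc_pos /is_arc; have nS : ~~ inS n I ((k : nat)%:Z, true).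
  rewrite -{1}(resid_ord i i) in k0.
  apply/inSP => -[d [] [Ek]]; first by case/eqP: (not_resid_shift d k0).
  by case/eqP: (not_resid_shift d k1).
case: (slide_thru (p := ((k : nat)%:Z, true)) erefl nS) => [[E [d [Ed]]]|->] //.
rewrite ifN; last by apply/eqP => E'; rewrite E' in E.
rewrite ifN // Ed slide_arc' //; apply/eqP => -[]; lia.
Qed.

End ThruSlide.

(* The top row is m arcs (0,1), (2,3), ... followed by n - 2m strands. *)
Definition is_pattern (m : nat) D := forall k : 'I_n,
  if (k < m.*2)%N then partner D ((k : nat)%:Z, true) =
      (if odd k then (k : nat)%:Z - 1 else (k : nat)%:Z + 1, true)
  else (D (k, true)).2 = false.

Lemma pattern_same_row m D D' : is_pattern m D -> is_pattern m D' -> same_row true D D'.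
Proof.
move=> P P'; apply: same_row_ord => k; have := P k; have := P' k; rewrite !partner_ord.
by case: ifP => _ -> ->.
Qed.

Lemma pattern_nvert m D : (m.*2 <= n)%N -> is_pattern m D -> nvert D = (n - m.*2)%N.
Proof.
move=> le P; rewrite /nvert -sum1_card.
rewrite (eq_bigl (fun k : 'I_n => (m.*2 <= k)%N)) => [|k]; last first.
  by rewrite !inE leqNgt; have := P k; rewrite partner_ord; case: ifP => _ ->.
transitivity (\sum_(m.*2 <= k < n) 1)%N; last by rewrite sum_nat_const_nat muln1.
by rewrite big_geq_mkord.
Qed.

Lemma pos_sum_same_row D D' : same_row true D D' -> pos_sum D' = pos_sum D.
Proof.
move=> H; apply: eq_bigr => k _; rewrite /arc_pos /is_arc.
have [E1 E2] := H (k : nat)%:Z; case E: (partner D ((k : nat)%:Z, true)).2.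
  by rewrite E2.
by rewrite E in E1; rewrite !ifN //; apply/eqP => E'; [move: E|move: E1]; rewrite E'.
Qed.

End Pattern.

Section Standard.
Variable n : odd_nat.
Let n_odd : odd n := odd_nat_odd n.
Let n_ge3 : (3 <= n)%N := odd_nat_ge3 n.
Implicit Types (A B D X : rdiag n) (i : 'I_n).

Lemma is_arc_shift D (x y : int) c : x = y + c * n%:Z -> is_arc D x = is_arc D y.
Proof.
move=> ->; have := partner_shift D c (y, true); rewrite /is_arc /shiftn /= => ->.
by rewrite [in RHS](surjective_pairing (partner D (y, true))) -!pair_eqE /=; lia.
Qed.

Lemma is_arc_disj D x : wf n (partner D) -> is_arc D x -> is_arc D (x + 1) -> False.
Proof.
move=> wfD /eqP E /eqP E'; have := wf_invol wfD (x, true); rewrite E E' => -[]; lia.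
Qed.

Section Unnested.
Variable D : rdiag n.
Hypothesis TD : inTL D.
Hypothesis un : unnested D.
Let wfD := inTL_wf TD.

Lemma unnested_top x : (partner D (x, true)).2 -> is_arc D x \/ is_arc D (x - 1).
Proof.
case E: (partner D (x, true)) => [y []] // _; have [lt|gt|Ey] := ltgtP x y.
- by left; rewrite /is_arc E (un E lt).
- have E' : partner D (y, true) = (x, true) by rewrite -E (wf_invol wfD).
  by right; rewrite /is_arc (_ : x - 1 = y) ?E' (un E' gt) // addrK.
- by have := wf_neq wfD (x, true); rewrite E Ey eqxx.
Qed.

(* No arc can be slid to the left inside the window 0..n-1. *)
Hypothesis stuck : forall x, 0 <= x -> x + 1 < n%:Z -> is_arc D (x + 1) ->
  (partner D (x, true)).2.

(** The node [x] carries no strand, and it cannot be the left end of an arc since [x + 1] is one; so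
    it is a right end. *)
Lemma stuck_pred x : 0 <= x -> x + 1 < n%:Z -> is_arc D (x + 1) -> is_arc D (x - 1).
Proof.
move=> x0 xn a1; case: (unnested_top (stuck x0 xn a1)) => // a0.
by case: (is_arc_disj wfD a0 a1).
Qed.

Lemma stuck_down (k j : nat) : (k < n)%N -> is_arc D k%:Z -> (j.*2 <= k)%N -> is_arc D (k - j.*2)%N%:Z.
Proof.
move=> kn ak; elim: j => [|j IH] le; first by rewrite subn0.
have {}IH := IH (ltnW (ltnW le)).
have := @stuck_pred (k - j.*2)%N.-1%:Z; rewrite doubleS in le *.
rewrite (_ : _.-1%:Z + 1 = (k - j.*2)%N%:Z); last by lia.
rewrite (_ : _.-1%:Z - 1 = (k - j.*2.+2)%N%:Z); last by lia.
by apply => //; lia.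
Qed.

(** From an arc at an odd place one descends by twos to an arc at 1, then to -1, which is [n - 1]
    mod [n]. As [n - 1] is even, the descent continues to 0, where the arc overlaps the one at 1. *)
Lemma stuck_even (k : nat) : (k < n)%N -> is_arc D k%:Z -> ~~ odd k.
Proof.
move=> kn ak; apply/negP => ok.
have a1 : is_arc D 1.
  by have := @stuck_down k k./2 kn ak; rewrite (_ : (k - _)%N = 1%N) => [|]; [apply|]; lia.
have am : is_arc D (-1) by have := @stuck_pred 0; rewrite add0r sub0r; apply => //; lia.
have an : is_arc D (n.-1)%:Z by rewrite (@is_arc_shift _ _ (-1) 1) //; lia.
have a0 : is_arc D 0.
  have := @stuck_down n.-1 n./2 _ an; rewrite (_ : (n.-1 - _)%N = 0%N); last by lia.
  by apply; lia.
by apply: (is_arc_disj wfD a0); rewrite add0r.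
Qed.

Lemma stuck_last : ~ is_arc D (n.-1)%:Z.
Proof.
move=> an; have a0 : is_arc D 0.
  have := @stuck_down n.-1 n./2 _ an; rewrite (_ : (n.-1 - _)%N = 0%N); last by lia.
  by apply; lia.
apply: (is_arc_disj wfD an); rewrite (@is_arc_shift _ _ 0 1) //; lia.
Qed.

Lemma stuck_pattern : exists2 m, (m.*2 < n)%N & is_pattern m D.
Proof.
(* The number of arcs is taken as the first [m] for which there is no arc at [2m]. *)
have exm : exists m, ~~ is_arc D m.*2%:Z || (n <= m.*2)%N by exists n; apply/orP; right; lia.
case: (ex_minnP exm) => m Hm minm.
have lowm j : (j < m)%N -> is_arc D j.*2%:Z /\ (j.*2 < n)%N.
  move=> lt; have := contra (@minm j); rewrite -ltnNge lt negb_or negbK -ltnNge.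
  by move=> /(_ isT)/andP.
have lt2 : (m.*2 < n)%N.
  case: m lowm {Hm minm} => [|m] lowm; first by lia.
  have [am lt] := lowm m (ltnSn m); have ne : m.*2 != n.-1.
    by apply/negP => /eqP E; apply: stuck_last; rewrite -E.
  by rewrite doubleS; lia.
have nam : ~~ is_arc D m.*2%:Z by move: Hm; rewrite leqNgt lt2 orbF.
have high (j : nat) : (j < n)%N -> is_arc D j%:Z -> (j < m.*2)%N.
  move=> jn aj; rewrite ltnNge; apply/negP => le; case/negP: nam.
  have ev := stuck_even jn aj; have := @stuck_down j (j./2 - m) jn aj.
  rewrite (_ : (j - _)%N = m.*2); last by lia.
  by apply; lia.
exists m => // k; have kn := ltn_ord k; case: ifP => ltk; last first.
  apply/negbTE/negP => Dk.
  have := @unnested_top (k : nat)%:Z; rewrite partner_ord => /(_ Dk) [/(high _ kn)|]; first by lia.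
  case: (posnP k) => [k0|k0] ak.
    by apply: stuck_last; rewrite (@is_arc_shift _ _ ((k : nat)%:Z - 1) 1) //; lia.
  have ak' : is_arc D k.-1%:Z by rewrite (_ : k.-1%:Z = (k : nat)%:Z - 1) //; lia.
  by have := high _ _ ak'; have := stuck_even _ ak'; lia.
have ltk2 : (k./2 < m)%N by lia.
have [/eqP a _] := lowm _ ltk2; case: ifP => ok.
  rewrite (_ : (k : nat)%:Z = (k./2.*2)%:Z + 1); last by lia.
  rewrite addrK -a (wf_invol wfD) //.
by rewrite (_ : (k : nat) = (k./2.*2)%N) //; lia.
Qed.

End Unnested.

(** A slide inside the window lowers [pos_sum] by 1 and raises [delta] by 2, so it terminates and
    preserves [delta + 2 pos_sum]. *)
Lemma normalize_unnested D : inTL D -> unnested D ->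
  exists D' m, [/\ mutual D D', (m.*2 < n)%N, is_pattern m D' &
    delta D' + (pos_sum D').*2%:Z = delta D + (pos_sum D).*2%:Z].
Proof.
have [q] := ubnP (pos_sum D); elim: q D => // q IH D ltq TD un.
case: (classic (exists i : 'I_n, [/\ (i.+1 < n)%N, is_arc D ((i : nat)%:Z + 1) & (D (i, true)).2 = false])).
  move=> [i [lti /eqP arc thr]]; rewrite -addrA in arc.
  have pos := slide_thru_pos TD arc thr.
  have r1 : (resid ((i : nat)%:Z + 1) i : nat) = i.+1.
    by apply/eqP; rewrite -eqz_nat residE modz_small //; lia.
  rewrite r1 in pos.
  have [||D' [m [mu lt P E]]] := IH (dcomp (dE i) D) _ (slide_inTL i TD); first by lia.
    exact: slide_thru_unnested.
  exists D', m; split=> //; first by apply: mutual_trans mu => //; exact: slide_mutual.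
  by rewrite E slide_thru_delta //; lia.
move=> nex; have [|m lt P] := stuck_pattern TD un.
  move=> x x0 x1 a; apply/negPn/negP => thr; apply: nex.
  have ltx : (absz x < n)%N by lia.
  exists (Ordinal ltx) => /=; have Ex : (absz x)%:Z = x by lia.
  rewrite Ex; split=> //; first by lia.
  have := partner_ord D (Ordinal ltx) true; rewrite /= Ex => <-; exact: negbTE.
by exists D, m; split=> //; split; exact: reach_refl.
Qed.

Lemma pattern_exists D : inTL D ->
  exists D' m, [/\ mutual D D', (m.*2 < n)%N & is_pattern m D'].
Proof.
move=> TD; have [D1 mu1 un] := unnest TD; have TD1 := mutual_inTL TD mu1.
have [D' [m [mu lt P _]]] := normalize_unnested TD1 un.
by exists D', m; split=> //; exact: mutual_trans mu.
Qed.

Lemma pattern_unnested m D : wf n (partner D) -> (m.*2 <= n)%N -> is_pattern m D -> unnested D.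
Proof.
move=> wfD le P x y.
have [k [c [->]]] := node_decomp n (x, true).
have := partner_shift D c ((k : nat)%:Z, true); rewrite /shiftn /= => ->.
have := P k; case: ifP => _; last by rewrite partner_ord => ->.
by move=> -> [<-]; case: ifP; lia.
Qed.

(* Slide the arc (0,1) to the left over the strand at n-1, across the window, and
   normalize again: the invariant delta + 2 * pos_sum has then grown by 2n. *)
Lemma pattern_shift m D : inTL D -> (0 < m)%N -> (m.*2 < n)%N -> is_pattern m D ->
  exists D', [/\ mutual D D', is_pattern m D' & delta D' = delta D + 2 * n%:Z].
Proof.
move=> TD m0 lt P; have wfD := inTL_wf TD.
have lti : (n.-1 < n)%N by lia.
pose i : 'I_n := Ordinal lti; have Ei : (i : nat)%:Z = n%:Z - 1 by rewrite /=; lia.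
have arc : partner D ((i : nat)%:Z + 1, true) = ((i : nat)%:Z + 2, true).
  have lt0 : (0 < n)%N by lia.
  have := P (Ordinal lt0); rewrite /= double_gt0 m0 add0r => E.
  have := partner_shift D 1 (0, true); rewrite E /shiftn /= mul1r add0r => E'.
  by rewrite Ei (_ : n%:Z - 1 + 1 = n%:Z) ?E'; [congr pair|]; lia.
have thr : (D (i, true)).2 = false by have := P i; rewrite ifF //=; lia.
have un := pattern_unnested wfD (ltnW lt) P.
have pos := slide_thru_pos TD arc thr.
have r1 : (resid ((i : nat)%:Z + 1) i : nat) = 0%N.
  by apply/eqP; rewrite -eqz_nat residE Ei subrK modzz.
rewrite r1 addn0 in pos; have dl := slide_thru_delta TD arc thr.
have [D' [m' [mu lt' P' E]]] := normalize_unnested (slide_inTL i TD) (slide_thru_unnested TD arc thr un).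
have mu' : mutual D D' by apply: mutual_trans mu => //; exact: slide_mutual.
have Em : m' = m.
  have := mutual_nvert TD mu'; rewrite (pattern_nvert _ P') ?(pattern_nvert _ P); lia.
subst m'; exists D'; split=> //.
have := pos_sum_same_row (pattern_same_row P P'); lia.
Qed.

End Standard.

(** * The shifts with standard rows *)

Section Gamma.
Variable n : odd_nat.
Let n_odd : odd n := odd_nat_odd n.
Let n_ge3 : (3 <= n)%N := odd_nat_ge3 n.
Implicit Types (A B D X : rdiag n) (i : 'I_n).

(* The product E_0 E_2 ... E_(2m-2). *)
Definition base m : rdiag n := [ffun p : 'I_n * bool =>
  let k := (p.1 : nat)%:Z in
  if (p.1 < m.*2)%N then (if odd p.1 then k - 1 else k + 1, p.2) else (k, ~~ p.2)].

Lemma base_pattern m : is_pattern m (base m).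
Proof. by move=> k; rewrite partner_ord !ffunE /=; case: ifP => ->. Qed.

Lemma base0 : base 0 = did n.
Proof. by apply/ffunP=> p; rewrite !ffunE. Qed.

Lemma dE_base m (lt : (m.*2 < n)%N) : (m.+1.*2 < n)%N -> inTL (base m) ->
  dcomp (dE (Ordinal lt)) (base m) = base m.+1.
Proof.
move=> lt1 TD; have wfD := inTL_wf TD; apply: partner_ext.
apply: equivariant_ext => [k p|k p|k r]; [exact: partner_shift|exact: partner_shift|].
rewrite partner_dcomp_dE //.
have kn := ltn_ord k.
have dvi (j : nat) : (j < n)%N -> (n%:Z %| j%:Z - m.*2%:Z)%Z = (j == m.*2).
  move=> jn; apply/idP/eqP => [dv|->]; last by rewrite subrr dvdz0.
  by have := @dvd_subn n _ 0 dv (dvdz0 _); lia.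
have dvi1 (j : nat) : (j < n)%N -> (n%:Z %| j%:Z - m.*2%:Z - 1)%Z = (j == m.*2.+1).
  move=> jn; apply/idP/eqP => [dv|->]; last by apply/dvdzP; exists 0; lia.
  by have := @dvd_subn n _ 0 dv (dvdz0 _); lia.
have inSE (j : nat) s : (j < n)%N -> inS n m.*2 (j%:Z, s) = s && ((j == m.*2) || (j == m.*2.+1)).
  by move=> jn; rewrite /inS /= dvi // dvi1.
have swE (j : nat) s : (j < n)%N -> sw n m.*2 (j%:Z, s) = (if j == m.*2 then j%:Z + 1 else j%:Z - 1, s).
  by move=> jn; rewrite /sw /= dvi //; case: ifP.
rewrite /stepf inSE // swE // !partner_ord !ffunE /= doubleS.
have [lt2|ge2] := ltnP k m.*2.
  rewrite (_ : (k == m.*2 :> nat) = false); last by lia.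
  rewrite (_ : (k == m.*2.+1 :> nat) = false) ?andbF; last by lia.
  rewrite (_ : (k < m.*2.+2)%N = true); last by lia.
  have [j [Ej jn jm]] : exists j : nat, [/\ (if odd k then (k : nat)%:Z - 1 else (k : nat)%:Z + 1) = j%:Z,
      (j < n)%N & (j < m.*2)%N].
    case: ifP => ok; first by exists k.-1; split; lia.
    by exists k.+1; split; lia.
  by rewrite Ej inSE // (_ : (j == m.*2) || (j == m.*2.+1) = false) ?andbF //; lia.
case: r => /=.
  have [->|ne] := eqVneq (k : nat) m.*2.
    by rewrite odd_double /= ltnS leqnSn.
  have [->|ne1] := eqVneq (k : nat) m.*2.+1.
    by rewrite ltnSn /= odd_double.
  by rewrite (_ : (k < _)%N = false) ?inSE //; lia.
rewrite inSE //=; have [Ek|ne] := eqVneq (k : nat) m.*2.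
  have lt' : (m.*2.+1 < n)%N by lia.
  have := partner_ord (base m) (Ordinal lt') true; rewrite swE // Ek eqxx /=.
  rewrite (_ : m.*2%:Z + 1 = m.*2.+1%:Z); last by lia.
  move=> ->; rewrite ffunE /= ltnNge leqnSn odd_double /= ltnS leqnSn; congr pair; lia.
have [Ek|ne1] := eqVneq (k : nat) m.*2.+1.
  have := partner_ord (base m) (Ordinal lt) true; rewrite swE // Ek /= (_ : (_ == _) = false); last by lia.
  rewrite (_ : m.*2.+1%:Z - 1 = m.*2%:Z); last by lia.
  by move=> ->; rewrite ffunE /= ltnn ltnSn odd_double.
by rewrite (_ : (k < _)%N = false) //; lia.
Qed.

Lemma base_inTL m : (m.*2 < n)%N -> inTL (base m).
Proof.
elim: m => [|m IH] lt; first by rewrite base0; constructor.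
have lt' : (m.*2 < n)%N by lia.
by have Tb := IH lt'; rewrite -(@dE_base _ lt') //; apply: inTL_E.
Qed.

Lemma base_act m j D : inTL D -> is_pattern m D -> (j <= m)%N -> (m.*2 < n)%N ->
  dcomp (base j) D = D.
Proof.
move=> TD P jm lt; elim: j jm => [|j IH] jm; first by rewrite base0; apply/dcomp_did/inTL_wf.
have ltj : (j.*2 < n)%N by lia.
have Tb : inTL (base j) by exact: base_inTL.
rewrite -(@dE_base _ ltj) //; last by lia.
have IHj : dcomp (base j) D = D by apply: IH; lia.
have wfD := inTL_wf TD; rewrite dcomp_dEA ?IHj //.
apply: dcomp_dE_joined => //=; have := P (Ordinal ltj); rewrite /= ifT; last by lia.
by rewrite odd_double.
Qed.

(** The elements of the cyclic group of the corner, with neutral element [base m]; [delta / 2n] is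
    the isomorphism to the integers when [m > 0]. *)
Record gamma (m : nat) (y : rdiag n) : Prop := Gamma {
  gamma_inTL : inTL y;
  gamma_top : is_pattern m y;
  gamma_bot : same_row false (base m) y }.

Section FixedLevel.
Variable m : nat.
Hypothesis lt_m : (m.*2 < n)%N.
Local Notation e := (base m).

Lemma base_gamma : gamma m e.
Proof. by split; [exact: base_inTL | exact: base_pattern | exact: same_row_refl]. Qed.

Lemma gamma_wf y : gamma m y -> wf n (partner y). Proof. by case=> /inTL_wf. Qed.

Lemma pattern_level D : is_pattern m D -> nvert D = (n - m.*2)%N.
Proof. exact/pattern_nvert/ltnW. Qed.

Lemma gamma_ext y y' : gamma m y -> gamma m y' -> delta y = delta y' -> y = y'.
Proof.
move=> gy gy' E; apply: same_rows_delta_inj E; [exact: gamma_wf gy'|exact: gamma_wf gy| |].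
  exact: pattern_same_row (gamma_top gy') (gamma_top gy).
exact: same_row_trans (same_row_sym (gamma_bot gy')) (gamma_bot gy).
Qed.

Lemma same_row_pattern D D' : same_row true D D' -> is_pattern m D -> is_pattern m D'.
Proof.
move=> st P k; have := P k; have [E1 E2] := st (k : nat)%:Z; rewrite -!partner_ord.
by case: ifP => _ H; [rewrite E2 // H | rewrite E1].
Qed.

Lemma dcomp_gamma D : inTL D -> nvert (dcomp e (dcomp D e)) = (n - m.*2)%N ->
  gamma m (dcomp e (dcomp D e)).
Proof.
move=> TD E; have Te := base_inTL lt_m; have Tde := inTL_dcomp TD Te.
have ne := pattern_level (@base_pattern m); split; first exact: inTL_dcomp.
  by apply: same_row_pattern (@base_pattern m); apply: dcomp_same_top; rewrite ne.
rewrite -dcompA // in E *; apply: dcomp_same_bot => //; first exact: inTL_dcomp.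
by rewrite E ne.
Qed.

Lemma gamma_thru_bot y (k : 'I_n) : gamma m y -> (y (k, false)).2 = (m.*2 <= k)%N.
Proof.
move=> gy; have [] := gamma_bot gy (k : nat)%:Z; rewrite !partner_ord => -> _.
by rewrite ffunE [RHS]leqNgt /=; case: ifP.
Qed.

Lemma gamma_thru_top y (k : 'I_n) : gamma m y -> ~~ (y (k, true)).2 = (m.*2 <= k)%N.
Proof.
by move=> gy; rewrite [RHS]leqNgt; have := gamma_top gy k; rewrite partner_ord; case: ifP => _ ->.
Qed.

Lemma gamma_trace y y' (k : 'I_n) : gamma m y -> (m.*2 <= k)%N ->
  trace y y' n.+1 (k : nat)%:Z false = Some (y (k, false)).
Proof.
move=> gy le; rewrite traceS /layer partner_ord.
by have := gamma_thru_bot k gy; rewrite le => ->.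
Qed.

(** The two rows that meet are mirror images, so every strand of [y'] runs directly into a strand of
    [y] and none is lost. *)
Lemma gamma_dcomp y y' : gamma m y -> gamma m y' -> gamma m (dcomp y y').
Proof.
move=> gy gy'; have Ty := gamma_inTL gy; have Ty' := gamma_inTL gy'.
have TC := inTL_dcomp Ty Ty'.
have nC : nvert (dcomp y y') = (n - m.*2)%N.
  rewrite -(pattern_level (gamma_top gy')) -!nvert_botE; [|exact: inTL_wf..].
  apply: eq_card => j; rewrite !inE -partner_ord partner_dcomp /= -[layer _ _ _ _]/(partner y' ((j : nat)%:Z, false)).
  rewrite partner_ord; case E: (y' (j, false)) => [a []] //=.
  have [k [c [Ea]]] := node_decomp n (a, true).
  have Ek : (m.*2 <= k)%N.
    rewrite -(gamma_thru_top k gy') -partner_ord.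
    have := wf_invol (gamma_wf gy') ((j : nat)%:Z, false); rewrite partner_ord E Ea.
    by have := partner_shift y' c ((k : nat)%:Z, true); rewrite /shiftn /= => -> [_ ->].
  by rewrite Ea trace_shift (gamma_trace y' gy Ek) /= (gamma_thru_bot k gy).
split=> //.
  apply: same_row_pattern (gamma_top gy); apply: dcomp_same_top.
  by rewrite nC (pattern_level (gamma_top gy)).
apply: same_row_trans (gamma_bot gy') _; apply: dcomp_same_bot => //.
by rewrite nC (pattern_level (gamma_top gy')).
Qed.

Lemma delta_gamma_dcomp y y' : gamma m y -> gamma m y' -> delta (dcomp y y') = delta y + delta y'.
Proof.
move=> gy gy'; have gC := gamma_dcomp gy gy'.
have Hn : nvert (dcomp y y') = nvert y'.
  by rewrite (pattern_level (gamma_top gC)) (pattern_level (gamma_top gy')).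
apply/eqP; rewrite -subr_eq; apply/eqP.
rewrite (delta_dcomp_exit (gamma_inTL gy) (gamma_inTL gy') Hn).
apply: eq_big => k; first by rewrite (gamma_thru_top k gy') (gamma_thru_bot k gy).
by rewrite (gamma_thru_top k gy') => le; rewrite /exit_up (gamma_trace y' gy le).
Qed.

Lemma gamma_comm y y' : gamma m y -> gamma m y' -> dcomp y y' = dcomp y' y.
Proof.
move=> gy gy'; apply: gamma_ext; [exact: gamma_dcomp..|].
by rewrite !delta_gamma_dcomp // addrC.
Qed.

Lemma delta_base : delta e = 0.
Proof.
by apply: big1 => j; rewrite ffunE /=; case: ifP => //= _ _; rewrite subrr.
Qed.

Lemma gamma_base_r y : gamma m y -> dcomp y e = y.
Proof.
move=> gy; have ge := base_gamma; apply: gamma_ext => //; first exact: gamma_dcomp.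
by rewrite delta_gamma_dcomp // delta_base addr0.
Qed.

Lemma gamma_same_top D y : gamma m y -> is_pattern m D -> same_row true y D.
Proof. by move=> gy; apply: pattern_same_row; exact: gamma_top gy. Qed.

Lemma gamma_wnum y y' : gamma m y -> gamma m y' ->
  delta y' - delta y = (wnum y' - wnum y) * n%:Z /\ (2 %| wnum y' - wnum y)%Z.
Proof.
move=> gy gy'.
have st : same_row true y y' by apply: gamma_same_top => //; exact: gamma_top gy'.
have sb := same_row_trans (same_row_sym (gamma_bot gy)) (gamma_bot gy').
have w := gamma_wf gy; have w' := gamma_wf gy'.
by split; [exact: delta_wnum_diff | exact: wnum_parity].
Qed.

Lemma gamma_delta y : gamma m y -> exists k : int, delta y = k * (2 * n%:Z).
Proof.
move=> gy; have [] := gamma_wnum base_gamma gy; rewrite delta_base subr0 => -> /dvdzP[k ->].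
by exists k; rewrite mulrA.
Qed.

Hypothesis m_gt0 : (0 < m)%N.

Lemma gamma_shift (k : int) : exists2 y, gamma m y & delta y = k * (2 * n%:Z).
Proof.
have ge := base_gamma; have Te := gamma_inTL ge; have ne := pattern_level (gamma_top ge).
have [y1 [mu P1 d1]] := pattern_shift Te m_gt0 lt_m (gamma_top ge).
rewrite delta_base add0r in d1.
have g1 : gamma m y1.
  split=> //; first exact: mutual_inTL mu.
  case: mu => -[X TX Ey1] _; rewrite -Ey1; apply: dcomp_same_bot => //.
  by rewrite Ey1 ne pattern_level.
(* The multiplier [X] that takes [y1] back to [e] lowers the displacement by [2n], and by
   [delta_dcomp] it does the same to every diagram with that top row, in particular to [e]. *)
have [z1 gz1 dz1] : exists2 z, gamma m z & delta z = - (2 * n%:Z).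
  case: mu => _ [X TX Ee]; have st := gamma_same_top g1 (gamma_top ge).
  have stX := dcomp_same_row X st; rewrite Ee in stX.
  have PX := same_row_pattern stX (gamma_top ge).
  exists (dcomp X e).
    split=> //; first exact: inTL_dcomp.
    by apply: dcomp_same_bot => //; rewrite ne pattern_level.
  have := delta_dcomp TX (gamma_inTL g1) Te st; rewrite Ee ne pattern_level // => /(_ erefl).
  by rewrite delta_base; lia.
have pos y0 d0 : gamma m y0 -> delta y0 = d0 -> forall j : nat, exists2 y, gamma m y & delta y = j%:Z * d0.
  move=> g0 E0; elim=> [|j [y gy dy]]; first by exists e => //; rewrite delta_base mul0r.
  exists (dcomp y0 y); first exact: gamma_dcomp.
  by rewrite delta_gamma_dcomp // E0 dy; lia.
case: (intP k) => [|j|j]; first by exists e => //; rewrite delta_base mul0r.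
  exact: pos d1 j.+1.
by have [y gy dy] := pos _ _ gz1 dz1 j.+1; exists y => //; rewrite dy; lia.
Qed.

End FixedLevel.
End Gamma.

(** * Irreducible representations and their invariants *)

Definition linear_pred (K : fieldType) (d : nat) (S : 'rV[K]_d -> Prop) : Prop :=
  S 0 /\ forall a x y, S x -> S y -> S (a *: x + y).

(** [rep_irreducible] speaks of matrices, while the submodules below are given by properties. A
    subspace of row vectors not of this form would contain row spaces of unbounded rank. *)
Lemma linear_pred_submx (K : fieldType) (d : nat) (S : 'rV[K]_d -> Prop) : linear_pred S ->
  exists U : 'M[K]_d, forall w : 'rV_d, (w <= U)%MS <-> S w.
Proof.
move=> linS; apply: NNPP => nex.
suff grow k : exists2 U : 'M[K]_d, (forall w : 'rV_d, (w <= U)%MS -> S w) & (k <= \rank U)%N.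
  have [U _] := grow d.+1; by rewrite ltnNge rank_leq_col.
elim: k => [|k [U SU rU]].
  by exists 0 => // w; rewrite submx0 => /eqP->; case: linS.
have [w [Sw nw]] : exists w : 'rV_d, S w /\ ~~ (w <= U)%MS.
  apply: NNPP => H; apply: nex; exists U => w; split=> [|Sw]; first exact: SU.
  by apply/negPn/negP => nw; apply: H; exists w.
exists (U + w)%MS => [x|].
  case/sub_addsmxP => -[a b] /= ->; case: linS => S0 SD.
  rewrite addrC (_ : b *m w = b 0 0 *: w); first by apply: SD => //; apply: SU; exact: submxMl.
  by rewrite {1}[b]mx11_scalar mul_scalar_mx.
apply: leq_ltn_trans rU _; apply: rank_ltmx; rewrite /ltmx addsmxSl /=.
by apply: contra nw; apply: submx_trans; exact: addsmxSr.
Qed.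

(** By Cayley-Hamilton the product of the factors M - z kills [w]. The last nonzero vector on the
    way is an eigenvector of [M], and it stays in the eigenspace of [E] because the factors commute
    with [E]. *)
Lemma eigenvector_in (K : closedFieldType) (d : nat) (M E : 'M[K]_d) (c : K) (w : 'cV_d) :
  comm_mx E M -> w != 0 -> E *m w = c *: w ->
  exists a, exists2 u : 'cV_d, u != 0 & E *m u = c *: u /\ M *m u = a *: u.
Proof.
case: d M E w => [|d] M E w comm w0 Ew; first by rewrite flatmx0 eqxx in w0.
have [r Er] := closed_field_poly_normal (char_poly M).
have prod0 : \prod_(z <- r) (M - z%:M) = 0.
  have := Cayley_Hamilton M; rewrite Er (monicP (char_poly_monic M)) scale1r rmorph_prod.
  by move=> <-; apply: eq_bigr => z _; rewrite rmorphB /= horner_mx_X horner_mx_C.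
have commr s : E *m \prod_(z <- s) (M - z%:M) = \prod_(z <- s) (M - z%:M) *m E.
  elim: s => [|z s IH]; first by rewrite big_nil mulmx1 mul1mx.
  rewrite big_cons -mulmxA -IH !mulmxA; congr (_ *m _).
  by rewrite mulmxBr mulmxBl comm scalar_mxC.
have : \prod_(z <- r) (M - z%:M) *m w = 0 by rewrite prod0 mul0mx.
elim: r {Er prod0} => [|z r IH]; first by rewrite big_nil mul1mx => E0; rewrite E0 eqxx in w0.
rewrite big_cons -mulmxA; set u := \prod_(_ <- _) _ *m w.
have [/IH//|u0 Mu] := eqVneq u 0; exists z, u => //; split.
  by rewrite /u mulmxA commr -mulmxA Ew scalemxAr.
by apply/eqP; rewrite -subr_eq0 -mul_scalar_mx -mulmxBl Mu.
Qed.

Lemma finite_pred (T : finType) (P : T -> Prop) : exists G : {set T}, forall x, (x \in G) <-> P x.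
Proof.
have /fin_all_exists[b Hb] (x : T) : exists b : bool, b <-> P x.
  by case: (classic (P x)) => H; [exists true | exists false].
by exists [set x | b x] => x; rewrite inE.
Qed.

Section Representations.
Variable n : odd_nat.
Let n_odd : odd n := odd_nat_odd n.
Let n_ge3 : (3 <= n)%N := odd_nat_ge3 n.
Variables (K : closedFieldType) (v : K).
Hypothesis q_neq0 : qtwo v != 0.
Implicit Types (A B D X : rdiag n) (i : 'I_n) (d m t : nat).
Local Notation q := (qtwo v).

Lemma irrep_ind d (rho : rdiag n -> 'M[K]_d) (S : 'cV[K]_d -> Prop) (u : 'cV_d) :
  rep_irreducible rho -> (forall a x y, S x -> S y -> S (a *: x + y)) ->
  (forall D x, inTL D -> S x -> S (rho D *m x)) -> S u -> u != 0 -> forall w, S w.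
Proof.
move=> [d0 irr] SD Srho Su u0.
have S0 : S 0 by have := SD (-1) u u Su Su; rewrite scaleN1r addNr.
have linS : linear_pred (fun x : 'rV_d => S x^T).
  by split=> [|a x y Sx Sy]; rewrite ?trmx0 // linearP; exact: SD.
have [U HU] := linear_pred_submx linS.
have uU : (u^T <= U)%MS by apply/HU; rewrite trmxK.
case: (irr U) => [D TD||rU w].
- apply/row_subP => i; rewrite row_mul; apply/HU; rewrite trmx_mul trmxK.
  by apply: Srho => //; apply/HU; exact: row_sub.
- move/eqP; rewrite mxrank_eq0 => /eqP U0; move: uU; rewrite U0 submx0 trmx_eq0.
  by rewrite (negbTE u0).
- rewrite -[w]trmxK; apply/HU; apply: submx_full; by rewrite /row_full rU.
Qed.

Section OneRep.
Variables (d : nat) (rho : rdiag n -> 'M[K]_d).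
Hypothesis repr : is_rep v rho.

Lemma rep_dcomp A B : inTL A -> inTL B ->
  rho (dcomp A B) = q ^- nloops A B *: (rho A *m rho B).
Proof.
by move=> TA TB; rewrite (proj2 repr) // scalerA mulVf ?scale1r // expf_neq0.
Qed.

Lemma rep_reach D D' : inTL D -> reach D D' -> rho D = 0 -> rho D' = 0.
Proof. by move=> TD [X TX <-] E; rewrite rep_dcomp // E mulmx0 scaler0. Qed.

(** A nonvanishing diagram of [t] strands can be replaced by a mutual one with standard top row; [e]
    fixes that one up to a nonzero scalar, so [e] does not act by 0 either. *)
Lemma rep_level_base t : is_level rho t ->
  exists m, [/\ (m.*2 < n)%N, t = (n - m.*2)%N & rho (base n m) <> 0].
Proof.
move=> [low [D [TD le nD]]]; have tD : nvert D = t.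
  by apply/eqP; rewrite eqn_leq le leqNgt; apply/negP => /(low _ TD).
have [D' [m [mu lt P]]] := pattern_exists TD; have TD' := mutual_inTL TD mu.
exists m; split=> // [|e0]; first by rewrite -tD -(mutual_nvert TD mu) (pattern_nvert (ltnW lt) P).
apply: nD; apply: (rep_reach TD' (proj2 mu)).
by rewrite -(base_act TD' P (leqnn m) lt) rep_dcomp ?e0 ?mul0mx ?scaler0 //; exact: base_inTL.
Qed.

Section AtLevel.
Variable m : nat.
Hypothesis lt_m : (m.*2 < n)%N.
Local Notation e := (base n m).
Local Notation c := (q ^+ nloops e e).
Hypothesis low : forall D, inTL D -> (nvert D < n - m.*2)%N -> rho D = 0.

Let Te : inTL e := base_inTL lt_m.

Lemma rep_gammaM y y' : gamma m y -> gamma m y' -> rho y *m rho y' = c *: rho (dcomp y y').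
Proof.
move=> gy gy'; rewrite (proj2 repr); [|exact: gamma_inTL gy|exact: gamma_inTL gy'].
rewrite (@nloops_same_row _ e y e y') //; first exact: gamma_bot gy.
exact: gamma_same_top (base_gamma lt_m) (gamma_top gy').
Qed.

Lemma rep_gamma_comm y y' : gamma m y -> gamma m y' -> rho y *m rho y' = rho y' *m rho y.
Proof. by move=> gy gy'; rewrite !rep_gammaM // (gamma_comm lt_m gy gy'). Qed.

Lemma rep_gamma_base y : gamma m y -> rho y *m rho e = c *: rho y.
Proof. by move=> gy; rewrite rep_gammaM ?(gamma_base_r lt_m gy) //; exact: base_gamma. Qed.

Lemma rep_base_gamma y : gamma m y -> rho e *m rho y = c *: rho y.
Proof. by move=> gy; rewrite rep_gamma_comm ?rep_gamma_base //; exact: base_gamma. Qed.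

End AtLevel.
End OneRep.

(** The scalar and the diagram are chosen before the representation, so that two representations can
    be compared. *)
Lemma corner_gamma m D : (m.*2 < n)%N -> inTL D ->
  exists (a : K) y, gamma m y /\ forall d (rho : rdiag n -> 'M[K]_d), is_rep v rho ->
    (forall D, inTL D -> (nvert D < n - m.*2)%N -> rho D = 0) ->
    rho (base n m) *m rho D *m rho (base n m) = a *: rho y.
Proof.
move=> lt TD; have Te := base_inTL lt; set e := base n m in Te *.
have Tde := inTL_dcomp TD Te; have Tz := inTL_dcomp Te Tde.
have eE d (rho : rdiag n -> 'M[K]_d) : is_rep v rho -> rho e *m rho D *m rho e =
    (q ^+ nloops D e * q ^+ nloops e (dcomp D e)) *: rho (dcomp e (dcomp D e)).
  by move=> [_ repr]; rewrite -mulmxA repr // -scalemxAr repr // scalerA.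
have [E|ne] := eqVneq (nvert (dcomp e (dcomp D e))) (n - m.*2)%N.
  exists (q ^+ nloops D e * q ^+ nloops e (dcomp D e)), (dcomp e (dcomp D e)).
  by split=> [|d rho repr _]; [exact: dcomp_gamma | exact: eE].
exists 0, e; split=> [|d rho repr low]; first exact: base_gamma.
rewrite eE // low ?scaler0 ?scale0r // ltn_neqAle ne /=.
by rewrite -(pattern_nvert (ltnW lt) (@base_pattern n m)) nvert_dcomp_l.
Qed.

Section Irreducible.
Variables (d : nat) (rho : rdiag n -> 'M[K]_d) (m : nat).
Hypothesis irr : irrep v rho.
Hypothesis lt_m : (m.*2 < n)%N.
Hypothesis low : forall D, inTL D -> (nvert D < n - m.*2)%N -> rho D = 0.
Local Notation e := (base n m).
Local Notation c := (q ^+ nloops e e).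
Hypothesis e_neq0 : rho e <> 0.
Let repr := proj1 irr.
Let Te : inTL e := base_inTL lt_m.
Let ge := base_gamma lt_m.

Lemma exists_base_vector : exists2 w : 'cV_d, w != 0 & rho e *m w = c *: w.
Proof.
have [j nj] : exists j, col j (rho e) != 0.
  apply: NNPP => H; apply: e_neq0; apply/matrixP => i j; rewrite mxE.
  have : col j (rho e) = 0 by apply/eqP/negPn/negP => nj; apply: H; exists j.
  by move/colP/(_ i); rewrite !mxE.
exists (col j (rho e)) => //.
by rewrite colE mulmxA (rep_gamma_base repr lt_m ge) -scalemxAl.
Qed.

Lemma base_fixed_corner (u : 'cV_d) D : rho e *m u = c *: u -> inTL D ->
  exists a y, gamma m y /\ rho e *m (rho D *m u) = a *: (rho y *m u).
Proof.
move=> Eu TD; have [a [y [gy Ha]]] := corner_gamma lt_m TD.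
have c0 := expf_neq0 (nloops e e) q_neq0; exists (c^-1 * a), y; split=> //.
rewrite [in LHS](_ : u = c^-1 *: (rho e *m u)); last by rewrite Eu scalerA mulVf ?scale1r.
by rewrite -!scalemxAr !mulmxA Ha // -scalemxAl scalerA.
Qed.

(** A form of Schur's lemma: [y] has an eigenvector [u] with [e u = c u]. The corner is commutative,
    so the vectors on whose images under e TL [y] acts by [l] form a submodule containing [u], hence
    everything. *)
Lemma gamma_scalar y : gamma m y -> exists l, rho y = l *: rho e.
Proof.
move=> gy; have [w w0 Ew] := exists_base_vector.
have comm : comm_mx (rho e) (rho y) by exact: (rep_gamma_comm repr lt_m ge gy).
have [l [u u0 [Eu yu]]] := eigenvector_in comm w0 Ew.
have all (w' : 'cV_d) : rho y *m (rho e *m (rho (did n) *m w')) = l *: (rho e *m (rho (did n) *m w')).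
  pose S (w' : 'cV_d) := forall D, inTL D ->
    rho y *m (rho e *m (rho D *m w')) = l *: (rho e *m (rho D *m w')).
  suff : S w' by apply; constructor.
  apply: (irrep_ind (rho := rho) (u := u)) => //; first by case: irr.
  - move=> a x x' Sx Sx' D TD; rewrite !mulmxDr -!scalemxAr Sx // Sx' //.
    by rewrite scalerDr !scalerA mulrC.
  - move=> D x TD Sx D' TD'; rewrite !(mulmxA (rho D')) (proj2 repr) // -!scalemxAl -!scalemxAr.
    rewrite Sx; last exact: inTL_dcomp.
    by rewrite !scalerA mulrC.
  - move=> D TD; have [a [y' [gy' ->]]] := base_fixed_corner Eu TD.
    by rewrite -scalemxAr mulmxA (rep_gamma_comm repr lt_m gy gy') -mulmxA yu -!scalemxAr !scalerA mulrC.
have c0 := expf_neq0 (nloops e e) q_neq0; exists (c^-1 * l).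
have ye : rho y *m rho e = l *: rho e.
  apply/matrixP => i j; have /colP/(_ i) := all (delta_mx j 0).
  by rewrite (proj1 repr) mul1mx mulmxA scalemxAl -!colE => E; move: E; rewrite mxE [in RHS]mxE.
rewrite -scalerA -ye (rep_gamma_base repr lt_m gy) scalerA mulVf ?scale1r //.
Qed.

End Irreducible.
End Representations.

(** * The scalar alpha, and comparison of representations with the same invariants *)

Section Invariants.
Variable n : odd_nat.
Let n_odd : odd n := odd_nat_odd n.
Let n_ge3 : (3 <= n)%N := odd_nat_ge3 n.
Variable K : closedFieldType.
Implicit Types (A B D X : rdiag n) (i : 'I_n) (d m t : nat).

Lemma level_unique d (rho : rdiag n -> 'M[K]_d) t t' : is_level rho t -> is_level rho t' -> t' = t.
Proof.
suff le t1 t2 : is_level rho t1 -> is_level rho t2 -> (t1 <= t2)%N.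
  by move=> l l'; apply/eqP; rewrite eqn_leq !le.
move=> [low1 _] [_ [D [TD le nD]]]; rewrite leqNgt; apply/negP => lt.
by apply: nD; apply: low1 => //; exact: leq_ltn_trans lt.
Qed.

(** [is_alpha] restricted to the corner: with rows fixed, an increase of [wnum] by 2 is an increase
    of [delta] by [2n]. *)
Definition shift_scalar d (rho : rdiag n -> 'M[K]_d) m (alpha : K) :=
  forall y y', gamma m y -> gamma m y' -> delta y' = delta y + 2 * n%:Z -> rho y' = alpha *: rho y.

Section FixedLevel.
Variable m : nat.
Hypothesis lt_m : (m.*2 < n)%N.
Local Notation e := (base n m).
Let Te : inTL e := base_inTL lt_m.
Let ge := base_gamma lt_m.

Lemma is_alpha_shift_scalar d (rho : rdiag n -> 'M[K]_d) alpha :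
  is_alpha rho (n - m.*2) alpha -> shift_scalar rho m alpha.
Proof.
move=> al y y' gy gy' E; have [dw _] := gamma_wnum gy gy'.
apply: al; [exact: gamma_inTL gy|exact: gamma_inTL gy'|exact: pattern_level (gamma_top gy)|..].
- by apply: same_row_rowInv; apply: gamma_same_top gy (gamma_top gy').
- apply: same_row_rowInv; exact: same_row_trans (same_row_sym (gamma_bot gy)) (gamma_bot gy').
- by rewrite E addrAC subrr add0r in dw; have : wnum y' - wnum y = 2; [nia | lia].
Qed.

Hypothesis m_gt0 : (0 < m)%N.

Lemma shift_scalar_neq0 d (rho : rdiag n -> 'M[K]_d) alpha :
  rho e <> 0 -> shift_scalar rho m alpha -> alpha != 0.
Proof.
move=> e0 sh; have [y gy dy] := gamma_shift lt_m m_gt0 (-1).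
apply/eqP => a0; apply: e0; rewrite (sh y e) // ?a0 ?scale0r //.
by rewrite delta_base dy; lia.
Qed.

Lemma shift_scalar_unique d (rho : rdiag n -> 'M[K]_d) a b :
  rho e <> 0 -> shift_scalar rho m a -> shift_scalar rho m b -> b = a.
Proof.
move=> e0 sa sb; have [y gy dy] := gamma_shift lt_m m_gt0 1.
have dE : delta y = delta e + 2 * n%:Z by rewrite delta_base dy; lia.
apply/eqP; rewrite -subr_eq0; apply/negPn/negP => ne; apply: e0.
have := sb _ _ ge gy dE; rewrite (sa _ _ ge gy dE) => /eqP.
rewrite eq_sym -subr_eq0 -scalerBl scaler_eq0 (negbTE ne) /=; exact/eqP.
Qed.

Lemma shift_scalar_value d (rho : rdiag n -> 'M[K]_d) alpha y (k : int) :
  alpha != 0 -> shift_scalar rho m alpha -> gamma m y -> delta y = k * (2 * n%:Z) ->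
  rho y = alpha ^ k *: rho e.
Proof.
move=> a0 sh gy dy.
have up (j : nat) (y1 y2 : rdiag n) (k1 : int) : gamma m y1 -> gamma m y2 ->
    delta y1 = k1 * (2 * n%:Z) -> delta y2 = (k1 + j%:Z) * (2 * n%:Z) -> rho y2 = alpha ^+ j *: rho y1.
  move=> g1 + d1; elim: j y2 => [|j IH] y2 g2 d2.
    by rewrite expr0 scale1r (gamma_ext g2 g1) // d2 d1 addr0.
  have [z gz dz] := gamma_shift lt_m m_gt0 (k1 + j%:Z).
  by rewrite (sh z y2 gz g2) ?(IH z gz dz) ?scalerA -?exprS // d2 dz; lia.
case: k dy => j dy; first by apply: (up j e y 0); rewrite ?delta_base ?mul0r.
(* For a negative exponent the climb goes from [y] up to [e]. *)
rewrite (up j.+1 y e (Negz j)) ?delta_base //; last by rewrite NegzE addNr mul0r.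
by rewrite NegzE -exprnN scalerA mulVf ?scale1r // expf_neq0.
Qed.

Variable v : K.
Hypothesis q_neq0 : qtwo v != 0.
Local Notation q := (qtwo v).
Local Notation c := (q ^+ nloops e e).

Section Irreducible.
Variables (d : nat) (rho : rdiag n -> 'M[K]_d).
Hypothesis irr : irrep v rho.
Hypothesis low : forall D, inTL D -> (nvert D < n - m.*2)%N -> rho D = 0.
Hypothesis e_neq0 : rho e <> 0.
Let repr := proj1 irr.
Let c0 : c != 0 := expf_neq0 _ q_neq0.

Lemma exists_shift_scalar : exists alpha, shift_scalar rho m alpha.
Proof.
have [y1 g1 d1] := gamma_shift lt_m m_gt0 1; rewrite mul1r in d1.
have [alpha E1] := gamma_scalar q_neq0 irr lt_m low e_neq0 g1.
exists alpha => y y' gy gy' E.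
have -> : y' = dcomp y1 y.
  apply: (gamma_ext gy'); first exact: gamma_dcomp.
  by rewrite (delta_gamma_dcomp lt_m) // d1 E addrC.
have := rep_gammaM repr lt_m g1 gy; rewrite E1 -scalemxAl (rep_base_gamma repr lt_m gy) => H.
by apply: (scalerI c0); rewrite -H !scalerA mulrC.
Qed.

(** One multiplier [X] brings [D] and [D'] to a standard top row. There they differ by the generator
    [y1] of the corner, which contributes [alpha], and one multiplier [X'] brings both back. *)
Lemma shift_scalar_is_alpha alpha : shift_scalar rho m alpha -> is_alpha rho (n - m.*2) alpha.
Proof.
move=> sh D D' TD TD' lD rt rb dw.
have wfD := inTL_wf TD; have wfD' := inTL_wf TD'.
have st : same_row true D D' by exact: rowInv_same_row.
have sb : same_row false D D' by exact: rowInv_same_row.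
have lD' : nvert D' = (n - m.*2)%N by rewrite (same_row_nvert st).
have dd : delta D' = delta D + 2 * n%:Z.
  by have := delta_wnum_diff wfD wfD' st sb; rewrite dw; lia.
have [D1 [m1 [mu lt1 P1]]] := pattern_exists TD; have TD1 := mutual_inTL TD mu.
have lD1 := mutual_nvert TD mu.
have Em : m1 = m by have := pattern_nvert (ltnW lt1) P1; rewrite lD1 lD; lia.
subst m1; case: mu => -[X TX EX] [X' TX' EX'].
have stX := dcomp_same_row X st; rewrite EX in stX.
set D1' := dcomp X D' in stX; have TD1' : inTL D1' by exact: inTL_dcomp.
have P1' := same_row_pattern stX P1.
have dX := delta_dcomp TX TD TD' st; rewrite EX lD1 -/D1' in dX; have {}dX := dX erefl.
have b1 : same_row false D D1 by rewrite -EX; apply: dcomp_same_bot; rewrite ?EX.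
have b1' : same_row false D' D1'.
  by apply: dcomp_same_bot => //; rewrite (same_row_nvert stX) lD1 lD.
have [y1 g1 d1] := gamma_shift lt_m m_gt0 1; rewrite mul1r in d1.
have Ty1 := gamma_inTL g1.
have ste : same_row true e D1 by exact: gamma_same_top ge P1.
have le : nvert e = (n - m.*2)%N := pattern_level lt_m (gamma_top ge).
have ye : dcomp y1 e = y1 by exact: gamma_base_r.
(* Both sides have the same rows and the same displacement. *)
have Ed1 : D1' = dcomp y1 D1.
  have stz := dcomp_same_row y1 ste; rewrite ye in stz.
  have lz : nvert (dcomp y1 D1) = nvert D1.
    by rewrite (same_row_nvert stz) lD1 lD (pattern_level lt_m (gamma_top g1)).
  apply: same_rows_delta_inj.
  - by apply: inTL_wf; exact: inTL_dcomp.
  - exact: inTL_wf.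
  - exact: pattern_same_row (same_row_pattern stz (gamma_top g1)) P1'.
  - apply: same_row_trans (same_row_trans (same_row_sym b1) (same_row_trans sb b1')).
    by apply: same_row_sym; exact: dcomp_same_bot.
  - have := delta_dcomp Ty1 Te TD1 ste; rewrite ye le (pattern_level lt_m (gamma_top g1)) => /(_ erefl).
    by rewrite delta_base d1; lia.
have rho1 : rho D1' = alpha *: rho D1.
  have nl : nloops y1 D1 = nloops e D1.
    by apply: nloops_same_row (gamma_bot g1) _; exact: same_row_refl.
  rewrite Ed1 (rep_dcomp q_neq0 repr) // (sh e y1 ge g1) ?delta_base ?add0r //.
  rewrite -scalemxAl scalerA mulrC -scalerA nl -(rep_dcomp q_neq0 repr) //.
  by rewrite (base_act TD1 P1 (leqnn m) lt_m).
have ED' : D' = dcomp X' D1'.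
  have stz := dcomp_same_row X' stX; rewrite EX' in stz.
  have lz : nvert (dcomp X' D1') = nvert D1'.
    by rewrite (same_row_nvert stz) lD (pattern_level lt_m P1').
  apply: same_rows_delta_inj.
  - by apply: inTL_wf; exact: inTL_dcomp.
  - exact: inTL_wf.
  - exact: same_row_trans (same_row_sym stz) st.
  - apply: same_row_trans (same_row_sym b1').
    by apply: same_row_sym; exact: dcomp_same_bot.
  - have := delta_dcomp TX' TD1 TD1' stX; rewrite EX' lD1 => /(_ erefl); lia.
rewrite [in LHS]ED' (rep_dcomp q_neq0 repr TX' TD1') rho1 -scalemxAr scalerA mulrC -scalerA.
by rewrite (nloops_same_row (@same_row_refl _ _ X') stX) -(rep_dcomp q_neq0 repr TX' TD1) EX'.
Qed.

End Irreducible.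

Section TwoReps.
Variables (d1 d2 : nat) (rho1 : rdiag n -> 'M[K]_d1) (rho2 : rdiag n -> 'M[K]_d2).
Hypotheses (irr1 : irrep v rho1) (irr2 : irrep v rho2).
Variables (u1 : 'cV[K]_d1) (u2 : 'cV[K]_d2).

(* A submodule of the direct sum of the two representations; by irreducibility it
   is the graph of an isomorphism as soon as it contains (u1, u2). *)
Definition linked (w1 : 'cV[K]_d1) (w2 : 'cV[K]_d2) := forall D, inTL D ->
  exists k, rho1 e *m (rho1 D *m w1) = k *: u1 /\ rho2 e *m (rho2 D *m w2) = k *: u2.

Lemma linkedD a x1 x2 y1 y2 : linked x1 x2 -> linked y1 y2 -> linked (a *: x1 + y1) (a *: x2 + y2).
Proof.
move=> Hx Hy D TD; have [k [E1 E2]] := Hx D TD; have [l [F1 F2]] := Hy D TD.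
by exists (a * k + l); rewrite !mulmxDr -!scalemxAr E1 E2 F1 F2 !scalerA !scalerDl.
Qed.

Lemma linked_rep D x1 x2 : inTL D -> linked x1 x2 -> linked (rho1 D *m x1) (rho2 D *m x2).
Proof.
move=> TD H D' TD'; have [k [E1 E2]] := H _ (inTL_dcomp TD' TD).
exists (q ^+ nloops D' D * k); rewrite !mulmxA -!(mulmxA _ (rho1 D')) -!(mulmxA _ (rho2 D')).
rewrite (proj2 (proj1 irr1)) // (proj2 (proj1 irr2)) //.
by rewrite -!scalemxAr -!scalemxAl -!mulmxA E1 E2 !scalerA.
Qed.

Lemma linked_total : linked u1 u2 -> u1 != 0 -> forall w1, exists w2, linked w1 w2.
Proof.
move=> H u10; apply: (irrep_ind (rho := rho1) (u := u1)) => //; first by case: irr1.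
- by move=> a x y [x2 Hx] [y2 Hy]; exists (a *: x2 + y2); exact: linkedD.
- by move=> D x TD [x2 Hx]; exists (rho2 D *m x2); exact: linked_rep.
- by exists u2.
Qed.

(** The vectors killed by e TL form a submodule. It does not contain [u2], so by irreducibility it
    is zero. *)
Lemma linked0 w2 : u1 != 0 -> u2 != 0 -> rho2 e *m u2 = c *: u2 -> linked 0 w2 -> w2 = 0.
Proof.
move=> u10 u20 Eu H; apply/eqP/negPn/negP => w0.
pose S (w : 'cV_d2) := forall D, inTL D -> rho2 e *m (rho2 D *m w) = 0.
have: S u2.
  apply: (irrep_ind (rho := rho2) (u := w2) (S := S)) => //; first by case: irr2.
  - by move=> a x y Sx Sy D TD; rewrite !mulmxDr -!scalemxAr Sx // Sy // scaler0 addr0.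
  - move=> D x TD Sx D' TD'; rewrite (mulmxA (rho2 D')) (proj2 (proj1 irr2)) //.
    by rewrite -scalemxAl -scalemxAr Sx ?scaler0 //; exact: inTL_dcomp.
  - move=> D TD; have [k [E1 ->]] := H D TD; move: E1; rewrite !mulmx0 => /esym/eqP.
    by rewrite scaler_eq0 (negbTE u10) orbF => /eqP->; rewrite scale0r.
move/(_ _ (inTL_id n)); rewrite (proj1 (proj1 irr2)) mul1mx Eu => /eqP.
by rewrite scaler_eq0 (negbTE u20) orbF (negbTE (expf_neq0 _ q_neq0)).
Qed.

End TwoReps.

Lemma linked_sym d1 d2 (rho1 : rdiag n -> 'M[K]_d1) (rho2 : rdiag n -> 'M[K]_d2) u1 u2 w1 w2 :
  linked rho1 rho2 u1 u2 w1 w2 -> linked rho2 rho1 u2 u1 w2 w1.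
Proof. by move=> H D TD; have [k [E1 E2]] := H D TD; exists k. Qed.

(** [P] sends each basis vector to the vector linked with it. Totality in both directions and
    [linked0] make this an invertible intertwiner. *)
Lemma linked_iso d1 d2 (rho1 : rdiag n -> 'M[K]_d1) (rho2 : rdiag n -> 'M[K]_d2) u1 u2 :
  irrep v rho1 -> irrep v rho2 -> u1 != 0 -> u2 != 0 ->
  rho1 e *m u1 = c *: u1 -> rho2 e *m u2 = c *: u2 -> linked rho1 rho2 u1 u2 u1 u2 ->
  rep_iso rho1 rho2.
Proof.
move=> irr1 irr2 u10 u20 E1 E2 Hu.
have Hu' := linked_sym Hu.
have inj1 w1 : linked rho1 rho2 u1 u2 w1 0 -> w1 = 0.
  by move/linked_sym; apply: (linked0 irr1 u20 u10 E1).
have /fin_all_exists[p Hp] (j : 'I_d2) :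
    exists w1 : 'cV_d1, linked rho1 rho2 u1 u2 w1 (delta_mx j 0).
  have [w1 H] := linked_total irr2 irr1 Hu' u20 (delta_mx j 0).
  by exists w1; exact: linked_sym.
pose P : 'M_(d1, d2) := \matrix_(i, j) p j i 0.
have l00 : linked rho1 rho2 u1 u2 0 0.
  by move=> D TD; exists 0; rewrite !mulmx0 !scale0r.
have HP w2 : linked rho1 rho2 u1 u2 (P *m w2) w2.
  have -> : P *m w2 = \sum_j w2 j 0 *: p j.
    apply/colP => i; rewrite mxE summxE; apply: eq_bigr => j _.
    by rewrite !mxE mulrC.
  have {2}-> : w2 = \sum_j w2 j 0 *: delta_mx j 0.
    by rewrite {1}[w2]matrix_sum_delta; apply: eq_bigr => j _; rewrite big_ord1.
  elim: (index_enum _) => [|j s IH]; first by rewrite !big_nil.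
  by rewrite !big_cons; exact: linkedD.
have sub w1 w1' w2 : linked rho1 rho2 u1 u2 w1 w2 -> linked rho1 rho2 u1 u2 w1' w2 -> w1 = w1'.
  move=> H H'; apply/eqP; rewrite -subr_eq0; apply/eqP/inj1.
  by have := linkedD (-1) H' H; rewrite !scaleN1r addNr addrC.
exists P; split.
- apply: inj_row_free => x xP; apply/rowP => i.
  have [w2 H] := linked_total irr1 irr2 Hu u10 (delta_mx i 0).
  have Ei : (delta_mx i 0 : 'cV_d1) = P *m w2 := sub _ _ _ H (HP w2).
  have : x *m (delta_mx i 0 : 'cV_d1) = 0 by rewrite Ei mulmxA xP mul0mx.
  by rewrite -colE => /matrixP/(_ 0 0); rewrite !mxE.
- suff : row_free P^T by rewrite /row_free /row_full mxrank_tr.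
  apply: inj_row_free => x xP; apply: trmx_inj; rewrite trmx0.
  have E0 : P *m x^T = 0 by rewrite -[P]trmxK -trmx_mul xP trmx0.
  by apply: (linked0 irr2 u10 u20 E2); rewrite -E0; exact: HP.
- move=> D TD; apply/matrixP => i j.
  pose x : 'cV[K]_d2 := delta_mx j 0.
  have E : rho1 D *m (P *m x) = P *m (rho2 D *m x).
    exact: sub (linked_rep irr1 irr2 TD (HP x)) (HP (rho2 D *m x)).
  rewrite !mulmxA /x in E.
  by move: E; rewrite -!colE => /colP/(_ i); rewrite !mxE.
Qed.

End FixedLevel.
End Invariants.

(** * The cell module *)

(** [C] is the quotient map and [L] a section of it. Both act on row vectors, because subspaces are
    encoded as row spaces; hence the transposes. *)
Lemma quotient_rep (n : nat) (K : fieldType) (v : K) d (rho : rdiag n -> 'M[K]_d) (U : 'M[K]_d) :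
  is_rep v rho -> (forall D, inTL D -> (U *m (rho D)^T <= U)%MS) ->
  (forall A B : rdiag n, inTL A -> inTL B -> inTL (dcomp A B)) ->
  exists k (C : 'M[K]_(d, k)) (rho' : rdiag n -> 'M[K]_k),
    [/\ is_rep v rho', forall D, inTL D -> (rho D)^T *m C = C *m (rho' D)^T,
        forall x : 'rV_d, (x <= U)%MS = (x *m C == 0) & exists L : 'M_(k, d), L *m C = 1%:M].
Proof.
move=> [rho1 rhoM] inv TLM.
pose C := col_base (cokermx U); pose L := pinvmx C.
have LC : L *m C = 1%:M by apply: mulVpmx; exact: col_base_full.
have memU p (x : 'M_(p, d)) : (x <= U)%MS = (x *m C == 0).
  rewrite submxE -{1}(mulmx_base (cokermx U)) mulmxA -/C.
  apply/eqP/eqP => [E|->]; last by rewrite mul0mx.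
  by rewrite -[x *m C](mulmxKp (row_base_free (cokermx U))) E mul0mx.
clearbody L; clearbody C.
have RC D : inTL D -> (rho D)^T *m C = C *m (L *m (rho D)^T *m C).
  move=> TD; apply/eqP; rewrite -subr_eq0 !mulmxA -!mulmxBl -{1}[(rho D)^T]mul1mx -mulmxBl.
  rewrite -memU; apply: submx_trans (inv D TD); apply: submxMr.
  by rewrite memU mulmxBl mul1mx -mulmxA LC mulmx1 subrr.
exists _, C, (fun D => (L *m (rho D)^T *m C)^T); split; [split=> [|A B TA TB]| |exact: memU|by exists L].
- by rewrite rho1 trmx1 mulmx1 LC trmx1.
- rewrite -trmx_mul -linearZ; congr trmx.
  rewrite -(mulmxA (L *m (rho B)^T)) -(RC A TA) mulmxA -(mulmxA L) -trmx_mul rhoM //.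
  by rewrite linearZ /= -scalemxAr -scalemxAl.
- by move=> D TD; rewrite trmxK RC.
Qed.

Section Cell.
Variable n : odd_nat.
Let n_odd : odd n := odd_nat_odd n.
Let n_ge3 : (3 <= n)%N := odd_nat_ge3 n.
Variables (K : closedFieldType) (v : K).
Hypothesis q_neq0 : qtwo v != 0.
Implicit Types (A B D X : rdiag n) (i : 'I_n) (d t : nat).
Local Notation q := (qtwo v).
Variable m : nat.
Hypothesis lt_m : (m.*2 < n)%N.
Local Notation t := (n - m.*2)%N.
Local Notation e := (base n m).

(* A top row S is represented by a chosen diagram DS S, and a diagram D with that
   row stands for gam ^ (delta D - delta (DS S)) times S. *)
Section Module.
Variables (gam : K) (G : {set {ffun 'I_n -> 'I_n}}) (DS : {ffun 'I_n -> 'I_n} -> rdiag n).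
Hypothesis gam_neq0 : gam != 0.
Hypothesis memG : forall D, inTL D -> nvert D = t -> rowInv D true \in G.
Hypothesis DSP : forall S, S \in G -> [/\ inTL (DS S), nvert (DS S) = t & rowInv (DS S) true = S].

(** The basis vector of a row is normalised so that any diagram [D] counts as [gam ^ (delta D)]
    times its top row. By [delta_dcomp] the coefficient then depends on [D] only through that
    row. *)
Definition cell_coef A D (S : {ffun 'I_n -> 'I_n}) : K :=
  if (nvert (dcomp A D) == t) && (rowInv (dcomp A D) true == S)
  then q ^+ nloops A D * gam ^ (delta (dcomp A D) - delta D) else 0.

Definition cell A : 'M[K]_#|G| :=
  \matrix_(i, j) cell_coef A (DS (enum_val j)) (enum_val i).

Lemma cell_index D : inTL D -> nvert D = t -> exists k : 'I_#|G|, enum_val k = rowInv D true.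
Proof.
move=> TD lD; have GD := memG TD lD; exists (enum_rank_in GD (rowInv D true)).
by rewrite enum_rankK_in.
Qed.

Lemma cell_coef_same_row A D D' S : inTL A -> inTL D -> inTL D' -> nvert D = t ->
  same_row true D D' -> cell_coef A D' S = cell_coef A D S.
Proof.
move=> TA TD TD' lD st; have st' := dcomp_same_row A st.
rewrite /cell_coef (same_row_nvert st') (same_row_rowInv st').
case: ifP => // /andP[/eqP l _].
by rewrite (nloops_same_row (@same_row_refl _ _ A) st) (delta_dcomp TA TD TD' st) // l lD.
Qed.

Lemma cellE A D (i k : 'I_#|G|) : inTL A -> inTL D -> nvert D = t ->
  enum_val k = rowInv D true -> cell A i k = cell_coef A D (enum_val i).
Proof.
move=> TA TD lD Ek; rewrite mxE; have [TS lS ES] := DSP (enum_valP k).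
apply: cell_coef_same_row => //; apply: rowInv_same_row; [exact: inTL_wf..|].
by rewrite ES Ek.
Qed.

(** Loop factors agree by [nloops_cocycle] and the differences of [delta] telescope. If [B] loses
    strands of [D], then so does [A B]. *)
Lemma cell_rep : is_rep v cell.
Proof.
split=> [|A B TA TB]; apply/matrixP => i j; have [TS lS ES] := DSP (enum_valP j).
  rewrite !mxE /cell_coef dcomp_did; last exact: inTL_wf.
  rewrite lS eqxx ES nloops_did // subrr expr0z mulr1 expr0 (inj_eq enum_val_inj) eq_sym.
  by case: eqP.
set D := DS (enum_val j) in TS lS ES.
have TBD := inTL_dcomp TB TS; have TAB := inTL_dcomp TA TB.
rewrite !mxE -/D; have [l|nl] := eqVneq (nvert (dcomp B D)) t; last first.
  rewrite big1 => [|k _]; last first.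
    by rewrite [cell B k j]mxE -/D /cell_coef (negbTE nl) mulr0.
  rewrite /cell_coef ifN ?mulr0 // negb_and; apply/orP; left.
  rewrite dcompA //; apply: contra nl => /eqP l; rewrite eqn_leq -{1}lS nvert_dcomp_r //=.
  by rewrite -l nvert_dcomp_r.
have [k Ek] := cell_index TBD l.
rewrite (bigD1 k) //= big1 => [|k' nk]; last first.
  rewrite [cell B k' j]mxE -/D /cell_coef [X in _ && X]eq_sym -Ek (inj_eq enum_val_inj) (negbTE nk).
  by rewrite andbF mulr0.
rewrite addr0 (cellE i TA TBD l Ek) [cell B k j]mxE -/D /cell_coef l eqxx -Ek eqxx /=.
rewrite dcompA //; case: ifP => _; last by rewrite mul0r mulr0.
rewrite mulrACA -exprD -expfzDr // mulrA -exprD nloops_cocycle //.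
by rewrite [(nloops A _ + _)%N]addnC addrA subrK.
Qed.

Lemma cell_low D : inTL D -> (nvert D < t)%N -> cell D = 0.
Proof.
move=> TD lt; apply/matrixP => i j; rewrite !mxE /cell_coef ifN // negb_and; apply/orP; left.
by rewrite neq_ltn (leq_ltn_trans (nvert_dcomp_l _ _) lt).
Qed.

Let Te := base_inTL lt_m.
Let le := pattern_level lt_m (@base_pattern n m).

Variable k0 : 'I_#|G|.
Hypothesis Ek0 : enum_val k0 = rowInv e true.
Local Notation u := (delta_mx k0 0 : 'cV[K]_#|G|).

Lemma cell_base x : exists a, cell e *m x = a *: u.
Proof.
exists ((cell e *m x) k0 0); apply/colP => i; rewrite !mxE eqxx andbT.
have [->|ni] := eqVneq i k0; first by rewrite mulr1.
rewrite mulr0; apply: big1 => j _; rewrite mxE /cell_coef; case: ifP => [/andP[/eqP l /eqP E]|]; last by rewrite mul0r.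
case/eqP: ni; apply: enum_val_inj; rewrite -E Ek0.
by apply: same_row_rowInv; apply: dcomp_same_top; rewrite l le.
Qed.

Lemma cell_col A : inTL A -> cell A *m u = \col_i cell_coef A e (enum_val i).
Proof. by move=> TA; apply/colP => i; rewrite -colE !mxE -(cellE i TA Te le Ek0) mxE. Qed.

Lemma cell_act A D : inTL A -> dcomp A e = D -> nvert D = t -> forall k, enum_val k = rowInv D true ->
  cell A *m u = (q ^+ nloops A e * gam ^ (delta D)) *: delta_mx k 0.
Proof.
move=> TA ED lD k Ek; rewrite cell_col //; apply/colP => i; rewrite !mxE /cell_coef ED lD eqxx.
rewrite delta_base subr0 -Ek (inj_eq enum_val_inj) eq_sym eqxx andbT /=.
by case: eqP; rewrite ?mulr1 ?mulr0.
Qed.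

Lemma cell_gamma y : gamma m y -> cell y *m u = (q ^+ nloops e e * gam ^ (delta y)) *: u.
Proof.
move=> gy; have nl : nloops y e = nloops e e.
  by apply: nloops_same_row (gamma_bot gy) _; exact: same_row_refl.
rewrite (@cell_act _ y (gamma_inTL gy) (gamma_base_r lt_m gy) _ k0) ?nl //.
  exact: pattern_level (gamma_top gy).
by rewrite Ek0; apply: same_row_rowInv; apply: (gamma_same_top gy); exact: base_pattern.
Qed.

(** Every row with [t] strands is mutual to the standard one, so some diagram takes [u] to a nonzero
    multiple of its basis vector. *)
Lemma cell_cyclic (S : 'cV[K]_#|G| -> Prop) : (forall a x y, S x -> S y -> S (a *: x + y)) ->
  (forall D x, inTL D -> S x -> S (cell D *m x)) -> S u -> forall w, S w.
Proof.
move=> SD Srho Su w; have S0 : S 0.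
  by have := SD (-1) u u Su Su; rewrite scaleN1r addNr.
have Sb (k : 'I_#|G|) : S (delta_mx k 0).
  have [TS lS ES] := DSP (enum_valP k); have [D' [m' [mu lt' P']]] := pattern_exists TS.
  have lD' := mutual_nvert TS mu; have Em : m' = m.
    by have := pattern_nvert (ltnW lt') P'; rewrite lD' lS; lia.
  have TD' := mutual_inTL TS mu; subst m'; case: mu => _ [X TX EX].
  have st := dcomp_same_row X (pattern_same_row P' (@base_pattern n m)); rewrite EX in st.
  have coef0 : q ^+ nloops X e * gam ^ delta (dcomp X e) != 0.
    by rewrite mulf_neq0 ?expf_neq0 ?expfz_neq0.
  have Ek : enum_val k = rowInv (dcomp X e) true by rewrite (same_row_rowInv st) ES.
  have act := cell_act TX erefl (etrans (same_row_nvert st) lS) Ek.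
  rewrite -[delta_mx k 0]scale1r -(mulVf coef0) -scalerA -act -[_ *: _]addr0.
  by apply: SD => //; exact: Srho.
rewrite [w]matrix_sum_delta; apply: (big_ind S) => [//|x y Sx Sy|i _].
  by rewrite -[x]scale1r; exact: SD.
by rewrite big_ord1 -[_ *: _]addr0; exact: SD.
Qed.

End Module.
End Cell.

(** * The trivial representation, and the bijection with pairs (alpha, t) *)

Section Classification.
Variable n : odd_nat.
Let n_odd : odd n := odd_nat_odd n.
Let n_ge3 : (3 <= n)%N := odd_nat_ge3 n.
Variables (K : closedFieldType) (v : K).
Hypothesis q_neq0 : qtwo v != 0.
Implicit Types (A B D X : rdiag n) (i : 'I_n) (d t : nat).
Local Notation q := (qtwo v).

Lemma dE_dcomp_nvert i D : inTL D -> (nvert (dcomp (dE i) D) < n)%N.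
Proof.
move=> TD; have TC := inTL_E i TD.
rewrite -[X in (_ < X)%N]card_ord; apply: proper_card; rewrite properE subset_predT /=.
apply/subsetPn; exists i => //; rewrite !inE -partner_ord partner_dcomp_dE; last exact: inTL_wf.
rewrite stepf_in ?sw_row //.
by have := @inS_l n i 0; rewrite mul0r addr0.
Qed.

Lemma inTL_nvert D : inTL D -> D = did n \/ (nvert D < n)%N.
Proof. by case=> [|i {}D TD]; [left | right; exact: dE_dcomp_nvert]. Qed.

Lemma dE_neq_did i : dE i <> did n.
Proof.
move=> E; have := partner_dE i ((i : nat)%:Z, true); rewrite E partner_did stepf_in.
  by move/(congr1 snd); rewrite sw_row.
by have := @inS_l n i 0; rewrite mul0r addr0.
Qed.

Lemma rep_dE0 d (rho : rdiag n -> 'M[K]_d) D : is_rep v rho -> (forall i, rho (dE i) = 0) ->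
  inTL D -> D = did n \/ rho D = 0.
Proof.
move=> repr E0 [|i {}D TD]; [by left | right].
by rewrite (rep_dcomp q_neq0 repr) ?E0 ?mul0mx ?scaler0 //; exact: inTL_dE.
Qed.

Lemma trivial_rep_exists : exists rho : rdiag n -> 'M[K]_1, irrep v rho /\ trivial_rep rho.
Proof.
exists (fun D => (D == did n)%:R%:M); split; last first.
  by split=> // i; rewrite (negbTE (introN eqP (@dE_neq_did i))) raddf0.
split; [split=> [|A B TA TB]|split=> // U _].
- by rewrite eqxx.
- have [->|nA] := eqVneq A (did n).
    by rewrite dcomp_did ?nloops_did ?mul1mx ?scale1r //; exact: inTL_wf.
  rewrite raddf0 mul0mx (_ : (dcomp A B == did n) = false) ?raddf0 ?scaler0 //.
  apply/negbTE/eqP => E; case: (inTL_nvert TA) => [EA|lt]; first by rewrite EA eqxx in nA.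
  by have := nvert_dcomp_l A B; rewrite E nvert_did leqNgt lt.
- by have := rank_leq_row U; case: (\rank U) => [|[|//]]; [left | right].
Qed.

Lemma trivial_rep_unique d1 d2 (rho1 : rdiag n -> 'M[K]_d1) (rho2 : rdiag n -> 'M[K]_d2) :
  irrep v rho1 -> irrep v rho2 -> trivial_rep rho1 -> trivial_rep rho2 -> rep_iso rho1 rho2.
Proof.
move=> [r1 _] [r2 _] [E1 z1] [E2 z2]; subst d1 d2.
exists 1%:M; rewrite /row_free /row_full mxrank1 !eqxx; split=> // D TD.
have [->|ne] := eqVneq D (did n); first by rewrite (proj1 r1) (proj1 r2).
case: (rep_dE0 r1 z1 TD) => [/eqP|->]; first by rewrite (negbTE ne).
case: (rep_dE0 r2 z2 TD) => [/eqP|->]; first by rewrite (negbTE ne).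
by rewrite mul0mx mulmx0.
Qed.

Lemma rep_has_level d (rho : rdiag n -> 'M[K]_d) D : inTL D -> rho D <> 0 -> exists t, is_level rho t.
Proof.
have [s] := ubnP (nvert D); elim: s D => // s IH D lts TD nD.
case: (classic (exists D', [/\ inTL D', (nvert D' < nvert D)%N & rho D' <> 0])).
  by move=> [D' [TD' lt nD']]; apply: (IH D') => //; exact: leq_trans lt lts.
move=> none; exists (nvert D); split=> [D' TD' lt|]; last by exists D.
by apply: NNPP => nD'; apply: none; exists D'.
Qed.

(** If [m = 0], the level is [n] and every E_i acts by 0. Every line is then invariant, so the
    representation is the trivial one. *)
Lemma irrep_level d (rho : rdiag n -> 'M[K]_d) : irrep v rho -> ~ trivial_rep rho ->
  exists m, [/\ (0 < m)%N, (m.*2 < n)%N, is_level rho (n - m.*2) & rho (base n m) <> 0].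
Proof.
move=> [repr [d0 irr]] ntriv.
have id_neq0 : rho (did n) <> 0.
  rewrite (proj1 repr) => /matrixP/(_ (Ordinal d0) (Ordinal d0)) /eqP.
  by rewrite !mxE eqxx oner_eq0.
have [t lt] := rep_has_level (inTL_id n) id_neq0.
have [m [ltm Et e0]] := rep_level_base q_neq0 repr lt.
exists m; rewrite -Et; split=> //; rewrite lt0n; apply/eqP => m0; apply: ntriv.
have z i : rho (dE i) = 0.
  apply: (proj1 lt); first exact: inTL_dE.
  rewrite Et m0 subn0 -[dE i](_ : dcomp (dE i) (did n) = _); first by apply: dE_dcomp_nvert; constructor.
  apply: partner_ext => p; rewrite partner_dcomp_dE; last exact: wf_did.
  by rewrite partner_dE.
split=> //; pose U : 'M[K]_d := delta_mx (Ordinal d0) (Ordinal d0).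
have rU : \rank U = 1%N by rewrite mxrank_delta.
case: (irr U) => [D TD||<-//]; last by rewrite rU.
case: (rep_dE0 repr z TD) => ->; last by rewrite trmx0 mulmx0 sub0mx.
by rewrite (proj1 repr) trmx1 mulmx1.
Qed.

Lemma rep_iso_invariants d1 d2 (rho1 : rdiag n -> 'M[K]_d1) (rho2 : rdiag n -> 'M[K]_d2) t alpha :
  rep_iso rho1 rho2 -> is_level rho1 t -> is_alpha rho1 t alpha ->
  is_level rho2 t /\ is_alpha rho2 t alpha.
Proof.
move=> [P [/row_freeP[Q' PQ'] /row_fullP[Q QP] HP]] [low [D0 [T0 l0 n0]]] al.
have conj D : inTL D -> rho2 D = Q *m (rho1 D *m P).
  by move=> TD; rewrite HP // mulmxA QP mul1mx.
split; [split=> [D TD lt|]|move=> D D' TD TD' lD rt rb dw].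
- by rewrite conj // low // mul0mx mulmx0.
- exists D0; split=> // E; apply: n0.
  by rewrite -[rho1 D0]mulmx1 -PQ' mulmxA HP // E mulmx0 mul0mx.
- by rewrite !conj // (al D D') // -scalemxAl -scalemxAr.
Qed.

(** On a vector [u] with [e u = c u], the product of [e] and [D] acts by a scalar computed from [D]
    and [alpha] alone, so [u1] and [u2] are linked. *)
Lemma injectivity d1 d2 (rho1 : rdiag n -> 'M[K]_d1) (rho2 : rdiag n -> 'M[K]_d2) t alpha :
  irrep v rho1 -> irrep v rho2 -> ~ trivial_rep rho1 -> ~ trivial_rep rho2 ->
  is_level rho1 t -> is_level rho2 t -> is_alpha rho1 t alpha -> is_alpha rho2 t alpha ->
  rep_iso rho1 rho2.
Proof.
move=> irr1 irr2 nt1 nt2 l1 l2 a1 a2.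
have [m [m0 ltm lm e1]] := irrep_level irr1 nt1.
have Et := level_unique lm l1; subst t.
have e2 : rho2 (base n m) <> 0.
  have [m' [lt' Em e2]] := rep_level_base q_neq0 (proj1 irr2) l2.
  by have -> : m = m' by lia.
have low1 := proj1 l1; have low2 := proj1 l2.
have s1 := is_alpha_shift_scalar ltm a1; have s2 := is_alpha_shift_scalar ltm a2.
have a0 := shift_scalar_neq0 ltm m0 e1 s1.
have [u1 u10 E1] := exists_base_vector irr1 ltm e1.
have [u2 u20 E2] := exists_base_vector irr2 ltm e2.
apply: (linked_iso q_neq0 irr1 irr2 u10 u20 E1 E2) => D TD.
have [a [y [gy Ha]]] := corner_gamma v ltm TD.
have [k dk] := gamma_delta ltm gy.
have c0 : q ^+ nloops (base n m) (base n m) != 0 by exact: expf_neq0.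
have key d (rho : rdiag n -> 'M[K]_d) (u : 'cV_d) : is_rep v rho ->
    (forall D, inTL D -> (nvert D < n - m.*2)%N -> rho D = 0) ->
    shift_scalar rho m alpha -> rho (base n m) *m u = q ^+ nloops (base n m) (base n m) *: u ->
    rho (base n m) *m (rho D *m u) = (a * alpha ^ k) *: u.
  move=> repr low sh Eu; apply: (scalerI c0).
  rewrite scalemxAr scalemxAr -Eu !mulmxA (Ha d rho repr low) (shift_scalar_value ltm m0 a0 sh gy dk).
  by rewrite scalerA -scalemxAl Eu !scalerA mulrC.
exists (a * alpha ^ k); split.
  exact: key (proj1 irr1) low1 s1 E1.
exact: key (proj1 irr2) low2 s2 E2.
Qed.

Lemma irrep_invariants d (rho : rdiag n -> 'M[K]_d) : irrep v rho -> ~ trivial_rep rho ->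
  exists (t : nat) (alpha : K),
    [/\ is_level rho t, (forall t', is_level rho t' -> t' = t),
        alpha != 0, is_alpha rho t alpha
      & forall alpha', is_alpha rho t alpha' -> alpha' = alpha] /\
    [/\ odd t, (1 <= t)%N & (t <= n - 2)%N].
Proof.
move=> irr nt; have [m [m0 ltm lm e0]] := irrep_level irr nt.
have [alpha sh] := exists_shift_scalar ltm m0 q_neq0 irr (proj1 lm) e0.
exists (n - m.*2)%N, alpha; split; last by split; lia.
split=> // [t'||  |alpha' al].
- exact: level_unique.
- exact: shift_scalar_neq0 sh.
- exact: (shift_scalar_is_alpha ltm m0 q_neq0 irr).
- by apply: (shift_scalar_unique ltm m0 e0 sh); exact: is_alpha_shift_scalar.
Qed.

Lemma closed_root (k : nat) (a : K) : (0 < k)%N -> exists x, x ^+ k = a.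
Proof.
move=> k0; have /closed_rootP[x] : size ('X^k - a%:P) != 1%N.
  by rewrite size_XnsubC // eqSS -lt0n.
by rewrite /root !hornerE subr_eq0 => /eqP; exists x.
Qed.

Lemma surjectivity t (alpha : K) : odd t -> (1 <= t)%N -> (t <= n - 2)%N -> alpha != 0 ->
  exists d (rho : rdiag n -> 'M[K]_d),
    [/\ irrep v rho, ~ trivial_rep rho, is_level rho t & is_alpha rho t alpha].
Proof.
move=> ot t0 tn a0.
have [m [m0 ltm ->]] : exists m, [/\ (0 < m)%N, (m.*2 < n)%N & t = (n - m.*2)%N].
  by exists (n - t)./2; split; lia.
have n2 : (0 < 2 * n)%N by lia.
(* A displacement of [2n] has to act by [alpha], so a unit displacement is made to act by a 2n-th
   root. *)
have [gam Egam] := closed_root alpha n2.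
have gam0 : gam != 0.
  by apply: contraNneq a0 => g0; rewrite -Egam g0 expr0n (gtn_eqF n2).
pose good (S : {ffun 'I_n -> 'I_n}) (D : rdiag n) :=
  [/\ inTL D, nvert D = (n - m.*2)%N & rowInv D true = S].
have [G HG] := finite_pred (fun S => exists D, good S D).
have /fin_all_exists[DS HDS] (S : {ffun 'I_n -> 'I_n}) : exists D, S \in G -> good S D.
  case SG: (S \in G); last by exists (did n).
  by have [D HD] := (HG S).1 SG; exists D.
have memG D : inTL D -> nvert D = (n - m.*2)%N -> rowInv D true \in G.
  by move=> TD lD; apply/HG; exists D.
have Te := base_inTL ltm; have le := pattern_level ltm (@base_pattern n m).
have [k0 Ek0] := cell_index memG Te le.
set e := base n m in Te le Ek0; pose M := cell v m gam G DS.
have repM : is_rep v M := cell_rep v gam0 memG HDS.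
have MM A B x : inTL A -> inTL B -> M A *m (M B *m x) = q ^+ nloops A B *: (M (dcomp A B) *m x).
  by move=> TA TB; rewrite mulmxA (proj2 repM) // -scalemxAl.
pose u : 'cV[K]_#|G| := delta_mx k0 0; pose c := q ^+ nloops e e.
have c0 : c != 0 by exact: expf_neq0.
have Mgam y : gamma m y -> M y *m u = (c * gam ^ delta y) *: u.
  by move=> gy; exact: cell_gamma.
have Mbase x : exists a, M e *m x = a *: u by exact: cell_base.
have Mcyc := cell_cyclic q_neq0 ltm gam0 HDS Ek0.
have Me : M e *m u = c *: u.
  by rewrite Mgam ?delta_base ?expr0z ?mulr1 //; exact: base_gamma.
(* The radical of the cell module: the largest submodule on which [e] acts by 0. *)
have linS : linear_pred (fun x : 'rV_#|G| => forall D, inTL D -> M e *m (M D *m x^T) = 0).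
  split=> [D _|a x y Sx Sy D TD]; first by rewrite trmx0 !mulmx0.
  by rewrite linearP /= !mulmxDr -!scalemxAr Sx // Sy // scaler0 addr0.
have [U HU] := linear_pred_submx linS.
have invU D : inTL D -> (U *m (M D)^T <= U)%MS.
  move=> TD; apply/row_subP => i; rewrite row_mul; apply/HU => D' TD'.
  rewrite trmx_mul trmxK (MM _ D' D) // -scalemxAr (HU _).1 ?scaler0 //; first exact: row_sub.
  exact: inTL_dcomp.
have [k [C [rho [repr RC memU [L LC]]]]] := quotient_rep repM invU (@inTL_dcomp n).
have uC0 : u^T *m C != 0.
  rewrite -memU; apply/negP => /HU/(_ _ (inTL_id n)).
  rewrite trmxK (proj1 repM) mul1mx Me => /eqP; rewrite scaler_eq0 (negbTE c0) /=.
  by move=> /eqP/colP/(_ k0)/eqP; rewrite !mxE !eqxx oner_eq0.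
have act D (x : 'rV_#|G|) : inTL D -> x *m C *m (rho D)^T = (M D *m x^T)^T *m C.
  by move=> TD; rewrite trmx_mul trmxK -!mulmxA RC.
have low D : inTL D -> (nvert D < n - m.*2)%N -> rho D = 0.
  move=> TD lt; apply: trmx_inj; rewrite trmx0 -[LHS]mul1mx -LC -mulmxA -RC //.
  by rewrite /M cell_low // trmx0 mul0mx mulmx0.
have actg y : gamma m y -> u^T *m C *m (rho y)^T = (c * gam ^ delta y) *: (u^T *m C).
  move=> gy; rewrite act ?trmxK ?Mgam //; last exact: gamma_inTL gy.
  by rewrite linearZ /= -scalemxAl.
have e0 : rho e <> 0.
  move=> E; have := actg e (base_gamma ltm); rewrite E trmx0 mulmx0 delta_base expr0z mulr1.
  by move/esym/eqP; rewrite scaler_eq0 (negbTE c0) (negbTE uC0).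
have irr : irrep v rho.
  split=> //; split.
    by rewrite lt0n; apply/eqP => k00; move: uC0; subst k; rewrite thinmx0 eqxx.
  move=> V invV; pose S (x : 'cV_#|G|) := (x^T *m C <= V)%MS.
  have SD a x y : S x -> S y -> S (a *: x + y).
    rewrite /S linearP /= mulmxDl -scalemxAl => Sx Sy.
    by apply: addmx_sub => //; exact: scalemx_sub.
  have SM D x : inTL D -> S x -> S (M D *m x).
    move=> TD Sx; rewrite /S -[x]trmxK -act //; apply: submx_trans (invV D TD).
    exact: submxMr.
  have liftV (y : 'rV_k) : y = (y *m L)^T^T *m C by rewrite trmxK -mulmxA LC mulmx1.
  (* If the preimage of [V] contains [u], it is everything. Otherwise e TL sends it to multiples of
     [u] lying in it, that is to 0, so it lies in the radical and [V = 0]. *)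
  case: (classic (S u)) => [Su|nSu]; [right|left].
    apply/eqP; rewrite -/(row_full V) -sub1mx; apply/row_subP => i.
    by rewrite (liftV (row i _)); exact: (Mcyc S SD SM Su).
  apply/eqP; rewrite mxrank_eq0; apply/eqP/row_matrixP => i; rewrite row0.
  set y := row i V; have yV : (y <= V)%MS by exact: row_sub.
  have Sy : S (y *m L)^T by rewrite /S -liftV.
  rewrite (liftV y); apply/eqP; rewrite -memU; apply/HU => D TD; rewrite trmxK.
  have [a Ea] := Mbase (M D *m (y *m L)^T).
  have [a00|na] := eqVneq a 0; first by rewrite Ea a00 scale0r.
  case: nSu; rewrite -[u]scale1r -(mulVf na) -scalerA -Ea -[_ *: _]addr0.
  apply: SD; last by rewrite /S trmx0 mul0mx sub0mx.
  exact: SM Te (SM _ _ TD Sy).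
have lvl : is_level rho (n - m.*2) by split=> //; exists e; rewrite le.
have nt : ~ trivial_rep rho.
  move=> [_ z]; case: (rep_dE0 repr z Te) => // E; move: le; rewrite E nvert_did; lia.
exists k, rho; split=> //.
have [al sh] := exists_shift_scalar ltm m0 q_neq0 irr low e0.
(* Both scalars are read off from the image of [u], on which the shift by [2n] acts as [gam ^ (2n)],
   up to the factor [c]. *)
suff -> : alpha = al by exact: (shift_scalar_is_alpha ltm m0 q_neq0 irr).
have [y gy dy] := gamma_shift ltm m0 1; have ge := base_gamma ltm.
have := actg y gy; rewrite (sh e y ge gy) ?delta_base ?dy; last by lia.
rewrite linearZ /= -scalemxAr (actg e ge) delta_base expr0z mulr1 scalerA => /eqP.
rewrite -subr_eq0 -scalerBl scaler_eq0 (negbTE uC0) orbF subr_eq0 mulrC => /eqP/(mulfI c0) ->.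
by rewrite mul1r -Egam.
Qed.

End Classification.

(** [v + v^-1 = 0] would make [v] a root of X^2 + 1. *)
Lemma qtwo_neq0 (K : closedFieldType) (F : fieldType) (iota : {rmorphism F -> K}) (v : K) :
  (forall p : {poly F}, p != 0 -> (map_poly iota p).[v] != 0) -> qtwo v != 0.
Proof.
move=> transc; have v0 : v != 0.
  by have := transc 'X; rewrite polyX_eq0 map_polyX hornerX => ->.
have := transc ('X^2 + 1); rewrite rmorphD rmorph1 /= map_polyXn !hornerE => v2.
have {}v2 : v ^+ 2 + 1 != 0.
  by apply: v2; rewrite -size_poly_eq0 size_polyDl size_polyXn // size_poly1.
by rewrite /qtwo; apply: contraNneq v2 => E; rewrite expr2 -(divff v0) -mulrDr E mulr0.
Qed.

Theorem theorem4p1p3 (n : nat) (n_odd : odd n) (n_ge3 : (3 <= n)%N)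
  (K : closedFieldType) (F : fieldType) (iota : {rmorphism F -> K}) (v : K)
  (v_transc : forall p : {poly F}, p != 0 -> (map_poly iota p).[v] != 0) :
  [/\
   (* the trivial representation is a (finite-dim.) irreducible representation *)
   (exists rho : rdiag n -> 'M[K]_1, irrep v rho /\ trivial_rep rho) /\
   (* and it is unique up to isomorphism *)
   (forall (d1 d2 : nat) (rho1 : rdiag n -> 'M[K]_d1) (rho2 : rdiag n -> 'M[K]_d2),
      irrep v rho1 -> irrep v rho2 -> trivial_rep rho1 -> trivial_rep rho2 ->
      rep_iso rho1 rho2),
   (* every nontrivial irrep has a unique t and a unique nonzero alpha, with
      t odd, 1 <= t <= n - 2 *)
   (forall (d : nat) (rho : rdiag n -> 'M[K]_d),
      irrep v rho -> ~ trivial_rep rho ->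
      exists (t : nat) (alpha : K),
        [/\ is_level rho t, (forall t', is_level rho t' -> t' = t),
            alpha != 0, is_alpha rho t alpha
          & forall alpha', is_alpha rho t alpha' -> alpha' = alpha] /\
        [/\ odd t, (1 <= t)%N & (t <= n - 2)%N]),
   (* (alpha, t) only depends on the isomorphism class *)
   (forall (d1 d2 : nat) (rho1 : rdiag n -> 'M[K]_d1) (rho2 : rdiag n -> 'M[K]_d2)
      (t : nat) (alpha : K),
      irrep v rho1 -> irrep v rho2 -> rep_iso rho1 rho2 ->
      is_level rho1 t -> is_alpha rho1 t alpha ->
      is_level rho2 t /\ is_alpha rho2 t alpha),
   (* injectivity *)
   (forall (d1 d2 : nat) (rho1 : rdiag n -> 'M[K]_d1) (rho2 : rdiag n -> 'M[K]_d2)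
      (t : nat) (alpha : K),
      irrep v rho1 -> irrep v rho2 -> ~ trivial_rep rho1 -> ~ trivial_rep rho2 ->
      is_level rho1 t -> is_level rho2 t ->
      is_alpha rho1 t alpha -> is_alpha rho2 t alpha ->
      rep_iso rho1 rho2)
   & (* surjectivity *)
   (forall (t : nat) (alpha : K),
      odd t -> (1 <= t)%N -> (t <= n - 2)%N -> alpha != 0 ->
      exists (d : nat) (rho : rdiag n -> 'M[K]_d),
        [/\ irrep v rho, ~ trivial_rep rho, is_level rho t & is_alpha rho t alpha])].
Proof.
have q0 := qtwo_neq0 v_transc; pose N := OddNat n_odd n_ge3; split.
- split; first exact: (@trivial_rep_exists N).
  exact: (@trivial_rep_unique N).
- exact: (@irrep_invariants N).
- move=> d1 d2 rho1 rho2 t alpha _ _; exact: (@rep_iso_invariants N).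
- exact: (@injectivity N _ _ q0).
- exact: (@surjectivity N).
Qed.
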